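(* Let $V$ be a Banach $\mathbb O$-bimodule, $T\in\mathscr B_{\mathcal{RO}}(V)$ power-associative, $U\subseteq\mathbb O$ a $T$-left-admissible domain, $J\in\mathbb S$ and $m\in\mathbb N$. Then $$\frac1{2\pi}\int_{\partial(U\cap\mathbb C_J)}(R_s-T)^{\circledcirc-}\odot(ds_J\,s^m)=T^m.$$
   Context: $\mathbb O$ is the real octonion algebra with basis $e_0=1,\dots,e_7$, conjugation $\bar x$, norm $|x|$; $\mathbb S=\{J:J^2=-1\}$, $\mathbb C_J=\mathbb R+\mathbb RJ$. An $\mathbb O$-bimodule is a real vector space $M$ with real-bilinear left and right multiplications by $\mathbb O$ (with $1x=x1=x$) whose associators $[p,q,x]=(pq)x-p(qx)$, $[p,x,q]=(px)q-p(xq)$, $[x,p,q]=(xp)q-x(pq)$ satisfy $[p,q,x]=[q,x,p]=[x,p,q]=-[q,p,x]$. $\operatorname{Re}M=\{m: pm=mp,\ [p,q,m]=0\ \forall p,q\}$; every $x=\sum_ix_ie_i$ uniquely with $x_i\in\operatorname{Re}M$, $\operatorname{Re}x:=x_0$. A Banach $\mathbb O$-bimodule has a complete norm with $\|px\|=\|xp\|=|p|\|x\|$. $\mathscr B_{\mathbb R}(V)$: bounded real-linear operators, ordinary powers; invertible means in $\mathscr B_{\mathbb R}(V)$; $R_sv=vs$. $B_p(f,x)=f(x)p-f(xp)$; $\mathscr B_{\mathcal{RO}}(V)$: bounded real-linear $f$ with $\operatorname{Re}B_p(f,x)=0\ \forall p,x$; it is a Banach $\mathbb O$-bimodule (operator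 norm) via $(p\odot f)(x)=pf(x)+B_p(f,x)$, $(f\odot p)(x)=f(px)-B_p(f,x)$. $T$ is power-associative if $T^n\in\mathscr B_{\mathcal{RO}}(V)$ for all $n$. For invertible $S$, $S^{\circledcirc-}=\operatorname{ext}(S^{-1}|_{\operatorname{Re}V})$ with $(\operatorname{ext}h)(\sum x_ie_i)=\sum h(x_i)e_i$. $S$ is $\mathbb C_J$-extendable power associative if $S^n(v\lambda)=S^n(v)\lambda$ for $n\ge1,v\in\operatorname{Re}V,\lambda\in\mathbb C_J$; $\rho_J^*(T)=\{s\in\mathbb C_J:R_s-T$ invertible and $(R_s-T)^{-1}$ $\mathbb C_J$-extendable power associative$\}$, $\sigma^*(T)=\mathbb O\setminus\bigcup_J\rho^*_J(T)$. $U\subseteq\mathbb O$ is axially symmetric if $x+yI\in U$ ($x,y\in\mathbb R$, $I\in\mathbb S$) implies $x+yK\in U$ for all $K\in\mathbb S$; it is a slice domain if it is a domain, $U\cap\mathbb R\ne\emptyset$ and each $U\cap\mathbb C_K$ is a domain in $\mathbb C_K$. $U$ is $T$-left-admissible if it is an axially symmetric slice domain containing $\sigma^*(T)$ such that for every $K\in\mathbb S$, $\partial(U\cap\mathbb C_K)$ is a finite union of continuously differentiable Jordan curves. Integrals over $\partial(U\cap\mathbb C_J)$ are taken with positive orientation: if $s:[a,b]\to\mathbb C_J$ is a piecewise $C^1$ parametrization, $ds_J:=-ds\,J$ and $\int F(s)\odot(ds_Jh(s)):=\int_a^bF(s(t))\odot\big(-s'(t)Jh(s(t))\big)dt$ (Bochner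 integral in $\mathscr B_{\mathcal{RO}}(V)$).
   Formalization: The boundary curves must have total winding number 1 about points of U∩C_J and 0 about points outside its closure, which forces U∩C_J to be bounded; for unbounded U (e.g. U=O, T=0, m=0) the stated identity fails. *)

(* Defs.v *)
From HB Require Import structures.
From mathcomp Require Import all_boot all_order all_algebra.
From mathcomp Require Import all_classical all_reals all_analysis.
Set Implicit Arguments. Unset Strict Implicit. Unset Printing Implicit Defensive.
Import Order.TTheory GRing.Theory Num.Theory.
Import numFieldNormedType.Exports.
Local Open Scope classical_set_scope.
Local Open Scope ring_scope.

Section Octonions.
Variable R : realType.

Definition oct := 'rV[R]_8.

Definition obasis (i : 'I_8) : oct := delta_mx 0 i.
Definition one_o : oct := obasis ord0.

(** Multiplication table (Baez's convention: e_i e_{i+1} = e_{i+3}, indices mod 7). *)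
Definition fano : seq (nat * nat * nat) :=
  [:: (1,2,4); (2,3,5); (3,4,6); (4,5,7); (5,6,1); (6,7,2); (7,1,3)]%N.
Definition cyc (i j k : nat) : bool :=
  has (fun t => let: (a, b, c) := t in
        [|| (i, j, k) == (a, b, c), (i, j, k) == (b, c, a) | (i, j, k) == (c, a, b)]) fano.
Definition octc (i j k : nat) : R :=
  if i == 0%N then (j == k)%:R
  else if j == 0%N then (i == k)%:R
  else if i == j then - (k == 0%N)%:R
  else if cyc i j k then 1 else if cyc j i k then -1 else 0.

Definition omul (x y : oct) : oct :=
  \row_(k < 8) \sum_(i < 8) \sum_(j < 8) x 0 i * y 0 j * octc i j k.

(** ordinary powers s^m (left multiplication; octonions are power-associative) *)
Definition opow (s : oct) (m : nat) : oct := iter m (omul s) one_o.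

Definition onorm (x : oct) : R := Num.sqrt (\sum_(i < 8) x 0 i ^+ 2).

Definition in_S (J : oct) : Prop := omul J J = - one_o.

Definition cJ (J : oct) (x y : R) : oct := x *: one_o + y *: J.
Definition in_CJ (J : oct) (s : oct) : Prop := exists x y : R, s = cJ J x y.

Definition sliceJ (U : set oct) (J : oct) : set (R * R) := [set p | U (cJ J p.1 p.2)].

Definition bdry (A : set (R * R)) : set (R * R) := closure A `\` interior A.

Record pcurve := PCurve { ca : R; cb : R; cx : R -> R; cy : R -> R }.

Definition C1_jordan (c : pcurve) : Prop :=
  ca c < cb c /\
  (forall t, derivable (cx c) t 1) /\ (forall t, derivable (cy c) t 1) /\
  continuous (derive1 (cx c)) /\ continuous (derive1 (cy c)) /\
  cx c (ca c) = cx c (cb c) /\ cy c (ca c) = cy c (cb c) /\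
  (forall t u, ca c <= t < cb c -> ca c <= u < cb c ->
     (cx c t, cy c t) = (cx c u, cy c u) -> t = u).

Definition curve_img (c : pcurve) : set (R * R) :=
  [set z | exists2 t, ca c <= t <= cb c & z = (cx c t, cy c t)].

Definition tagged_part (a b : R) (p tg : seq R) (d : R) : Prop :=
  size p = (size tg).+1 /\ p`_0 = a /\ p`_(size tg) = b /\
  (forall i, (i < size tg)%N ->
     p`_i <= tg`_i <= p`_i.+1 /\ 0 < p`_i.+1 - p`_i < d).

Definition is_rint (f : R -> R) (a b l : R) : Prop :=
  forall e, 0 < e -> exists2 d, 0 < d & forall p tg, tagged_part a b p tg d ->
    `| \sum_(i < size tg) (p`_i.+1 - p`_i) * f tg`_i - l | < e.

Definition wind_integrand (c : pcurve) (z : R * R) (t : R) : R :=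
  ((cx c t - z.1) * (derive1 (cy c)) t - (cy c t - z.2) * (derive1 (cx c)) t) /
  ((cx c t - z.1) ^+ 2 + (cy c t - z.2) ^+ 2).

(** the family cs (finitely many C^1 Jordan curves) parametrizes the boundary of D,
    and is positively oriented: total winding number 1 around points of D,
    0 around points outside the closure of D *)
Definition pos_bdry_param (D : set (R * R)) (n : nat) (cs : 'I_n -> pcurve) : Prop :=
  (forall k, C1_jordan (cs k)) /\
  bdry D = \bigcup_(k in [set: 'I_n]) curve_img (cs k) /\
  (forall z, ~ bdry D z -> exists w : 'I_n -> R,
     (forall k, is_rint (wind_integrand (cs k) z) (ca (cs k)) (cb (cs k)) (w k)) /\
     \sum_(k < n) w k = (if pselect (D z) then 2 * pi else 0)).

End Octonions.

Section Bimodule.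
Variable R : realType.
Variable V : completeNormedModType R.
Variable lm : oct R -> V -> V.
Variable rm : V -> oct R -> V.

Definition assoc_ppx (p q : oct R) (x : V) : V := lm (omul p q) x - lm p (lm q x).
Definition assoc_pxq (p : oct R) (x : V) (q : oct R) : V := rm (lm p x) q - lm p (rm x q).
Definition assoc_xpq (x : V) (p q : oct R) : V := rm (rm x p) q - rm x (omul p q).

Definition banach_O_bimodule : Prop :=
  (forall p x y, lm p (x + y) = lm p x + lm p y) /\
  (forall p q x, lm (p + q) x = lm p x + lm q x) /\
  (forall (r : R) p x, lm (r *: p) x = r *: lm p x) /\
  (forall (r : R) p x, lm p (r *: x) = r *: lm p x) /\
  (forall p x y, rm (x + y) p = rm x p + rm y p) /\
  (forall p q x, rm x (p + q) = rm x p + rm x q) /\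
  (forall (r : R) p x, rm x (r *: p) = r *: rm x p) /\
  (forall (r : R) p x, rm (r *: x) p = r *: rm x p) /\
  (forall x, lm (one_o R) x = x) /\ (forall x, rm x (one_o R) = x) /\
  (forall p q x,
     assoc_ppx p q x = assoc_pxq q x p /\
     assoc_pxq q x p = assoc_xpq x p q /\
     assoc_xpq x p q = - assoc_ppx q p x) /\
  (forall p x, `| lm p x | = onorm p * `| x |) /\
  (forall p x, `| rm x p | = onorm p * `| x |).

Definition ReV (m : V) : Prop :=
  (forall p, lm p m = rm m p) /\ (forall p q, assoc_ppx p q m = 0).

(** decomposition x = sum_i x_i e_i with x_i in Re V (it exists and is unique) *)
Definition decomp (x : V) (xs : 'I_8 -> V) : Prop :=
  (forall i, ReV (xs i)) /\ x = \sum_(i < 8) rm (xs i) (obasis R i).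

Definition ocomp (x : V) : 'I_8 -> V :=
  match pselect (exists xs, decomp x xs) with
  | left H => proj1_sig (cid H)
  | right _ => fun _ => 0
  end.

Definition ReP (x : V) : V := ocomp x ord0.

Definition bdd_lin (f : V -> V) : Prop :=
  (forall x y, f (x + y) = f x + f y) /\ (forall (r : R) x, f (r *: x) = r *: f x) /\
  (exists C : R, forall x, `| f x | <= C * `| x |).

Definition Bp (f : V -> V) (p : oct R) (x : V) : V := rm (f x) p - f (rm x p).

Definition in_BRO (f : V -> V) : Prop :=
  bdd_lin f /\ forall p x, ReP (Bp f p x) = 0.

Definition odot_r (f : V -> V) (p : oct R) : V -> V := fun x => f (lm p x) - Bp f p x.

Definition power_assoc (T : V -> V) : Prop := forall n, in_BRO (iter n T).

Definition invertible (S : V -> V) : Prop :=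
  exists g, bdd_lin g /\ cancel S g /\ cancel g S.

Definition opinv (S : V -> V) : V -> V :=
  match pselect (exists g, bdd_lin g /\ cancel S g /\ cancel g S) with
  | left H => proj1_sig (cid H)
  | right _ => id
  end.

Definition ext (h : V -> V) : V -> V :=
  fun x => \sum_(i < 8) rm (h (ocomp x i)) (obasis R i).

Definition circ_inv (S : V -> V) : V -> V := ext (opinv S).

Definition Rs (s : oct R) : V -> V := fun v => rm v s.

Definition RsT (T : V -> V) (s : oct R) : V -> V := fun v => rm v s - T v.

Definition CJ_ext_pa (J : oct R) (S : V -> V) : Prop :=
  forall n, (0 < n)%N -> forall v, ReV v -> forall lam, in_CJ J lam ->
    iter n S (rm v lam) = rm (iter n S v) lam.

Definition rhoJ (T : V -> V) (J : oct R) (s : oct R) : Prop :=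
  in_CJ J s /\ invertible (RsT T s) /\ CJ_ext_pa J (opinv (RsT T s)).

Definition sigmaS (T : V -> V) (s : oct R) : Prop :=
  ~ (exists J, in_S J /\ rhoJ T J s).

Definition axially_symmetric (U : set (oct R)) : Prop :=
  forall (x y : R) (I : oct R), in_S I -> U (cJ I x y) ->
    forall K, in_S K -> U (cJ K x y).

Definition slice_domain (U : set (oct R)) : Prop :=
  open U /\ connected U /\ (exists r : R, U (r *: one_o R)) /\
  forall K, in_S K -> open (sliceJ U K) /\ connected (sliceJ U K).

Definition left_admissible (T : V -> V) (U : set (oct R)) : Prop :=
  axially_symmetric U /\ slice_domain U /\ (forall s, sigmaS T s -> U s) /\
  forall K, in_S K -> exists n (cs : 'I_n -> pcurve R),
    (forall k, C1_jordan (cs k)) /\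
    bdry (sliceJ U K) = \bigcup_(k in [set: 'I_n]) curve_img (cs k).

Definition is_oint (F : R -> V -> V) (a b : R) (L : V -> V) : Prop :=
  forall e, 0 < e -> exists2 d, 0 < d & forall p tg, tagged_part a b p tg d ->
    forall v, `| \sum_(i < size tg) (p`_i.+1 - p`_i) *: F tg`_i v - L v | <= e * `| v |.

Definition contour_integrand (T : V -> V) (J : oct R) (m : nat) (c : pcurve R)
  : R -> V -> V := fun t =>
  let s := cJ J (cx c t) (cy c t) in
  let s' := cJ J ((derive1 (cx c)) t) ((derive1 (cy c)) t) in
  odot_r (circ_inv (RsT T s)) (omul (omul (- s') J) (opow s m)).

End Bimodule.

(* Main.v *)
Require Import Defs.
From HB Require Import structures.
From mathcomp Require Import all_boot all_order all_algebra.
From mathcomp Require Import all_classical all_reals all_analysis.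
From mathcomp Require Import complex ring lra.
Set Implicit Arguments. Unset Strict Implicit. Unset Printing Implicit Defensive.
Import Order.TTheory GRing.Theory Num.Theory.
Import numFieldNormedType.Exports.
Local Open Scope classical_set_scope.
Local Open Scope ring_scope.

Import Normc.

(** Write [D] for the slice of [U] in [C_J]. Extending the inverse from [Re V] makes the integrand
    act on the components of [v = sum v_i e_i], so it suffices to integrate [F(s) s^m], where
    [F(s)] solves [z s - T z = x] with [x] in [Re V], in the complex structure [x |-> x J].
    Off [D] the function [F] is locally a power series: around a nonreal point this is the
    power-associativity of the resolvent, and every real point outside [D] is a limit of nonreal
    ones, since otherwise [D] would lie on both sides of a real arc of a boundary curve, across
    which the winding number of that curve jumps although it is constant on the connected set [D].

    The given curves enter only through their winding numbers. Take a fine grid on a large square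
    and the union of the cells meeting the complement of [D]; its boundary consists of edges
    inside [D] and of the outer square. Cauchy's formula expresses [F] on the curves by integrals
    over these edges; exchanging the integrations leaves the winding numbers, [1] on the inner
    edges and [0] on the outer ones. Cauchy's theorem for the same cells then replaces the inner
    edges by the outer square, where [F(s) = sum T^n x s^(-n-1)] gives [T^m x]. *)

(** [T] is only known to commute with right multiplication by [J] on [Re V], and the solutions of
    [z s - T z = x] in general leave [Re V]. What remains holds along orbits: for fixed [x] in
    [Re V], the iterates of [T], and those of the inverse of [R_s - T], at [x] commute with the
    scalars of a slice. The Laurent series at infinity and the power series at nonreal points need
    exactly this. Holomorphy is replaced by uniform approximability by vector-valued polynomials.
    For these, Cauchy's theorem on a rectangle amounts to the existence of a primitive and Cauchy's
    formula to a polynomial division, and both survive uniform limits. The exchange of integrations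
    is made on Riemann sums along the edges. The decomposition of a bimodule over its real part is
    proved as well: left multiplications by the seven imaginary units generate a representation of a
    Clifford algebra, in which everything becomes a finite sign computation. *)

Inductive mexp (K : Type) := MVar of nat | MZero | MAdd of mexp K & mexp K
  | MOpp of mexp K | MScale of K & mexp K
  | MNat of mexp K & nat.
Arguments MVar {K}. Arguments MZero {K}.

(** * Linear identities in modules by reflection *)

Section ModuleIdentities.
Variables (K : pzRingType) (M : lmodType K).

Fixpoint meval (env : seq M) (e : mexp K) : M := match e with
  | MVar n => nth 0 env n | MZero => 0 | MAdd a b => meval env a + meval env b
  | MOpp a => - meval env a | MScale c a => c *: meval env a
  | MNat a n => meval env a *+ n end.

Fixpoint mcoef (e : mexp K) (i : nat) : K := match e with
  | MVar n => if eqn n i then 1 else 0 | MZero => 0 | MAdd a b => mcoef a i + mcoef b i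
  | MOpp a => - mcoef a i | MScale c a => c * mcoef a i
  | MNat a n => n%:R * mcoef a i end.

Lemma meval_coef env e : meval env e = \sum_(i < size env) mcoef e i *: env`_i.
Proof.
elim: e => [n||a ha b hb|a ha|c a ha|a ha n] /=; rewrite ?ha ?hb.
- have [ns|ns] := ltnP n (size env); last first.
    rewrite nth_default // big1 // => i _; case: eqnP => [e|]; last by rewrite scale0r.
    by move: (ltn_ord i); rewrite -e ltnNge ns.
  rewrite (bigD1 (Ordinal ns)) //= eqnE eqxx scale1r big1 ?addr0 // => i /negPf ne.
  case: eqP => [e|]; last by rewrite scale0r.
  by move: ne; rewrite -val_eqE /= e eqxx.
- by rewrite big1 // => i _; rewrite scale0r.
- by rewrite -big_split; apply: eq_bigr => i _; rewrite scalerDl.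
- by rewrite -sumrN; apply: eq_bigr => i _; rewrite scaleNr.
- by rewrite scaler_sumr; apply: eq_bigr => i _; rewrite scalerA.
- by rewrite -sumrMnl; apply: eq_bigr => i _; rewrite mulr_natl scalerMnl.
Qed.

(** Comparing coefficients is enough; the [foldr] unfolds to one scalar equation per variable, so
    that [ring] can treat each separately. *)
Lemma mexp_eq env e1 e2 :
  foldr (fun i P => mcoef e1 i = mcoef e2 i /\ P) True (iota 0 (size env)) ->
  meval env e1 = meval env e2.
Proof.
move=> h; rewrite !meval_coef; apply: eq_bigr => i _; congr (_ *: _).
have : nat_of_ord i \in iota 0 (size env) by rewrite mem_iota add0n ltn_ord.
elim: (iota 0 (size env)) h (nat_of_ord i) => //= a s IH [h1 h2] j.
by rewrite in_cons => /orP[/eqP ->|]; [exact: h1 | exact: IH].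
Qed.

(** Reduces a consequence of a linear hypothesis [l = r] to an unconditional identity, which
    comparison of coefficients settles. *)
Lemma lin1 (l r a b : M) (c : K) : l = r -> a - b = c *: (l - r) -> a = b.
Proof. by move=> ->; rewrite subrr scaler0 => /eqP; rewrite subr_eq0 => /eqP. Qed.

End ModuleIdentities.

Ltac mfind x env :=
  match env with
  | x :: _ => constr:(Some 0%N)
  | _ :: ?t => match mfind x t with Some ?n => constr:(Some (S n)) | None => constr:(@None nat) end
  | _ => constr:(@None nat)
  end.
Ltac msnoc x env :=
  match env with
  | ?h :: ?t => let t' := msnoc x t in constr:(h :: t')
  | _ => constr:([:: x])
  end.
Ltac msize env := match env with _ :: ?t => let n := msize t in constr:(S n) | _ => constr:(0%N) end.

Ltac mreify K env e :=
  match e with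
  | GRing.add ?a ?b =>
      match mreify K env a with (?env1, ?a') =>
      match mreify K env1 b with (?env2, ?b') => constr:((env2, @MAdd K a' b')) end end
  | GRing.opp ?a => match mreify K env a with (?env1, ?a') => constr:((env1, @MOpp K a')) end
  | GRing.scale ?c ?a =>
      match mreify K env a with (?env1, ?a') => constr:((env1, @MScale K c a')) end
  | GRing.natmul ?a ?n =>
      match mreify K env a with (?env1, ?a') => constr:((env1, @MNat K a' n)) end
  | GRing.zero => constr:((env, @MZero K))
  | _ => match mfind e env with
         | Some ?n => constr:((env, @MVar K n))
         | None => let n := msize env in let env' := msnoc e env in constr:((env', @MVar K n))
         end
  end.

(* solves equations in a left module, leaving coefficientwise scalar equations *)
Ltac lmod_with K M :=
  lazymatch goal with
  | |- ?a = ?b =>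
    match mreify K (@nil M) a with (?env1, ?a') =>
    match mreify K env1 b with (?env2, ?b') =>
      change (@meval K M env2 a' = @meval K M env2 b');
      apply: mexp_eq; cbn [foldr iota size mcoef eqn];
      repeat (split; [try ring|]); try exact I
    end end
  end.

(** * Octonion multiplication table *)

(** The product of [e_i] and [e_j] is [e_k] up to sign with [k = bidx i j], and [bsgn i j] tells
    that the sign is minus. Both compute on [nat], so finite identities between units are decided by
    [vm_compute]. *)
Definition bidx (i j : nat) : nat :=
  if i == 0%N then j else if j == 0%N then i else if i == j then 0%N
  else find (fun k => cyc i j k || cyc j i k) (iota 0 8).

Definition bsgn (i j : nat) : bool :=
  if (i == 0%N) || (j == 0%N) then false else if i == j then true
  else ~~ cyc i j (bidx i j).

Section OctonionTable.
Variable R : realType.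
Implicit Types (x y p q : oct R).

Definition eb (k : nat) : oct R := obasis R (inord k).

Lemma eb_ord (i : 'I_8) : obasis R i = eb i.
Proof. by rewrite /eb inord_val. Qed.

Lemma omulDl x y p : omul (x + y) p = omul x p + omul y p.
Proof.
apply/rowP => k; rewrite !mxE -big_split; apply: eq_bigr => i _ /=.
by rewrite -big_split; apply: eq_bigr => j _ /=; rewrite !mxE; ring.
Qed.

Lemma omulDr x y p : omul p (x + y) = omul p x + omul p y.
Proof.
apply/rowP => k; rewrite !mxE -big_split; apply: eq_bigr => i _ /=.
by rewrite -big_split; apply: eq_bigr => j _ /=; rewrite !mxE; ring.
Qed.

Lemma omulZl r x y : omul (r *: x) y = r *: omul x y.
Proof.
apply/rowP => k; rewrite !mxE mulr_sumr; apply: eq_bigr => i _ /=.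
by rewrite mulr_sumr; apply: eq_bigr => j _ /=; rewrite !mxE; ring.
Qed.

Lemma omulZr r x y : omul x (r *: y) = r *: omul x y.
Proof.
apply/rowP => k; rewrite !mxE mulr_sumr; apply: eq_bigr => i _ /=.
by rewrite mulr_sumr; apply: eq_bigr => j _ /=; rewrite !mxE; ring.
Qed.

Lemma octc_table i j k : (i < 8)%N -> (j < 8)%N -> (k < 8)%N ->
  octc R i j k = (-1) ^+ bsgn i j * (k == bidx i j)%:R.
Proof.
move=> hi hj hk; rewrite /octc /bsgn /bidx.
set b := find _ _.
case: (eqVneq i 0%N) => [_|i0] /=; first by rewrite expr0 mul1r eq_sym.
case: (eqVneq j 0%N) => [_|j0] /=; first by rewrite expr0 mul1r eq_sym.
case: (eqVneq i j) => [_|ij] /=; first by rewrite expr1 mulN1r.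
(* The structure constants live in an abstract field and do not compute; the check is run on the
   boolean [cyc] that defines them. *)
have /allP/(_ i) : all (fun i => all (fun j => all (fun k =>
    [|| i == 0%N, j == 0%N, i == j |
     let b := find (fun k => cyc i j k || cyc j i k) (iota 0 8) in
     (cyc i j k == (cyc i j b) && (k == b)) &&
     (~~ cyc i j k ==> (cyc j i k == (~~ cyc i j b) && (k == b)))])
   (iota 0 8)) (iota 0 8)) (iota 0 8) by vm_compute.
rewrite mem_iota => /(_ hi)/allP/(_ j); rewrite mem_iota => /(_ hj)/allP/(_ k).
rewrite mem_iota => /(_ hk); rewrite (negPf i0) (negPf j0) (negPf ij) -/b.
case: (cyc i j k) => /=.
  by rewrite andbT => /eqP/esym/andP[-> ->]; rewrite expr0 mul1r.
case: (k == b); rewrite ?andbT ?andbF /= ?mulr0.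
  by case: (cyc i j b) => //= /eqP ->; rewrite mulr1.
by move=> /eqP ->.
Qed.

Lemma bidx_lt i j : (i < 8)%N -> (j < 8)%N -> (bidx i j < 8)%N.
Proof. by case: i => [|[|[|[|[|[|[|[|i]]]]]]]] //; case: j => [|[|[|[|[|[|[|[|j]]]]]]]] //. Qed.

Lemma omul_eb i j : (i < 8)%N -> (j < 8)%N ->
  omul (eb i) (eb j) = (-1) ^+ bsgn i j *: eb (bidx i j).
Proof.
move=> hi hj; apply/rowP => k; rewrite /eb /obasis !mxE.
rewrite (bigD1 (inord i)) //= [X in _ + X]big1 ?addr0; last first.
  move=> a /negPf ha; apply: big1 => b _.
  by rewrite !mxE ha andbF /= !mul0r.
rewrite (bigD1 (inord j)) //= [X in _ + X]big1 ?addr0; last first.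
  move=> b /negPf hb; by rewrite !mxE hb andbF /= mulr0 mul0r.
rewrite !mxE !eqxx /= !mul1r !inordK // octc_table //.
by congr (_ * _); rewrite -val_eqE /= inordK // bidx_lt.
Qed.

Lemma one_oE : one_o R = eb 0.
Proof. by rewrite /one_o /eb; congr obasis; apply/val_inj; rewrite /= inordK. Qed.

Lemma oct_eb x : x = \sum_(i < 8) x 0 i *: eb i.
Proof.
rewrite {1}[x]row_sum_delta; apply: eq_bigr => i _.
by rewrite /eb inord_val.
Qed.

Lemma oct_ind (P : oct R -> Prop) :
  (forall x y, P x -> P y -> P (x + y)) -> (forall r x, P x -> P (r *: x)) ->
  (forall i, (i < 8)%N -> P (eb i)) -> forall x, P x.
Proof.
move=> hD hZ hb x; rewrite [x]oct_eb.
apply: (big_ind P) => //; last by move=> i _; apply/hZ/hb.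
by rewrite -(scale0r (eb 0)); apply/hZ/hb.
Qed.

Lemma omul1l x : omul (one_o R) x = x.
Proof.
elim/oct_ind: x => [x y hx hy|r x hx|i hi].
- by rewrite omulDr hx hy.
- by rewrite omulZr hx.
- by rewrite one_oE omul_eb //= scale1r.
Qed.

Lemma omul1r x : omul x (one_o R) = x.
Proof.
elim/oct_ind: x => [x y hx hy|r x hx|i hi].
- by rewrite omulDl hx hy.
- by rewrite omulZl hx.
rewrite one_oE omul_eb //= /bidx /bsgn /= orbT scale1r.
by case: eqP => [->|].
Qed.

End OctonionTable.
Arguments eb {R} k.

(** * Words in left multiplications by units *)

Definition cliff_ins (k : nat) := fix ins (w : seq nat) : bool * seq nat :=
  match w with
  | [::] => (false, [:: k])
  | h :: t => if k == h then (true, t) else if (k < h)%N then (false, k :: w)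
              else let r := ins t in (~~ r.1, h :: r.2)
  end.

(** Left multiplications by [e_1, ..., e_7] anticommute and square to -1. Hence a word in them
    equals, up to the sign in the first component, the increasing word of the letters that occur an
    odd number of times. *)
Definition cliff_nf : seq nat -> bool * seq nat :=
  foldr (fun k r => let r' := cliff_ins k r.2 in (r.1 (+) r'.1, r'.2)) (false, [::]).

Section Bimodule.
Variables (R : realType) (V : completeNormedModType R).
Variables (lm : oct R -> V -> V) (rm : V -> oct R -> V).
Hypothesis HV : banach_O_bimodule lm rm.
Implicit Types (x y m : V) (p q r : oct R).

Lemma lmDr p x y : lm p (x + y) = lm p x + lm p y. Proof. by case: HV. Qed.

Lemma lmDl p q x : lm (p + q) x = lm p x + lm q x. Proof. by case: HV => _ []. Qed.

Lemma lmZl a p x : lm (a *: p) x = a *: lm p x. Proof. by case: HV => _ [_ []]. Qed.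

Lemma lmZr a p x : lm p (a *: x) = a *: lm p x.
Proof. by case: HV => _ [_ [_ []]]. Qed.

Lemma rmDl p x y : rm (x + y) p = rm x p + rm y p.
Proof. by case: HV => _ [_ [_ [_ []]]]. Qed.

Lemma rmDr p q x : rm x (p + q) = rm x p + rm x q.
Proof. by case: HV => _ [_ [_ [_ [_ []]]]]. Qed.

Lemma rmZr a p x : rm x (a *: p) = a *: rm x p.
Proof. by case: HV => _ [_ [_ [_ [_ [_ []]]]]]. Qed.

Lemma rmZl a p x : rm (a *: x) p = a *: rm x p.
Proof. by case: HV => _ [_ [_ [_ [_ [_ [_ []]]]]]]. Qed.

Lemma lm1 x : lm (one_o R) x = x.
Proof. by case: HV => _ [_ [_ [_ [_ [_ [_ [_ []]]]]]]]. Qed.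

Lemma rm1 x : rm x (one_o R) = x.
Proof. by case: HV => _ [_ [_ [_ [_ [_ [_ [_ [_ []]]]]]]]]. Qed.

Lemma lm_norm p x : `|lm p x| = onorm p * `|x|.
Proof. by case: HV => _ [_ [_ [_ [_ [_ [_ [_ [_ [_ [_ []]]]]]]]]]]. Qed.

Lemma rm_norm p x : `|rm x p| = onorm p * `|x|.
Proof. by case: HV => _ [_ [_ [_ [_ [_ [_ [_ [_ [_ [_ [_ ]]]]]]]]]]]. Qed.

Lemma assoc_rotate p q x : [/\ assoc_ppx lm p q x = assoc_pxq lm rm q x p,
  assoc_ppx lm p q x = assoc_xpq rm x p q & assoc_ppx lm p q x = - assoc_ppx lm q p x].
Proof.
case: HV => _ [_ [_ [_ [_ [_ [_ [_ [_ [_ [h _]]]]]]]]]].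
by have [h1 [h2 h3]] := h p q x; split => //; rewrite h1 h2.
Qed.

Lemma lmNl p x : lm (- p) x = - lm p x.
Proof. by rewrite -scaleN1r lmZl scaleN1r. Qed.

Lemma lmNr p x : lm p (- x) = - lm p x.
Proof. by rewrite -scaleN1r lmZr scaleN1r. Qed.

Lemma rmNr p x : rm x (- p) = - rm x p.
Proof. by rewrite -scaleN1r rmZr scaleN1r. Qed.

Lemma rmNl p x : rm (- x) p = - rm x p.
Proof. by rewrite -scaleN1r rmZl scaleN1r. Qed.

Lemma lm0 p : lm p 0 = 0. Proof. by rewrite -(scale0r 0) lmZr !scale0r. Qed.

Lemma rm0 p : rm 0 p = 0. Proof. by rewrite -(scale0r 0) rmZl !scale0r. Qed.

Lemma lm0l x : lm 0 x = 0. Proof. by rewrite -(scale0r 0) lmZl !scale0r. Qed.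

Lemma rm0r x : rm x 0 = 0. Proof. by rewrite -(scale0r 0) rmZr !scale0r. Qed.

Lemma rm_sum p (I : Type) (s : seq I) (P : pred I) (F : I -> V) :
  rm (\sum_(i <- s | P i) F i) p = \sum_(i <- s | P i) rm (F i) p.
Proof.
elim/big_rec2: _ => [|i y1 y2 _ h]; first exact: rm0.
by rewrite rmDl h.
Qed.

Lemma lm_sum p (I : Type) (s : seq I) (P : pred I) (F : I -> V) :
  lm p (\sum_(i <- s | P i) F i) = \sum_(i <- s | P i) lm p (F i).
Proof.
elim/big_rec2: _ => [|i y1 y2 _ h]; first exact: lm0.
by rewrite lmDr h.
Qed.

Local Notation A p q x := (lm (omul p q) x - lm p (lm q x)).

Lemma rm_lm p q x : rm (lm q x) p = lm q (rm x p) + A p q x.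
Proof.
have [h _ _] := assoc_rotate p q x.
by rewrite -[A p q x]/(assoc_ppx lm p q x) h /assoc_pxq addrC subrK.
Qed.

Lemma rm_rm p q x : rm (rm x p) q = rm x (omul p q) + A p q x.
Proof.
have [_ h _] := assoc_rotate p q x.
by rewrite -[A p q x]/(assoc_ppx lm p q x) h /assoc_xpq addrC subrK.
Qed.

Lemma assoc_anti p q x : A p q x = - A q p x.
Proof. by have [_ _ h] := assoc_rotate p q x. Qed.

Lemma lm_alt p x : lm p (lm p x) = lm (omul p p) x.
Proof.
have h := assoc_anti p p x; apply/eqP; rewrite eq_sym -subr_eq0; apply/eqP.
have : A p p x + A p p x = 0 by rewrite {1}h addNr.
by rewrite -mulr2n -scaler_nat => /eqP; rewrite scaler_eq0 pnatr_eq0 /= => /eqP.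
Qed.

Lemma rm_alt p q x : rm (rm x p) q + rm (rm x q) p = rm x (omul p q + omul q p).
Proof. by rewrite !rm_rm (assoc_anti q p) addrACA subrr addr0 rmDr. Qed.

Lemma lm_anti p q x : lm p (lm q x) + lm q (lm p x) = lm (omul p q + omul q p) x.
Proof.
have /eqP := assoc_anti p q x; rewrite -subr_eq0 opprK addrACA -lmDl -opprD.
by rewrite subr_eq0 => /eqP.
Qed.

Definition lword (w : seq nat) x := foldr (fun k => lm (eb k)) x w.

Lemma lword_cat w1 w2 x : lword (w1 ++ w2) x = lword w1 (lword w2 x).
Proof. by rewrite /lword foldr_cat. Qed.

Lemma lwordZ w a x : lword w (a *: x) = a *: lword w x.
Proof. by elim: w => //= k w ->; rewrite lmZr. Qed.

Lemma lwordD w x y : lword w (x + y) = lword w x + lword w y.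
Proof. by elim: w => //= k w ->; rewrite lmDr. Qed.

Definition units7 (w : seq nat) := all (fun k => (0 < k < 8)%N) w.

Lemma lm_ebK k x : (0 < k < 8)%N -> lm (eb k) (lm (eb k) x) = - x.
Proof.
case/andP => k0 k8; rewrite lm_alt omul_eb //.
rewrite /bidx /bsgn eqxx gtn_eqF //= expr1 scaleN1r lmNl -one_oE.
by rewrite lm1.
Qed.

Lemma lm_ebC k h x : (0 < k < 8)%N -> (0 < h < 8)%N -> k != h ->
  lm (eb k) (lm (eb h) x) = - lm (eb h) (lm (eb k) x).
Proof.
move=> /andP[k0 k8] /andP[h0 h8] kh; apply/eqP; rewrite -addr_eq0 lm_anti.
rewrite !omul_eb //; have -> : bidx h k = bidx k h.
  apply/eqP; move: k h k8 h8 {k0 h0 kh}.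
  have H : all (fun k => all (fun h => bidx h k == bidx k h) (iota 0 8)) (iota 0 8).
    by vm_compute.
  move=> k h k8 h8; move/allP/(_ k): H; rewrite mem_iota => /(_ k8)/allP/(_ h).
  by rewrite mem_iota; exact.
have -> : bsgn h k = ~~ bsgn k h.
  apply/eqP; move: k h k8 h8 k0 h0 kh.
  have H : all (fun k => all (fun h => (0 < k)%N && (0 < h)%N && (k != h) ==>
    (bsgn h k == ~~ bsgn k h)) (iota 0 8)) (iota 0 8) by vm_compute.
  move=> k h k8 h8 k0 h0 kh; move/allP/(_ k): H; rewrite mem_iota => /(_ k8)/allP/(_ h).
  by rewrite mem_iota => /(_ h8); rewrite k0 h0 kh.
by rewrite signrN scaleNr subrr lm0l.
Qed.

Lemma cliff_ins_units k w : (0 < k < 8)%N -> units7 w -> units7 (cliff_ins k w).2.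
Proof.
move=> hk; elim: w => [_|h t IH]; first by rewrite /= hk.
rewrite [units7 _]/= => /andP[hh ht] /=; case: eqP => //= _.
by case: ifP => _ /=; rewrite ?hk hh //; apply: IH.
Qed.

Lemma lword_ins k w x : (0 < k < 8)%N -> units7 w ->
  lm (eb k) (lword w x) = (-1) ^+ (cliff_ins k w).1 *: lword (cliff_ins k w).2 x.
Proof.
move=> hk; elim: w => [_|h t IH]; first by rewrite /= scale1r.
rewrite [units7 _]/= => /andP[hh ht] /=; case: (eqVneq k h) => [<-|kh] /=.
  by rewrite lm_ebK // expr1 scaleN1r.
case: ifP => _ /=; first by rewrite scale1r.
by rewrite lm_ebC // IH // lmZr signrN scaleNr.
Qed.

Lemma cliff_nf_units w : units7 w -> units7 (cliff_nf w).2.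
Proof.
elim: w => [|k w IH] //=; case/andP => hk hw.
by apply: cliff_ins_units => //; apply: IH.
Qed.

Lemma lword_nf w x : units7 w ->
  lword w x = (-1) ^+ (cliff_nf w).1 *: lword (cliff_nf w).2 x.
Proof.
elim: w => [|k w IH]; first by rewrite /= scale1r.
rewrite [units7 _]/= => /andP[hk hw] /=.
rewrite IH // lmZr lword_ins //; last exact: cliff_nf_units.
by rewrite scalerA -signr_addb.
Qed.

Lemma lword_eq w1 w2 x : units7 w1 && units7 w2 ->
  (cliff_nf w1).2 == (cliff_nf w2).2 ->
  lword w1 x = (-1) ^+ ((cliff_nf w1).1 (+) (cliff_nf w2).1) *: lword w2 x.
Proof.
case/andP => h1 h2 /eqP e; rewrite lword_nf // (lword_nf x h2) e scalerA.
by rewrite -signr_addb -addbA addbb addbF.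
Qed.

End Bimodule.

(** A line stands for the product of its three units. Such a product squares to 1, and two lines,
    which share one point, give commuting products. Four lines generate all seven, which leaves
    sixteen sign patterns of joint eigenvalues. *)
Definition lines4 : seq (seq nat) := [:: [:: 1; 2; 4]; [:: 2; 3; 5]; [:: 3; 4; 6]; [:: 4; 5; 7]]%N.

(* each Fano line with the lines of [lines4] whose symmetric difference it is *)
Definition lines7 : seq (seq nat * seq nat) :=
  [:: ([:: 1; 2; 4], [:: 0]); ([:: 2; 3; 5], [:: 1]); ([:: 3; 4; 6], [:: 2]);
      ([:: 4; 5; 7], [:: 3]); ([:: 5; 6; 1], [:: 0; 1; 2]); ([:: 6; 7; 2], [:: 1; 2; 3]);
      ([:: 7; 1; 3], [:: 0; 1; 3])]%N.

Definition uword (r : nat) : seq nat := if r == 0%N then [::] else [:: r].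

(** * Regular decomposition of octonionic bimodules *)

Section Structure.
Variables (R : realType) (V : completeNormedModType R).
Variables (lm : oct R -> V -> V) (rm : V -> oct R -> V).
Hypothesis HV : banach_O_bimodule lm rm.
Implicit Types (x y m : V).
Local Notation lw := (lword lm).
Local Notation A p q x := (lm (omul p q) x - lm p (lm q x)).

(** The halves of [x + wx] and [x - wx] are eigenvectors of the involution [w]. A word commuting
    with [w] preserves both, so eigenvalues obtained earlier are kept. *)
Lemma split_word w x : (forall u, lw w (lw w u) = u) ->
  exists y z, [/\ x = y + z, lw w y = (-1) ^+ false *: y, lw w z = (-1) ^+ true *: z &
   forall w' (b : bool), (forall u, lw w' (lw w u) = lw w (lw w' u)) ->
     lw w' x = (-1) ^+ b *: x ->
     lw w' y = (-1) ^+ b *: y /\ lw w' z = (-1) ^+ b *: z].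
Proof.
move=> inv; exists (2^-1 *: (x + lw w x)), (2^-1 *: (x - lw w x)).
have lN w1 u : lw w1 (- u) = - lw w1 u by rewrite -scaleN1r (lwordZ HV) scaleN1r.
split.
- rewrite -scalerDr addrACA subrr addr0 -mulr2n -(scaler_nat 2 x) scalerA.
  by rewrite mulVf ?pnatr_eq0 // scale1r.
- by rewrite (lwordZ HV) (lwordD HV) inv scale1r addrC.
- by rewrite (lwordZ HV) (lwordD HV) lN inv expr1 scaleN1r -scalerN opprB addrC.
move=> w' b com e; split; rewrite (lwordZ HV) (lwordD HV) ?e.
  by rewrite com e (lwordZ HV) -scalerDr !scalerA mulrC.
rewrite lN com e (lwordZ HV) -scalerBr !scalerA.
by rewrite mulrC.
Qed.

Lemma lines4_inv : all (fun w => (cliff_nf (w ++ w)) == (false, [::])) lines4.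
Proof. by vm_compute. Qed.

Lemma lines4_comm :
  all (fun w => all (fun w' => cliff_nf (w ++ w') == cliff_nf (w' ++ w)) lines4) lines4.
Proof. by vm_compute. Qed.

Lemma lines4_units : all units7 lines4. Proof. by []. Qed.

Lemma units7_cat w w' : units7 w -> units7 w' -> units7 (w ++ w').
Proof. by rewrite /units7 all_cat => -> ->. Qed.

Lemma lines4_involutive w u : w \in lines4 -> lw w (lw w u) = u.
Proof.
move=> hw; rewrite -lword_cat (lword_nf HV); last first.
  by apply: units7_cat; apply: (allP lines4_units).
by have /eqP -> := allP lines4_inv _ hw; rewrite /= scale1r.
Qed.

Lemma lines4_commute w w' u : w \in lines4 -> w' \in lines4 ->
  lw w (lw w' u) = lw w' (lw w u).
Proof.
move=> hw hw'; rewrite -!lword_cat (lword_nf HV); last first.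
  by apply: units7_cat; apply: (allP lines4_units).
rewrite [RHS](lword_nf HV); last by apply: units7_cat; apply: (allP lines4_units).
by have /allP/(_ _ hw')/eqP -> := allP lines4_comm _ hw.
Qed.

(** The four involutions are used in turn, each splitting the summands obtained so far; in the inner
    induction [k] counts those still to be used. *)
Lemma lines4_ind (P : V -> Prop) : (forall x y, P x -> P y -> P (x + y)) ->
  (forall (s : seq bool) y, size s = 4%N ->
     (forall i, (i < 4)%N -> lw (nth [::] lines4 i) y = (-1) ^+ nth false s i *: y) -> P y) ->
  forall x, P x.
Proof.
move=> hD hP x.
have key k : (k <= 4)%N -> forall x (s : seq bool), size s = (4 - k)%N ->
    (forall i, (i < 4 - k)%N -> lw (nth [::] lines4 i) x = (-1) ^+ nth false s i *: x) -> P x.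
  elim: k => [|k IH] hk {}x s hs hx; first exact: (hP s).
  have ks : (4 - k)%N = (4 - k.+1).+1 by rewrite subnSK.
  have mem i : (i < 4)%N -> nth [::] lines4 i \in lines4 by move=> ?; apply: mem_nth.
  have l4 : (4 - k.+1 < 4)%N by rewrite ltn_subrL.
  have [y [z [xe ey ez h]]] := split_word x (fun u => lines4_involutive u (mem _ l4)).
  have hyz i : (i < 4 - k.+1)%N ->
      lw (nth [::] lines4 i) y = (-1) ^+ nth false s i *: y /\
      lw (nth [::] lines4 i) z = (-1) ^+ nth false s i *: z.
    move=> hi; apply: h; last exact: hx.
    by move=> u; apply: lines4_commute; apply: mem => //; apply: ltn_trans hi _.
  rewrite xe; apply: hD.
    apply: (IH (ltnW hk) y (rcons s false)); first by rewrite size_rcons hs ks.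
    move=> i; rewrite ks nth_rcons hs ltnS leq_eqVlt => /orP[/eqP ->|hi].
      by rewrite ltnn eqxx.
    by rewrite hi; have [] := hyz i hi.
  apply: (IH (ltnW hk) z (rcons s true)); first by rewrite size_rcons hs ks.
  move=> i; rewrite ks nth_rcons hs ltnS leq_eqVlt => /orP[/eqP ->|hi].
    by rewrite ltnn eqxx.
  by rewrite hi; have [] := hyz i hi.
by apply: (key 4%N _ x [::]).
Qed.

(* The lines of [lines4] give commuting involutions of [V], so [V] is spanned by joint
   eigenvectors; a unit moves any of these to one on which all seven lines act by the same sign.
   For one sign [m] is nuclear, for the other it is an opposite module, which alternativity kills. *)
Definition seven (e : bool) m :=
  forall l, l \in lines7 -> lw l.1 m = (-1) ^+ e *: m.

Definition sgn_sum (s : seq bool) (t : seq nat) := foldr (fun i b => nth false s i (+) b) false t.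
Definition word_sum (t : seq nat) := flatten [seq nth [::] lines4 i | i <- t].

Lemma lw_sum (s : seq bool) y t : all (fun i => (i < 4)%N) t ->
  (forall i, (i < 4)%N -> lw (nth [::] lines4 i) y = (-1) ^+ nth false s i *: y) ->
  lw (word_sum t) y = (-1) ^+ sgn_sum s t *: y.
Proof.
move=> ht h; elim: t ht => [|i t IH] /=; first by rewrite scale1r.
case/andP => hi ht; rewrite lword_cat IH // (lwordZ HV) h //.
by rewrite scalerA -signr_addb addbC.
Qed.

(** A unit [e_r] commutes with the lines through [r] and anticommutes with the four others. The sign
    changes by none or by one of the seven units, together with the common sign [e], exhaust the
    sixteen patterns. *)
Lemma seven_exists_table : all (fun s => has (fun r => has (fun e =>
    all (fun l => ((cliff_nf (l.1 ++ uword r)).2 == (cliff_nf (uword r ++ word_sum l.2)).2)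
      && ((cliff_nf (l.1 ++ uword r)).1 (+) (cliff_nf (uword r ++ word_sum l.2)).1
           (+) sgn_sum s l.2 == e)) lines7)
  [:: false; true]) (iota 0 8))
  [seq [:: a; b; c; d] | '((a, b), (c, d)) <-
    allpairs pair (allpairs pair [:: false; true] [:: false; true])
                  (allpairs pair [:: false; true] [:: false; true])].
Proof. by vm_compute. Qed.

Lemma lines7_units : all (fun l => units7 l.1 && units7 (word_sum l.2)
   && all (fun i => (i < 4)%N) l.2) lines7.
Proof. by vm_compute. Qed.

Lemma seven_exists (s : seq bool) y : size s = 4%N ->
  (forall i, (i < 4)%N -> lw (nth [::] lines4 i) y = (-1) ^+ nth false s i *: y) ->
  exists (r : nat) (e b : bool), (r < 8)%N /\ seven e (lw (uword r) y) /\
    y = (-1) ^+ b *: lw (uword r) (lw (uword r) y).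
Proof.
move=> hs hy; have := seven_exists_table; move/allP/(_ s) => table.
have /table/hasP[r] : s \in [seq [:: a; b; c; d] | '((a, b), (c, d)) <-
    allpairs pair (allpairs pair [:: false; true] [:: false; true])
                  (allpairs pair [:: false; true] [:: false; true])].
  by case: s hs {hy table} => [|[] [|[] [|[] [|[] [|? ?]]]]].
rewrite mem_iota => r8 /hasP[e _ /allP h].
have ur : units7 (uword r) by rewrite /uword; case: (r) r8 => //= k ->.
exists r, e, (r != 0%N); split => //; split; last first.
  rewrite /uword; case: eqP => [_|/eqP r0] /=; first by rewrite scale1r.
  by rewrite (lm_ebK HV) ?lt0n ?r0 // expr1 scaleN1r opprK.
move=> l hl; have /andP[h1 /eqP h2] := h l hl.
have /andP[/andP[u1 u2] u3] := allP lines7_units _ hl.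
rewrite -lword_cat (lword_eq HV _ _ h1); last by rewrite !units7_cat.
rewrite lword_cat (lw_sum u3 hy) (lwordZ HV) scalerA -signr_addb.
by rewrite h2.
Qed.

Lemma seven_pair_table : all (fun p => all (fun q => (p != q) ==> has (fun l =>
   ((cliff_nf (bidx p q :: l.1)).2 == (cliff_nf [:: p; q]).2)
   && units7 [:: bidx p q] &&
   ((cliff_nf (bidx p q :: l.1)).1 (+) (cliff_nf [:: p; q]).1 == ~~ bsgn p q))
   lines7) (iota 1 7)) (iota 1 7).
Proof. by vm_compute. Qed.

(** The line through [p] and [q] trades [e_p e_q] for the third unit. For [e = true] the result is
    [p(qm) = (pq)m], and for [e = false] it is [p(qm) = (qp)m], as distinct imaginary units
    anticommute. *)
Lemma seven_pair e m p q : seven e m -> (0 < p < 8)%N -> (0 < q < 8)%N -> p != q ->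
  lm (eb p) (lm (eb q) m) = (-1) ^+ (~~ e (+) bsgn p q) *: lm (eb (bidx p q)) m.
Proof.
move=> he hp hq pq.
have /allP/(_ p) := seven_pair_table; rewrite mem_iota => /(_ hp)/allP/(_ q).
rewrite mem_iota => /(_ hq); rewrite pq => /hasP[l hl /andP[/andP[h1 u1] /eqP h2]].
have /andP[/andP[ul _] _] := allP lines7_units _ hl.
have hh : units7 (bidx p q :: l.1) && units7 [:: p; q].
  by rewrite -cat1s units7_cat //= hp hq.
have := lword_eq HV m hh h1; rewrite h2 => h3.
have : lw (bidx p q :: l.1) m = (-1) ^+ e *: lm (eb (bidx p q)) m.
  by rewrite /= -/(lw l.1 m) (he l hl) (lmZr HV).
rewrite h3 => /(congr1 ( *:%R ((-1) ^+ (~~ bsgn p q)))).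
rewrite !scalerA -!signr_addb addbb scale1r /= => ->.
by congr (_ ^+ _ *: _); case: (e); case: (bsgn p q).
Qed.

Lemma seven_true m : seven true m -> forall p q, lm p (lm q m) = lm (omul p q) m.
Proof.
move=> h p q; elim/oct_ind: p => [p p' hp hp'|a p hp|i hi].
- by rewrite (lmDl HV) omulDl (lmDl HV) hp hp'.
- by rewrite (lmZl HV) omulZl (lmZl HV) hp.
elim/oct_ind: q => [q q' hq hq'|a q hq|j hj].
- by rewrite (lmDl HV) omulDr (lmDl HV) (lmDr HV) hq hq'.
- by rewrite (lmZl HV) (lmZr HV) omulZr (lmZl HV) hq.
case: (posnP i) => [->|i0]; first by rewrite -one_oE omul1l (lm1 HV).
case: (posnP j) => [->|j0]; first by rewrite -one_oE omul1r (lm1 HV).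
case: (eqVneq i j) => [->|ij]; first exact: (lm_alt HV).
by rewrite (seven_pair h) ?i0 ?j0 // omul_eb // (lmZl HV).
Qed.

Lemma seven_false m : seven false m -> forall p q, lm p (lm q m) = lm (omul q p) m.
Proof.
move=> h p q; elim/oct_ind: p => [p p' hp hp'|a p hp|i hi].
- by rewrite (lmDl HV) omulDr (lmDl HV) hp hp'.
- by rewrite (lmZl HV) omulZr (lmZl HV) hp.
elim/oct_ind: q => [q q' hq hq'|a q hq|j hj].
- by rewrite (lmDl HV) omulDl (lmDl HV) (lmDr HV) hq hq'.
- by rewrite (lmZl HV) (lmZr HV) omulZl (lmZl HV) hq.
case: (posnP i) => [->|i0]; first by rewrite -one_oE omul1r (lm1 HV).
case: (posnP j) => [->|j0]; first by rewrite -one_oE omul1l (lm1 HV).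
case: (eqVneq i j) => [->|ij]; first exact: (lm_alt HV).
rewrite (lm_ebC HV) ?i0 ?j0 // (seven_pair h) ?i0 ?j0 1?eq_sym //.
by rewrite omul_eb // (lmZl HV) -scaleNr -signrN /= negbK.
Qed.

(* the two ways of computing ((m p) q) r *)
Lemma rm3 p q r x :
  rm x (omul (omul p q) r) + A (omul p q) r x + rm (A p q x) r =
  rm x (omul p (omul q r)) + A p (omul q r) x + A q r (rm x p).
Proof.
have h1 : rm (rm (rm x p) q) r =
    rm x (omul (omul p q) r) + A (omul p q) r x + rm (A p q x) r.
  by rewrite (rm_rm HV p q) (rmDl HV) (rm_rm HV (omul p q)).
by rewrite -h1 (rm_rm HV q r) (rm_rm HV p).
Qed.

(** The associators of [m] in [rm3] vanish; the one of [mp] survives and turns the octonion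
    associator on the right of [m] into the same one on the left. *)
Lemma nuclear_assoc m : (forall p q, lm p (lm q m) = lm (omul p q) m) ->
  forall p q r, rm m (omul (omul p q) r - omul p (omul q r)) =
                lm (omul (omul p q) r - omul p (omul q r)) m.
Proof.
move=> h p q r; have := rm3 p q r m.
rewrite !h !subrr !addr0 (rm0 HV) addr0 => e.
have c a b : lm b (rm m a) = rm (lm b m) a.
  by rewrite (rm_lm HV) h subrr addr0.
have e2 : lm q (lm r (rm m p)) = rm (lm (omul q r) m) p - A p q (lm r m).
  by rewrite c -h [in RHS](rm_lm HV) addrK.
rewrite (rmDr HV) (rmNr HV) e addrAC subrr add0r c e2 opprB addrC subrK.
by rewrite !h (lmDl HV) (lmNl HV).
Qed.

(** Every imaginary unit is up to sign half an associator of units, because [(e_p e_q) e_r] and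
    [e_p (e_q e_r)] are opposite. With [nuclear_assoc] this makes nuclear elements commute with all
    octonions. *)
Lemma assoc_table k : (0 < k < 8)%N -> exists p q r,
  [/\ [/\ (p < 8)%N, (q < 8)%N & (r < 8)%N], bidx (bidx p q) r = k, bidx p (bidx q r) = k &
    bsgn p q (+) bsgn (bidx p q) r = ~~ (bsgn q r (+) bsgn p (bidx q r))].
Proof.
case: k => [|[|[|[|[|[|[|[|k]]]]]]]] // _;
[exists 2, 3, 6 | exists 1, 3, 6 | exists 1, 2, 6 | exists 1, 3, 5 | exists 1, 2, 7 | exists 1, 2, 3 | exists 1, 2, 5]; by [].
Qed.

Lemma nuclear_comm m : (forall p q, lm p (lm q m) = lm (omul p q) m) ->
  forall p, lm p m = rm m p.
Proof.
move=> h p; elim/oct_ind: p => [p p' hp hp'|a p hp|k hk].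
- by rewrite (lmDl HV) (rmDr HV) hp hp'.
- by rewrite (lmZl HV) (rmZr HV) hp.
case: (posnP k) => [->|k0]; first by rewrite -one_oE (lm1 HV) (rm1 HV).
have [|p [q [r [[hp hq hr] h1 h2 hs]]]] := @assoc_table k; first by rewrite k0.
have hpq := bidx_lt hp hq; have hqr := bidx_lt hq hr.
have := nuclear_assoc h (eb p) (eb q) (eb r).
have -> : omul (omul (eb p) (eb q)) (eb r) =
    (-1) ^+ (bsgn p q (+) bsgn (bidx p q) r) *: eb k :> oct R.
  rewrite (omul_eb _ hp hq) omulZl (omul_eb _ hpq hr) h1 scalerA.
  by rewrite -signr_addb.
have -> : omul (eb p) (omul (eb q) (eb r)) =
    (-1) ^+ (bsgn q r (+) bsgn p (bidx q r)) *: eb k :> oct R.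
  rewrite (omul_eb _ hq hr) omulZr (omul_eb _ hp hqr) h2 scalerA.
  by rewrite -signr_addb.
rewrite hs signrN -scalerBl -opprD -mulr2n (lmZl HV) (rmZr HV) => /(scalerI _) -> //.
by rewrite oppr_eq0 mulrn_eq0 signr_eq0.
Qed.

End Structure.

Section Decomposition.
Variables (R : realType) (V : completeNormedModType R).
Variables (lm : oct R -> V -> V) (rm : V -> oct R -> V).
Hypothesis HV : banach_O_bimodule lm rm.
Implicit Types (x y m : V).
Local Notation A p q x := (lm (omul p q) x - lm p (lm q x)).
Local Notation br a b := (omul a b - omul b a).
Ltac lmod := lmod_with R V.

(* expresses right multiplications on a vector of opposite type by left ones *)
Lemma opposite_rm m : (forall p q, lm p (lm q m) = lm (omul q p) m) -> forall p q r,
  rm m (omul (omul p q) r - omul p (omul q r)) + lm (br p q) (rm m r)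
    - lm (br q r) (rm m p) =
  lm (- br (omul p q) r - br r (br p q) + br p (omul q r) - br p (omul r q)
      + omul r (omul p q) - omul (omul r q) p + omul (br p r) q) m.
Proof.
move=> h p q r.
have hA a b : A a b m = lm (br a b) m by rewrite h (lmDl HV) (lmNl HV).
have hrl a b : rm (lm a m) b = lm a (rm m b) + lm (br b a) m.
  by rewrite (rm_lm HV) hA.
have := rm3 HV p q r m; rewrite !hA hrl.
have -> : lm q (lm r (rm m p)) = lm (omul r q) (rm m p) + lm (br p (omul r q)) m
    - lm (omul r (omul p q)) m + lm (omul (omul r q) p) m - lm (omul (br p r) q) m.
  have -> : lm r (rm m p) = rm (lm r m) p - lm (br p r) m by rewrite hrl addrK.
  have e := rm_lm HV p q (lm r m).
  rewrite (lmDr HV) (lmNr HV) h; congr (_ - _).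
  move: e; rewrite !h hrl => e; apply: (lin1 (c := -1) e); lmod.
move=> e; apply: (lin1 (c := 1) e).
rewrite ![lm (_ + _) _](lmDl HV) !(rmDr HV) !(lmNl HV) !(rmNr HV).
rewrite !(lmDl HV) !(lmNl HV); lmod.
Qed.

Lemma omulNl (p q : oct R) : omul (- p) q = - omul p q.
Proof. by rewrite -scaleN1r omulZl scaleN1r. Qed.

Lemma omulNr (p q : oct R) : omul p (- q) = - omul p q.
Proof. by rewrite -scaleN1r omulZr scaleN1r. Qed.

Lemma omul_ebE (i j k : nat) (b : bool) : (i < 8)%N -> (j < 8)%N ->
  (bsgn i j == b) && (bidx i j == k) -> omul (eb i) (eb j) = (-1) ^+ b *: eb k :> oct R.
Proof. by move=> hi hj /andP[/eqP <- /eqP <-]; exact: omul_eb. Qed.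

(** [P], [Q], [K] generate a quaternion algebra, so the associator in [opposite_rm] at [(P, Q, P)]
    disappears and [K(mP) = Qm] remains. Multiplying by [K] gives the claim. *)
Lemma opposite_rm_unit m (P Q K : oct R) : (forall p q, lm p (lm q m) = lm (omul q p) m) ->
  omul P Q = K -> omul Q P = - K -> omul Q K = P -> omul K P = Q -> omul P K = - Q ->
  omul P P = - one_o R -> omul K K = - one_o R ->
  rm m P = - lm P m.
Proof.
move=> h PQ QP QK KP PK PP KK; have := opposite_rm h P Q P.
rewrite PQ QP !omulNr !omulDr !omulDl !omulNr !omulNl KP !PK PP !opprK.
rewrite !addrN (rm0r HV) add0r => e.
have e4 : 4 *: lm K (rm m P) = 4 *: lm Q m.
  move: e; rewrite ?(omulDr, omulNr, omulDl, omulNl) ?KP ?PK ?((lmDl HV), (lmNl HV)) => e.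
  apply: (lin1 (c := 1) e).
  rewrite ?(omulDr, omulNr, omulDl, omulNl, opprK) ?KP ?PK ?(lm0l HV) ?((lmDl HV), (lmNl HV)).
  by lmod.
have /(congr1 (lm K)) : lm K (rm m P) = lm Q m by apply: scalerI e4; rewrite pnatr_eq0.
rewrite (lm_alt HV) KK h QK (lmNl HV) (lm1 HV) => <-.
by rewrite opprK.
Qed.

(** Quaternionic triples show that right multiplication by [e_1], [e_3], [e_6] is minus the left
    one. Inserted into [opposite_rm] for [e_1, e_2, e_3], which do not associate, this leaves
    [2 e_6 m = 0]. *)
Lemma seven_false0 m : seven lm false m -> m = 0.
Proof.
move/(seven_false HV) => h.
have e12 : omul (eb 1) (eb 2) = eb 4 :> oct R by rewrite (@omul_ebE _ _ 4 false) ?scale1r.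
have u p q k : (0 < p < 8)%N -> (0 < q < 8)%N -> (0 < k < 8)%N ->
   [&& ~~ bsgn p q && (bidx p q == k), bsgn q p && (bidx q p == k),
       ~~ bsgn q k && (bidx q k == p), ~~ bsgn k p && (bidx k p == q)
     & bsgn p k && (bidx p k == q)] -> rm m (eb p) = - lm (eb p) m.
  case/andP => p0 hp /andP[q0 hq] /andP[k0 hk].
  case/and5P => /andP[/negPf a1 a2] /andP[b1 b2] /andP[/negPf c1 c2] /andP[/negPf d1 d2].
  case/andP => f1 f2.
  have sq i : (0 < i)%N -> (i < 8)%N -> omul (eb i) (eb i) = - one_o R.
    move=> i0 i8; rewrite omul_eb // one_oE /bidx /bsgn eqxx gtn_eqF //=.
    by rewrite expr1 scaleN1r.
  apply: (opposite_rm_unit (Q := eb q) (K := eb k)) => //; try exact: sq.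
  - by rewrite (@omul_ebE _ _ k false) ?scale1r // a1 a2.
  - by rewrite (@omul_ebE _ _ k true) ?expr1 ?scaleN1r // b1 b2.
  - by rewrite (@omul_ebE _ _ p false) ?scale1r // c1 c2.
  - by rewrite (@omul_ebE _ _ q false) ?scale1r // d1 d2.
  - by rewrite (@omul_ebE _ _ q true) ?expr1 ?scaleN1r // f1 f2.
have r1 := u 1%N 2%N 4%N isT isT isT isT.
have r3 := u 3%N 4%N 6%N isT isT isT isT.
have r6 := u 6%N 3%N 4%N isT isT isT isT.
have neg i j k : (i < 8)%N -> (j < 8)%N -> (bsgn i j == true) && (bidx i j == k) ->
    omul (eb i) (eb j) = - eb k :> oct R.
  by move=> hi hj hh; rewrite (omul_ebE hi hj hh) expr1 scaleN1r.
have pos i j k : (i < 8)%N -> (j < 8)%N -> (bsgn i j == false) && (bidx i j == k) ->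
    omul (eb i) (eb j) = eb k :> oct R.
  by move=> hi hj hh; rewrite (omul_ebE hi hj hh) scale1r.
have t12 := pos 1%N 2%N 4%N isT isT isT; have t21 := neg 2%N 1%N 4%N isT isT isT.
have t23 := pos 2%N 3%N 5%N isT isT isT; have t32 := neg 3%N 2%N 5%N isT isT isT.
have t43 := neg 4%N 3%N 6%N isT isT isT; have t34 := pos 3%N 4%N 6%N isT isT isT.
have t15 := pos 1%N 5%N 6%N isT isT isT; have t51 := neg 5%N 1%N 6%N isT isT isT.
have t13 := pos 1%N 3%N 7%N isT isT isT; have t31 := neg 3%N 1%N 7%N isT isT isT.
have t72 := pos 7%N 2%N 6%N isT isT isT.
have := opposite_rm h (eb 1) (eb 2) (eb 3).
rewrite t12 t21 t23 t32 t13 t31 t43 t34 !(omulDr, omulNr, omulDl, omulNl).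
rewrite t15 t51 t43 t34 t72 !((lmDl HV), (lmNl HV), (rmDr HV), (rmNr HV)) r1 r3 r6.
rewrite !(lmNr HV) !h t34 t15 => e.
have e2 : 2 *: lm (eb 6) m = 2 *: 0.
  by apply: (lin1 (c := -1) e); lmod.
have /(congr1 (lm (eb 6))) : lm (eb 6) m = 0 by apply: scalerI e2; rewrite pnatr_eq0.
by rewrite (lm_ebK HV) // (lm0 HV) => /eqP; rewrite oppr_eq0 => /eqP.
Qed.

Lemma ReV_nuclear m : (forall p q, lm p (lm q m) = lm (omul p q) m) -> Defs.ReV lm rm m.
Proof.
move=> h; split; first exact: (nuclear_comm HV h).
by move=> p q; rewrite /assoc_ppx h subrr.
Qed.

Lemma ReVD x y : Defs.ReV lm rm x -> Defs.ReV lm rm y -> Defs.ReV lm rm (x + y).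
Proof.
move=> [x1 x2] [y1 y2]; split=> [p|p q].
  by rewrite (lmDr HV) (rmDl HV) x1 y1.
have := x2 p q; have := y2 p q; rewrite /assoc_ppx !(lmDr HV) => hy hx.
by rewrite opprD addrACA hx hy addr0.
Qed.

Lemma ReVZ a x : Defs.ReV lm rm x -> Defs.ReV lm rm (a *: x).
Proof.
move=> [x1 x2]; split=> [p|p q].
  by rewrite (lmZr HV) (rmZl HV) x1.
by have := x2 p q; rewrite /assoc_ppx !(lmZr HV) -scalerBr => ->; rewrite scaler0.
Qed.

Lemma ReV0 : Defs.ReV lm rm 0.
Proof.
split=> [p|p q]; first by rewrite (lm0 HV) (rm0 HV).
by rewrite /assoc_ppx !(lm0 HV) subrr.
Qed.

Lemma ReV_lm m p : Defs.ReV lm rm m -> lm p m = rm m p.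
Proof. by case. Qed.

Lemma ReV_rmA m p q : Defs.ReV lm rm m -> rm (rm m p) q = rm m (omul p q).
Proof. by case=> _ h; rewrite (rm_rm HV); move: (h p q); rewrite /assoc_ppx => ->; rewrite addr0. Qed.

Lemma ReV_lmA m p q : Defs.ReV lm rm m -> lm p (rm m q) = rm m (omul p q).
Proof.
move=> hm; rewrite -(ReV_lm q hm) -(ReV_lm _ hm); case: hm => _ /(_ p q).
by rewrite /assoc_ppx => /eqP; rewrite subr_eq0 => /eqP.
Qed.

(** A joint eigenvector of the lines is [e_r m] up to sign with [m] satisfying [seven]. For one sign
    [m] vanishes, for the other it lies in [Re V], and then [r] is the only index with a nonzero
    component. *)
Lemma decomp_exists x : exists xs, decomp lm rm x xs.
Proof.
have hD y z : (exists xs, decomp lm rm y xs) -> (exists xs, decomp lm rm z xs) ->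
    exists xs, decomp lm rm (y + z) xs.
  case=> ys [hy ->] [zs [hz ->]]; exists (fun i => ys i + zs i); split=> [i|].
    exact: ReVD.
  by rewrite -big_split; apply: eq_bigr => i _; rewrite (rmDl HV).
apply: (lines4_ind HV hD) => s y hs hy.
have [r [e [b [r8 [sv yE]]]]] := seven_exists HV hs hy.
case: e sv => sv; last first.
  exists (fun=> 0); split; first by move=> _; exact: ReV0.
  rewrite yE (seven_false0 sv) big1 => [|i _]; last exact: (rm0 HV).
  by rewrite /uword; case: eqP => _ /=; rewrite ?(lm0 HV) scaler0.
have hm := ReV_nuclear (seven_true HV sv).
exists (fun i => if i == inord r then (-1) ^+ b *: lword lm (uword r) y else 0).
split=> [i|]; first by case: ifP => _; [exact: ReVZ | exact: ReV0].
rewrite (bigD1 (inord r)) //= eqxx big1 ?addr0 => [|i /negPf ->]; last exact: (rm0 HV).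
rewrite (rmZl HV) {1}yE -/(eb r) -(ReV_lm _ hm); congr (_ *: _).
rewrite /uword; case: eqP => [->|_] //=.
by rewrite -one_oE (lm1 HV).
Qed.

End Decomposition.

(** * Components of a vector and operators determined by them *)

Section Components.
Variables (R : realType) (V : completeNormedModType R).
Variables (lm : oct R -> V -> V) (rm : V -> oct R -> V).
Hypothesis HV : banach_O_bimodule lm rm.
Implicit Types (x y m : V).
Local Notation ReV := (Defs.ReV lm rm).
Local Notation ReP := (Defs.ReP lm rm).
Local Notation ocomp := (Defs.ocomp lm rm).
Ltac lmod := lmod_with R V.

Definition sgn3 (i j : nat) := bsgn j i (+) bsgn i (bidx j i).

Lemma sgn3_table : all (fun i => all (fun j => bidx i (bidx j i) == j) (iota 0 8)) (iota 0 8).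
Proof. by vm_compute. Qed.

Lemma omul3 i j : (i < 8)%N -> (j < 8)%N ->
  omul (eb i) (omul (eb j) (eb i)) = (-1) ^+ sgn3 i j *: eb j :> oct R.
Proof.
move=> hi hj; have hji := bidx_lt hj hi.
rewrite (omul_eb _ hj hi) omulZr (omul_eb _ hi hji) scalerA -signr_addb.
move: sgn3_table => /allP/(_ i); rewrite mem_iota => /(_ hi)/allP/(_ j).
by rewrite mem_iota => /(_ hj)/eqP ->.
Qed.

Lemma sgn3_count : all (fun j => count (fun i => sgn3 i j) (iota 0 8) ==
  if j == 0%N then 7%N else 1%N) (iota 0 8).
Proof. by vm_compute. Qed.

Lemma sum_signs (f : nat -> bool) (t : seq nat) :
  \sum_(i <- t) (-1) ^+ f i = (size t)%:R - 2 * (count f t)%:R :> R.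
Proof.
elim: t => [|i t IH]; first by rewrite big_nil mulr0 subr0.
rewrite big_cons IH /= -(addn1 (size t)) !natrD; case: (f i) => /=; rewrite ?expr1 ?expr0;
move: (size t)%:R (count f t)%:R => u v; ring.
Qed.

(** Among the signs of [e_i (e_j e_i)] seven are negative for [j = 0], and only the one with [i = j]
    otherwise. The coefficients 1/2 and 1/12 of [rho] are those that turn -6 into 1 and 6 into 0. *)
Lemma sgn3_sum j : (j < 8)%N ->
  \sum_(i < 8) (-1) ^+ sgn3 i j = (if j == 0%N then -6 else 6) :> R.
Proof.
move=> hj; rewrite -(big_mkord xpredT (fun i => (-1) ^+ sgn3 i j)) (sum_signs (fun i => sgn3 i j)).
have /allP/(_ j) := sgn3_count; rewrite mem_iota => /(_ hj)/eqP.
by rewrite -[iota 0 8]/(index_iota 0 8) => ->; rewrite size_iota subn0; case: eqP => _; lra.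
Qed.

(* on [O] itself this is the real part *)
Definition rho x := 2^-1 *: x - 12^-1 *: \sum_(i < 8) lm (eb i) (rm x (eb i)).

Lemma rhoD x y : rho (x + y) = rho x + rho y.
Proof.
rewrite /rho; have -> : \sum_(i < 8) lm (eb i) (rm (x + y) (eb i)) =
  \sum_(i < 8) lm (eb i) (rm x (eb i)) + \sum_(i < 8) lm (eb i) (rm y (eb i)).
  by rewrite -big_split; apply: eq_bigr => i _; rewrite (rmDl HV) (lmDr HV).
by lmod.
Qed.

Lemma rhoZ a x : rho (a *: x) = a *: rho x.
Proof.
rewrite /rho; have -> : \sum_(i < 8) lm (eb i) (rm (a *: x) (eb i)) =
  a *: \sum_(i < 8) lm (eb i) (rm x (eb i)).
  by rewrite scaler_sumr; apply: eq_bigr => i _; rewrite (rmZl HV) (lmZr HV).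
by lmod.
Qed.

Lemma rho0 : rho 0 = 0.
Proof. by rewrite -(scale0r 0) rhoZ !scale0r. Qed.

Lemma rho_sum (I : Type) (s : seq I) (P : pred I) (F : I -> V) :
  rho (\sum_(i <- s | P i) F i) = \sum_(i <- s | P i) rho (F i).
Proof.
elim/big_rec2: _ => [|i y1 y2 _ h]; first exact: rho0.
by rewrite rhoD h.
Qed.

Lemma eb00 i : (i < 8)%N -> (eb i : oct R) 0 0 = (i == 0%N)%:R.
Proof.
by move=> hi; rewrite mxE eqxx /= -val_eqE /= inordK // eq_sym.
Qed.

Lemma rho_rm y p : ReV y -> rho (rm y p) = p 0 0 *: y.
Proof.
move=> hy; elim/oct_ind: p => [p p' hp hp'|a p hp|j hj].
- by rewrite (rmDr HV) rhoD hp hp' mxE scalerDl.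
- by rewrite (rmZr HV) rhoZ hp mxE scalerA.
rewrite eb00 // /rho.
have -> : \sum_(i < 8) lm (eb i) (rm (rm y (eb j)) (eb i)) =
    (if j == 0%N then -6 else 6) *: rm y (eb j).
  rewrite -sgn3_sum // scaler_suml; apply: eq_bigr => i _.
  by rewrite (ReV_rmA HV) // ReV_lmA // omul3 ?ltn_ord // (rmZr HV).
case: eqP => [->|_] /=; rewrite ?mulr1n ?mulr0n.
  by rewrite -one_oE (rm1 HV); lmod; field.
by lmod; field.
Qed.

Lemma omul00 i j : (i < 8)%N -> (j < 8)%N -> (omul (eb i) (eb j) : oct R) 0 0 =
  if i == j then (-1) ^+ (i != 0%N) else 0.
Proof.
move=> hi hj; rewrite omul_eb // mxE eb00 ?bidx_lt //.
have H : all (fun i => all (fun j => ((bidx i j == 0%N) == (i == j)) &&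
    ((i == j) ==> (bsgn i j == (i != 0%N)))) (iota 0 8)) (iota 0 8) by vm_compute.
move: H => /allP/(_ i); rewrite mem_iota => /(_ hi)/allP/(_ j).
rewrite mem_iota => /(_ hj)/andP[/eqP ->].
by case: eqP => [_ /eqP ->|]; rewrite ?mulr1 ?mulr0.
Qed.

(** Right multiplication by [e_j] moves the component [x_j] to the real place, up to the sign of the
    square of [e_j], and [rho] reads it off. Uniqueness of components follows. *)
Lemma decomp_comp x xs j : decomp lm rm x xs ->
  xs j = (-1) ^+ (val j != 0%N) *: rho (rm x (eb j)).
Proof.
case=> hx ->; rewrite (rm_sum HV) rho_sum (bigD1 j) //= big1 ?addr0; last first.
  move=> i ij; rewrite eb_ord (ReV_rmA HV) // rho_rm // omul00 ?ltn_ord //.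
  by rewrite val_eqE (negPf ij) scale0r.
rewrite eb_ord (ReV_rmA HV) // rho_rm // omul00 ?ltn_ord // eqxx scalerA.
by rewrite -expr2 sqrr_sign scale1r.
Qed.

Lemma ocomp_decomp x : decomp lm rm x (ocomp x).
Proof.
rewrite /Defs.ocomp; case: pselect => [h|]; first exact: (proj2_sig (cid h)).
by have := decomp_exists HV x.
Qed.

Lemma ocompE x j : ocomp x j = (-1) ^+ (val j != 0%N) *: rho (rm x (eb j)).
Proof. exact/decomp_comp/ocomp_decomp. Qed.

Lemma ocomp_unique x xs j : decomp lm rm x xs -> ocomp x j = xs j.
Proof. by move=> h; rewrite (decomp_comp _ h) ocompE. Qed.

Lemma ocomp_ReV x j : ReV (ocomp x j).
Proof. by have [h _] := ocomp_decomp x. Qed.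

Lemma ocomp_sum x : x = \sum_(i < 8) rm (ocomp x i) (eb i).
Proof.
by have [_ {1}->] := ocomp_decomp x; apply: eq_bigr => i _; rewrite eb_ord.
Qed.

Lemma ocompD x y j : ocomp (x + y) j = ocomp x j + ocomp y j.
Proof. by rewrite !ocompE (rmDl HV) rhoD scalerDr. Qed.

Lemma ocomp_rm y p j : ReV y -> ocomp (rm y p) j = p 0 j *: y.
Proof.
move=> hy; rewrite (@ocomp_unique _ (fun i => p 0 i *: y)) //; split=> [i|].
  exact: (ReVZ HV).
rewrite {1}[p]oct_eb.
have -> : forall q : 'I_8 -> oct R, rm y (\sum_(i < 8) q i) = \sum_(i < 8) rm y (q i).
  by move=> q; apply: (big_morph (rm y)) => [a b|]; rewrite ?(rmDr HV) ?(rm0r HV).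
by apply: eq_bigr => i _; rewrite (rmZr HV) (rmZl HV) eb_ord.
Qed.

Lemma onorm_eb i : onorm (eb i) = 1 :> R.
Proof.
rewrite /onorm (bigD1 (inord i)) //= mxE !eqxx expr1n big1 ?addr0 ?sqrtr1 //.
by move=> j /negPf h; rewrite mxE h andbF expr0n.
Qed.

(** The factor is [1/2 + 8/12] rounded up. *)
Lemma ocomp_norm x j : `|ocomp x j| <= 2 * `|x|.
Proof.
rewrite ocompE normrZ normrX normrN normr1 expr1n mul1r /rho.
have nr i y : `|rm y (eb i)| = `|y| by rewrite (rm_norm HV) onorm_eb mul1r.
have nl i y : `|lm (eb i) y| = `|y| by rewrite (lm_norm HV) onorm_eb mul1r.
apply: le_trans (ler_normB _ _) _; rewrite !normrZ nr.
have h : `|\sum_(i < 8) lm (eb i) (rm (rm x (eb j)) (eb i))| <= 8 * `|x|.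
  apply: le_trans (ler_norm_sum _ _ _) _.
  rewrite (eq_bigr (fun=> `|x|)) => [|i _]; last by rewrite nl !nr.
  by rewrite sumr_const card_ord -[X in X <= _]mulr_natl.
rewrite !ger0_norm ?invr_ge0 ?ler0n //.
have := normr_ge0 x; move: h; set a := `|\sum_(i < 8) _|; move: (`|x|) => b h b0.
have : 12^-1 * a <= 12^-1 * (8 * b) by apply: ler_wpM2l => //; rewrite invr_ge0 ler0n.
by lra.
Qed.

Lemma ReP_E x : ReP x = rho x.
Proof. by rewrite /Defs.ReP ocompE expr0 scale1r -one_oE (rm1 HV). Qed.

Lemma ReP_eq x y : (forall j, (j < 8)%N -> ReP (rm x (eb j)) = ReP (rm y (eb j))) -> x = y.
Proof.
move=> h; rewrite [x]ocomp_sum [y]ocomp_sum; apply: eq_bigr => i _; congr rm.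
by rewrite !ocompE -!ReP_E h.
Qed.

Lemma octD0 (p q : oct R) : (p + q) 0 0 = p 0 0 + q 0 0. Proof. by rewrite mxE. Qed.

Lemma octZ0 a (p : oct R) : (a *: p) 0 0 = a * p 0 0. Proof. by rewrite mxE. Qed.

(** Associators of octonions are purely imaginary; by trilinearity it suffices to go through the
    triples of units. *)
Lemma omul_assoc00 (p q r : oct R) :
  (omul (omul p q) r) 0 0 = (omul p (omul q r)) 0 0.
Proof.
elim/oct_ind: p => [p p' hp hp'|a p hp|i hi].
- by rewrite !omulDl !(octD0, octZ0) hp hp'.
- by rewrite !omulZl !(octD0, octZ0) hp.
elim/oct_ind: q => [q q' hq hq'|a q hq|j hj].
- by rewrite !(omulDl, omulDr) !(octD0, octZ0) hq hq'.
- by rewrite !(omulZl, omulZr) !(octD0, octZ0) hq.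
elim/oct_ind: r => [r r' hr hr'|a r hr|k hk].
- by rewrite !omulDr !(octD0, octZ0) hr hr'.
- by rewrite !omulZr !(octD0, octZ0) hr.
rewrite (omul_eb _ hi hj) (omul_eb _ hj hk) omulZl omulZr !octZ0.
rewrite !omul00 ?bidx_lt //.
have H : all (fun i => all (fun j => all (fun k =>
   ((bidx i j == k) == (i == bidx j k)) && ((bidx i j == k) ==>
     (bsgn i j (+) (k != 0%N) == bsgn j k (+) (i != 0%N))))
   (iota 0 8)) (iota 0 8)) (iota 0 8) by vm_compute.
move: H => /allP/(_ i); rewrite mem_iota => /(_ hi)/allP/(_ j).
rewrite mem_iota => /(_ hj)/allP/(_ k); rewrite mem_iota => /(_ hk)/andP[/eqP <-].
case: (eqVneq (bidx i j) k) => [->|_ _]; last by rewrite !mulr0.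
by rewrite -!signr_addb => /eqP ->.
Qed.

Lemma ReP_assoc x p q : ReP (rm (rm x p) q) = ReP (rm x (omul p q)).
Proof.
rewrite !ReP_E [x]ocomp_sum !(rm_sum HV) !rho_sum; apply: eq_bigr => i _.
have h := ocomp_ReV x i.
by rewrite !(ReV_rmA HV _ _ h) !rho_rm // omul_assoc00.
Qed.

(** The condition on [B_p] says that [f] commutes with right multiplication under [Re]. Testing
    against each [e_j] moves [p] and [e_j] jointly through [f], since real parts of triple products
    associate and [x] is nuclear. *)
Lemma BRO_rm f x p : in_BRO lm rm f -> ReV x -> f (rm x p) = rm (f x) p.
Proof.
case=> [[fD [fZ _]] hf] hx; apply: ReP_eq => j hj.
have h q y : ReP (rm (f y) q) = ReP (f (rm y q)).
  apply/eqP; rewrite -subr_eq0; apply/eqP; rewrite -[RHS](hf q y) !ReP_E /Bp.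
  by rewrite rhoD -[X in _ = _ + rho X]scaleN1r rhoZ scaleN1r.
by rewrite h ReP_assoc (ReV_rmA HV) // h.
Qed.

Lemma ext_rm h y p : (forall (a : R) x, h (a *: x) = a *: h x) -> ReV y ->
  ext lm rm h (rm y p) = rm (h y) p.
Proof.
move=> hZ hy; rewrite /ext [in RHS](oct_eb p).
have -> : forall (x : V) (q : 'I_8 -> oct R),
    rm x (\sum_(i < 8) q i) = \sum_(i < 8) rm x (q i).
  by move=> x q; apply: (big_morph (rm x)) => [a b|]; rewrite ?(rmDr HV) ?(rm0r HV).
by apply: eq_bigr => i _; rewrite ocomp_rm // hZ (rmZl HV) (rmZr HV) eb_ord.
Qed.

Lemma extD h x y : (forall x y, h (x + y) = h x + h y) ->
  ext lm rm h (x + y) = ext lm rm h x + ext lm rm h y.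
Proof.
by move=> hD; rewrite /ext -big_split; apply: eq_bigr => i _; rewrite ocompD hD (rmDl HV).
Qed.

Lemma ext_sum h (F : 'I_8 -> V) : (forall x y, h (x + y) = h x + h y) ->
  ext lm rm h (\sum_(i < 8) F i) = \sum_(i < 8) ext lm rm h (F i).
Proof.
move=> hD; apply: (big_morph (ext lm rm h)) => [x y|]; first exact: extD.
have : ext lm rm h 0 + ext lm rm h 0 = ext lm rm h 0 by rewrite -extD // addr0.
by move/(congr1 (fun z => z - ext lm rm h 0)); rewrite addrK subrr.
Qed.

(** On [v_i e_i] the three terms of the right action are [h(v_i)(p e_i)], [h(v_i)(e_i p)] and
    [-(h(v_i) e_i)p]. By alternativity of the right multiplication their sum is [(h(v_i) p) e_i]. *)
Lemma odot_ext h p v : (forall x y, h (x + y) = h x + h y) ->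
  (forall (a : R) x, h (a *: x) = a *: h x) ->
  odot_r lm rm (ext lm rm h) p v = \sum_(i < 8) rm (rm (h (ocomp v i)) p) (eb i).
Proof.
move=> hD hZ; rewrite /odot_r /Bp [v in LHS]ocomp_sum (lm_sum HV) !(ext_sum _ hD) !(rm_sum HV).
rewrite !(ext_sum _ hD) -!sumrB.
apply: eq_bigr => i _; have hv := ocomp_ReV v i.
rewrite ReV_lmA // (ReV_rmA HV) // !ext_rm //.
have e := rm_alt HV p (eb i) (h (ocomp v i)); move: e; rewrite (rmDr HV) => e.
by apply: (lin1 (c := -1) e); lmod.
Qed.

End Components.

(** * Slices of the octonions *)

Section Slice.
Variables (R : realType).
Local Notation C := (R[i]).
Ltac lmodo := lmod_with R (oct R).

Definition odot_prod (x y : oct R) : R := \sum_(i < 8) x 0 i * y 0 i.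

Lemma odot_prod_eb i j : (i < 8)%N -> (j < 8)%N ->
  odot_prod (eb i) (eb j) = (i == j)%:R.
Proof.
move=> hi hj; rewrite /odot_prod (bigD1 (inord i)) //= big1 ?addr0 => [|k /negPf hk].
  by rewrite !mxE !eqxx /= mul1r -val_eqE /= !inordK.
by rewrite mxE hk andbF mul0r.
Qed.

Lemma omul_polar (x y : oct R) : omul x y + omul y x =
  2 *: (x 0 0 *: y + y 0 0 *: x - odot_prod x y *: one_o R).
Proof.
elim/oct_ind: x => [x x' hx hx'|a x hx|i hi].
- rewrite omulDl omulDr addrACA hx hx' octD0 /odot_prod.
  have -> : \sum_(i < 8) (x + x') 0 i * y 0 i =
      \sum_(i < 8) x 0 i * y 0 i + \sum_(i < 8) x' 0 i * y 0 i.
    by rewrite -big_split; apply: eq_bigr => i _; rewrite mxE mulrDl.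
  by lmodo.
- rewrite omulZl omulZr -scalerDr hx octZ0 /odot_prod.
  have -> : \sum_(i < 8) (a *: x) 0 i * y 0 i = a * \sum_(i < 8) x 0 i * y 0 i.
    by rewrite mulr_sumr; apply: eq_bigr => i _; rewrite mxE mulrA.
  by lmodo.
elim/oct_ind: y => [x x' hx hx'|a x hx|j hj].
- rewrite omulDl omulDr addrACA hx hx' octD0 /odot_prod.
  have -> : \sum_(j < 8) eb i 0 j * (x + x') 0 j =
      \sum_(j < 8) eb i 0 j * x 0 j + \sum_(j < 8) eb i 0 j * x' 0 j.
    by rewrite -big_split; apply: eq_bigr => k _; rewrite [(x + x') 0 k]mxE mulrDr.
  by lmodo.
- rewrite omulZl omulZr -scalerDr hx octZ0 /odot_prod.
  have -> : \sum_(j < 8) eb i 0 j * (a *: x) 0 j = a * \sum_(j < 8) eb i 0 j * x 0 j.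
    by rewrite mulr_sumr; apply: eq_bigr => k _; rewrite [(a *: x) 0 k]mxE mulrCA.
  by lmodo.
rewrite odot_prod_eb // !eb00 //.
case: (posnP i) => [->|i0]; case: (posnP j) => [->|j0].
- by rewrite -one_oE omul1l !mulr1n; lmodo.
- by rewrite -one_oE omul1l omul1r !mulr1n (ltn_eqF j0) !mulr0n; lmodo.
- by rewrite -one_oE omul1l omul1r !mulr1n (gtn_eqF i0) !mulr0n; lmodo.
case: (eqVneq i j) => [->|ij].
  rewrite omul_eb // /bidx /bsgn eqxx (gtn_eqF j0) /= expr1 -one_oE mulr1n.
  by lmodo.
rewrite !mulr0n !scale0r addr0 subrr scaler0 !omul_eb //.
have H : all (fun i => all (fun j => [&& (0 < i)%N, (0 < j)%N & i != j] ==>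
   (bidx i j == bidx j i) && (bsgn i j == ~~ bsgn j i)) (iota 0 8)) (iota 0 8).
  by vm_compute.
move: H => /allP/(_ i); rewrite mem_iota => /(_ hi)/allP/(_ j).
rewrite mem_iota i0 j0 ij => /(_ hj)/andP[/eqP -> /eqP ->].
by rewrite signrN scaleNr addNr.
Qed.

Lemma omul_sqr (x : oct R) : omul x x = (2 * x 0 0) *: x - odot_prod x x *: one_o R.
Proof.
have := omul_polar x x => e.
have e2 : 2 *: omul x x = 2 *: ((2 * x 0 0) *: x - odot_prod x x *: one_o R).
  by apply: (lin1 (c := 1) e); lmodo.
by apply: scalerI e2; rewrite pnatr_eq0.
Qed.

Lemma one_o0 (j : 'I_8) : (one_o R) 0 j = (j == 0)%:R.
Proof. by rewrite mxE eqxx. Qed.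

Section Unit.
Variable J : oct R.
Hypothesis HJ : in_S J.

(** By the quadratic law [J J] is [2 J_0 J] minus a nonnegative real. If [J_0] were nonzero, all
    other coordinates of [J] would vanish and the square of [J_0] would be -1. *)
Lemma inS_re : J 0 0 = 0.
Proof.
have e := omul_sqr J; rewrite HJ in e.
have pos : 0 <= odot_prod J J.
  by apply: sumr_ge0 => i _; rewrite -expr2 sqr_ge0.
case: (eqVneq (J 0 0) 0) => // j0.
have J' j : j != 0 -> J 0 j = 0.
  move=> hj; have := congr1 (fun x : oct R => x 0 j) e; rewrite !mxE eqxx /=.
  rewrite (negPf hj) oppr0 mulr0 subr0 => /esym/eqP.
  by rewrite !mulf_eq0 pnatr_eq0 (negPf j0) /= => /eqP.
have := congr1 (fun x : oct R => x 0 0) e; rewrite !mxE eqxx /=.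
have -> : odot_prod J J = J 0 0 ^+ 2.
  rewrite /odot_prod (bigD1 0) //= big1 ?addr0 ?expr2 // => i /J' ->.
  by rewrite mulr0.
by have := sqr_ge0 (J 0 0); rewrite expr2; nra.
Qed.

Lemma inS_norm : odot_prod J J = 1.
Proof.
have := congr1 (fun x : oct R => x 0 0) (omul_sqr J).
rewrite HJ inS_re mulr0 scale0r sub0r !mxE eqxx /= !mulr1 => /eqP.
by rewrite eqr_opp => /eqP.
Qed.

Definition oz (z : C) : oct R := cJ J (complex.Re z) (complex.Im z).

Lemma ozM z w : oz (z * w) = omul (oz z) (oz w).
Proof.
case: z w => [a b] [c d]; rewrite /oz /cJ /=.
rewrite !(omulDl, omulDr, omulZl, omulZr, omul1l, omul1r) HJ.
by lmodo.
Qed.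

Lemma oz1 : oz 1 = one_o R. Proof. by rewrite /oz /cJ /= scale1r scale0r addr0. Qed.

Lemma ozX z m : oz (z ^+ m) = opow (oz z) m.
Proof.
elim: m => [|m IH]; first by rewrite expr0 oz1.
by rewrite exprS ozM IH.
Qed.

Lemma oz_norm z : onorm (oz z) = normc z.
Proof.
case: z => a b; rewrite /onorm /normc; congr Num.sqrt.
rewrite (eq_bigr (fun i => a ^+ 2 * ((one_o R) 0 i * (one_o R) 0 i)
   + 2 * a * b * ((one_o R) 0 i * J 0 i) + b ^+ 2 * (J 0 i * J 0 i))); last first.
  by move=> i _; rewrite /oz /cJ !mxE /=; ring.
rewrite !big_split -!mulr_sumr /= -/(odot_prod J J) inS_norm.
rewrite -/(odot_prod (one_o R) (one_o R)) one_oE odot_prod_eb // mulr1.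
rewrite -/(odot_prod (eb 0) J).
have -> : odot_prod (eb 0) J = 0.
  rewrite -one_oE /odot_prod big1 // => i _; rewrite one_o0.
  by case: eqP => [->|]; rewrite ?inS_re ?mulr0 ?mul0r.
by rewrite mulr0 addr0 !mulr1.
Qed.

End Unit.

Section Action.
Variables (V : completeNormedModType R) (lm : oct R -> V -> V) (rm : V -> oct R -> V).
Hypothesis HV : banach_O_bimodule lm rm.
Variable J : oct R.
Hypothesis HJ : in_S J.

(** The associator of two elements of one slice with [x] reduces to that of [J, J, x], which
    vanishes by alternativity. Hence each [J] makes [V] a complex vector space. *)
Lemma rm_slice x z w : rm (rm x (oz J z)) (oz J w) = rm x (oz J (z * w)).
Proof.
rewrite (rm_rm HV) ozM //.
suff -> : lm (omul (oz J z) (oz J w)) x - lm (oz J z) (lm (oz J w) x) = 0 by rewrite addr0.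
have e := lm_alt HV J x.
rewrite /oz /cJ !(omulDl, omulDr, omulZl, omulZr, omul1l, omul1r).
rewrite !((lmDl HV), (lmZl HV), (lmDr HV), (lmZr HV), (lm1 HV)) e.
by lmod_with R V.
Qed.

End Action.
End Slice.

(** * Integrals of vector-valued functions *)

(** Passes from local to global positive constants. One number [d] serves both as the radius of the
    ball and as the constant valid on it, and [Q] is inherited by smaller constants. *)
Lemma compact_uniform (R : realType) (T : pseudoMetricType R) (K : set T) (Q : R -> T -> Prop) :
  compact K -> (forall d d' x, 0 < d' <= d -> Q d x -> Q d' x) ->
  (forall x, K x -> exists2 d, 0 < d & forall y, K y -> ball x d y -> Q d y) ->
  exists2 d, 0 < d & forall x, K x -> Q d x.
Proof.
move=> cK anti loc.
have /near_covering_withinP cov := (compact_near_coveringP K).1 cK.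
have := cov R (0^'+) Q _ _.
case=> [x /loc[d d0 hd]|].
  exists (ball x d, [set i | 0 < i <= d]) => /=; last first.
    by move=> [y i] /= [hy hi] Ky; apply: anti hi _; exact: hd.
  split; first exact: nbhsx_ballx.
  near=> i; rewrite /mkset; apply/andP; split; near: i; [exact: nbhs_right_gt|exact: nbhs_right_le].
move=> e /= e0 he; exists (e / 2); first by rewrite divr_gt0.
move=> x Kx; apply: (he (e / 2)) => //=; last by rewrite divr_gt0.
by rewrite sub0r normrN gtr0_norm ?divr_gt0 // ltr_pdivrMr // ltr_pMr // ltr1n.
Unshelve. all: by end_near.
Qed.

Section Integral.
Variable R : realType.

Definition ucont (X : normedModType R) (g : R -> X) (a b : R) :=
  forall e : R, 0 < e -> exists2 d : R, 0 < d & forall u v : R, a <= u <= b -> a <= v <= b ->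
    `|u - v| < d -> `|g u - g v| <= e.

(** Keeps [e] and [d] explicit: convergence of Riemann sums in operator norm needs the same [d] for
    a whole family of integrands. *)
Definition prim_mod (X : normedModType R) (g G : R -> X) (a b e d : R) :=
  forall u t v : R, a <= u -> u <= t -> t <= v -> v <= b -> v - u < d ->
    `|G v - G u - (v - u) *: g t| <= e * (v - u).

(* the difference quotients converge uniformly, which makes Riemann sums of [g] converge to [G b - G a] *)
Definition prim (X : normedModType R) (g G : R -> X) (a b : R) :=
  forall e : R, 0 < e -> exists2 d : R, 0 < d & prim_mod g G a b e d.

Lemma ucont_continuous (X : normedModType R) (g : R -> X) a b :
  (forall t, a <= t <= b -> {for t, continuous g}) -> ucont g a b.
Proof.
move=> cg e e0.
have [|x /= hx|d d0 hd] := @compact_uniform R R `[a, b] (fun d x => forall y, a <= y <= b ->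
   `|x - y| < d -> `|g x - g y| <= e) (@segment_compact _ _ _).
- move=> d d' x /andP[_ dd'] h y hy xy; apply: h => //; exact: lt_le_trans dd'.
- rewrite in_itv /= in hx.
  have /cvgr_dist_le/(_ (e / 2)) := cg x hx; rewrite divr_gt0 // => /(_ isT) [d /= d0 hd].
  exists (d / 2); first by rewrite divr_gt0.
  move=> y /=; rewrite in_itv /= => hy xy z hz yz.
  have -> : g y - g z = (g x - g z) - (g x - g y) by lmod_with R X.
  apply: le_trans (ler_normB _ _) _; rewrite (splitr e) lerD //; apply: hd => /=.
    rewrite /ball /= in xy; have -> : x - z = (x - y) + (y - z) by rewrite subrKA.
    by rewrite (le_lt_trans (ler_normD _ _)) // (splitr d) ltrD.
  by rewrite /ball /= in xy; apply: lt_le_trans xy _; rewrite ler_pdivrMr // ler_peMr ?ltW // ltr1n.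
by exists d => // u v hu hv uv; apply: hd.
Qed.

Section Normed.
Variable X : normedModType R.
Implicit Types (g G : R -> X) (a b e d M : R).

Lemma tagged_mono a b p tg d (Hp : @tagged_part R a b p tg d) i j :
  (i <= j <= size tg)%N -> p`_i <= p`_j.
Proof.
case: Hp => _ [_ [_ h]]; elim: j => [|j IH]; first by rewrite leqn0 => /andP[/eqP ->].
rewrite leq_eqVlt => /andP[/orP[/eqP -> //|ij] jt].
have [/andP[h1 h2] _] := h j jt.
by apply: le_trans (le_trans h1 h2); apply: IH; rewrite -ltnS ij ltnW.
Qed.

(** Each tag lies in its subinterval, so the errors telescope to [e] times the total length. *)
Lemma prim_riemann g G a b e d p tg : prim_mod g G a b e d -> @tagged_part R a b p tg d ->
  `|\sum_(i < size tg) (p`_i.+1 - p`_i) *: g tg`_i - (G b - G a)| <= e * (b - a).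
Proof.
move=> hG Hp; have mono := tagged_mono Hp; case: (Hp) => sp [p0 [pn h]].
have tel (Y : zmodType) (f : R -> Y) : \sum_(i < size tg) (f p`_i.+1 - f p`_i) = f b - f a.
  by rewrite -(big_mkord xpredT (fun i => f p`_i.+1 - f p`_i)) telescope_sumr // p0 pn.
rewrite -(tel _ G) -(tel _ id) -sumrB mulr_sumr.
apply: le_trans (ler_norm_sum _ _ _) _; apply: ler_sum => i _; rewrite distrC.
have [/andP[h1 h2] /andP[_ h3]] := h i (ltn_ord i).
apply: hG => //; first by rewrite -p0 mono //= ltnW.
by rewrite -pn mono // ltn_ord leqnn.
Qed.

Lemma tagged_uniform a b d : a < b -> 0 < d -> exists N : nat, forall n, (N <= n)%N ->
  @tagged_part R a b (mkseq (fun i => a + (b - a) * (i%:R / n.+1%:R)) n.+2)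
    (mkseq (fun i => a + (b - a) * (i%:R / n.+1%:R)) n.+1) d.
Proof.
move=> ab d0; have ba : 0 < b - a by rewrite subr_gt0.
exists (Num.trunc ((b - a) / d)) => n hn.
have n0 : (0 : R) < n.+1%:R by rewrite ltr0n.
have step i : a + (b - a) * (i.+1%:R / n.+1%:R) - (a + (b - a) * (i%:R / n.+1%:R)) =
    (b - a) / n.+1%:R.
  by rewrite -natr1; field; rewrite addrC natr1 pnatr_eq0.
split; first by rewrite !size_mkseq.
split; first by rewrite nth_mkseq // mul0r mulr0 addr0.
split; first by rewrite size_mkseq nth_mkseq // divff ?mulr1 ?subrKC // gt_eqF.
move=> i; rewrite size_mkseq => hi; rewrite !nth_mkseq ?ltnS // ?(ltnW hi) // step.
split; first by rewrite lexx -subr_ge0 step divr_ge0 // ltW.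
rewrite divr_gt0 //= ltr_pdivrMr // mulrC -ltr_pdivrMr //.
apply: lt_le_trans (truncnS_gt _) _; by rewrite ler_nat ltnS.
Qed.

Lemma tagged_exists a b d : a < b -> 0 < d -> exists p tg, @tagged_part R a b p tg d.
Proof.
by move=> ab d0; have [N h] := tagged_uniform ab d0; do 2 eexists; exact: (h N).
Qed.

Lemma tagged_mem a b p tg d (Hp : @tagged_part R a b p tg d) i : (i < size tg)%N ->
  a <= tg`_i <= b.
Proof.
move=> hi; have mono := tagged_mono Hp; case: Hp => _ [p0 [pn h]].
have [/andP[h1 h2] _] := h i hi; apply/andP; split.
  by apply: le_trans h1; rewrite -p0 mono //= ltnW.
by apply: le_trans h2 _; rewrite -pn mono // hi leqnn.
Qed.

(** Mean value inequality for vector values: the increment is compared with a Riemann sum of norm at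
    most [M (b - a)]. *)
Lemma prim_bound g G a b M : a <= b -> prim g G a b ->
  (forall t, a <= t <= b -> `|g t| <= M) -> `|G b - G a| <= M * (b - a).
Proof.
rewrite le_eqVlt => /orP[/eqP <- _ _|ab hG hM]; first by rewrite !subrr normr0 mulr0.
have ba : 0 < b - a by rewrite subr_gt0.
apply/ler_addgt0Pr => e e0.
have [d d0 hd] := hG (e / (b - a)) (divr_gt0 e0 ba).
have [p [tg Hp]] := tagged_exists ab d0.
have := prim_riemann hd Hp; rewrite divfK ?gt_eqF //.
set S := \sum_(i < _) _ => hS.
have -> : G b - G a = S - (S - (G b - G a)) by rewrite subKr.
apply: le_trans (ler_normB _ _) _; apply: lerD => //.
have [_ [p0 [pn h]]] := Hp.
have -> : b - a = \sum_(i < size tg) (p`_i.+1 - p`_i).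
  by rewrite -(big_mkord xpredT (fun i => p`_i.+1 - p`_i)) telescope_sumr // p0 pn.
rewrite mulr_sumr; apply: le_trans (ler_norm_sum _ _ _) _; apply: ler_sum => i _.
have [_ /andP[h3 _]] := h i (ltn_ord i).
rewrite normrZ gtr0_norm // mulrC ler_wpM2r ?(ltW h3) //.
by apply: hM; apply: tagged_mem Hp _ _.
Qed.

Lemma primZD (c : R) g h G H a b : prim g G a b -> prim h H a b ->
  prim (fun t => c *: g t + h t) (fun t => c *: G t + H t) a b.
Proof.
move=> hG hH e e0.
have c1 : 0 < `|c| + 1 by rewrite ltr_wpDl.
have [d1 d10 h1] := hG (e / 2 / (`|c| + 1)) (divr_gt0 (divr_gt0 e0 (ltr0Sn R 1)) c1).
have [d2 d20 h2] := hH (e / 2) (divr_gt0 e0 (ltr0Sn R 1)).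
exists (Num.min d1 d2); first by rewrite lt_min d10.
move=> u t v au ut tv vb; rewrite lt_min => /andP[k1 k2].
have uv : 0 <= v - u by rewrite subr_ge0 (le_trans ut).
have -> : c *: G v + H v - (c *: G u + H u) - (v - u) *: (c *: g t + h t) =
  c *: (G v - G u - (v - u) *: g t) + (H v - H u - (v - u) *: h t) by lmod_with R X.
apply: le_trans (ler_normD _ _) _; rewrite normrZ (splitr e) mulrDl lerD //.
  apply: le_trans (ler_wpM2l _ (h1 u t v au ut tv vb k1)) _; first exact: normr_ge0.
  rewrite mulrA ler_wpM2r // mulrCA ler_piMr ?divr_ge0 ?(ltW e0) //.
  by rewrite ler_pdivrMr // mul1r lerDl.
exact: h2.
Qed.

Lemma prim0 a b : prim (fun=> 0 : X) (fun=> 0) a b.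
Proof.
move=> e e0; exists 1 => // u t v _ ut tv _ _.
by rewrite scaler0 !subrr normr0 mulr_ge0 ?(ltW e0) // subr_ge0 (le_trans ut).
Qed.

Lemma primD g h G H a b : prim g G a b -> prim h H a b ->
  prim (fun t => g t + h t) (fun t => G t + H t) a b.
Proof.
move=> hg hh; have := primZD 1 hg hh.
by under [X in prim X]eq_fun do rewrite scale1r; under [X in prim _ X]eq_fun do rewrite scale1r.
Qed.

Lemma primZ (c : R) g G a b : prim g G a b ->
  prim (fun t => c *: g t) (fun t => c *: G t) a b.
Proof.
move=> hg; have := primZD c hg (prim0 a b).
by under [X in prim X]eq_fun do rewrite addr0; under [X in prim _ X]eq_fun do rewrite addr0.
Qed.

Lemma prim_ext g h G H a b : (forall t, a <= t <= b -> g t = h t) ->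
  (forall t, a <= t <= b -> G t = H t) -> prim g G a b -> prim h H a b.
Proof.
move=> gh GH hG e e0; have [d d0 hd] := hG e e0; exists d => // u t v au ut tv vb k.
have tb := le_trans tv vb; have at_ := le_trans au ut.
have := hd u t v au ut tv vb k; rewrite gh ?at_ // !GH //.
  by rewrite au (le_trans ut).
by rewrite (le_trans at_).
Qed.

Lemma prim_sub g G a b a' b' : a <= a' -> b' <= b -> prim g G a b -> prim g G a' b'.
Proof.
move=> aa bb hG e e0; have [d d0 hd] := hG e e0; exists d => // u t v au ut tv vb k.
by apply: hd => //; [exact: le_trans au | exact: le_trans bb].
Qed.

Lemma prim_sum (I : Type) (s : seq I) (g G : I -> R -> X) a b :
  (forall i, prim (g i) (G i) a b) ->
  prim (fun t => \sum_(i <- s) g i t) (fun t => \sum_(i <- s) G i t) a b.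
Proof.
move=> h; elim: s => [|i s IH].
  apply: prim_ext (prim0 a b) => t _; by rewrite big_nil.
by apply: prim_ext (primD (h i) IH) => t _; rewrite big_cons.
Qed.

Lemma primB g h G H a b : prim g G a b -> prim h H a b ->
  prim (fun t => g t - h t) (fun t => G t - H t) a b.
Proof.
move=> hg hh; apply: prim_ext (primZD (-1) hh hg) => t _;
by rewrite scaleN1r addrC.
Qed.

Lemma prim_unique g G H a b : a <= b -> prim g G a b -> prim g H a b ->
  G b - G a = H b - H a.
Proof.
move=> ab hG hH; apply/eqP; rewrite -subr_eq0 -normr_le0.
have -> : G b - G a - (H b - H a) = G b - H b - (G a - H a) by lmod_with R X.
have := @prim_bound _ _ a b 0 ab (primB hG hH); rewrite mul0r; apply => t _.
by rewrite subrr normr0.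
Qed.

Lemma ucontD g h a b : ucont g a b -> ucont h a b -> ucont (fun t => g t + h t) a b.
Proof.
move=> hg hh e e0; have e2 : 0 < e / 2 by rewrite divr_gt0.
have [d1 d10 h1] := hg _ e2; have [d2 d20 h2] := hh _ e2.
exists (Num.min d1 d2); first by rewrite lt_min d10.
move=> u v hu hv; rewrite lt_min => /andP[k1 k2].
have -> : g u + h u - (g v + h v) = (g u - g v) + (h u - h v) by rewrite opprD addrACA.
by rewrite (le_trans (ler_normD _ _)) // (splitr e) lerD // ?h1 ?h2.
Qed.

Lemma ucont_limit g a b : (forall e, 0 < e -> exists2 h : R -> X, ucont h a b &
   forall t, a <= t <= b -> `|g t - h t| <= e) -> ucont g a b.
Proof.
move=> hl e e0; have e3 : 0 < e / 3 by rewrite divr_gt0.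
have [h uh hh] := hl _ e3; have [d d0 hd] := uh _ e3; exists d => // u v hu hv uv.
have -> : g u - g v = (g u - h u) + (h u - h v) - (g v - h v) by lmod_with R X.
have := hh u hu; have := hh v hv; have := hd u v hu hv uv.
have := ler_normB (g u - h u + (h u - h v)) (g v - h v).
have := ler_normD (g u - h u) (h u - h v); lra.
Qed.

Lemma ucont_bound g a b : ucont g a b -> exists2 M, 0 <= M & forall t, a <= t <= b -> `|g t| <= M.
Proof.
move=> ug; have [d d0 hd] := ug 1 ltr01.
have [|x /= hx|e e0 he] := @compact_uniform R R `[a, b]
  (fun d x => `|g x| <= d^-1) (@segment_compact _ _ _).
- move=> e e' x /andP[e0 ee'] /le_trans; apply.
  by rewrite lef_pV2 ?posrE // (lt_le_trans e0).
- rewrite in_itv /= in hx; exists (Num.min d (`|g x| + 1)^-1).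
    by rewrite lt_min d0 invr_gt0 ltr_wpDl.
  move=> y /=; rewrite in_itv /= => hy; rewrite /ball /= lt_min => /andP[xy _].
  have := hd y x hy hx; rewrite distrC => /(_ xy) h.
  have : `|g y| <= `|g x| + 1.
    have -> : g y = g x + (g y - g x) by rewrite subrKC.
    by apply: le_trans (ler_normD _ _) _; rewrite lerD2l.
  move/le_trans; apply; rewrite -[leLHS]invrK lef_pV2 ?posrE ?invr_gt0 ?ltr_wpDl //.
    by rewrite ge_min lexx orbT.
  by rewrite lt_min d0 invr_gt0 ltr_wpDl.
by exists e^-1; [rewrite invr_ge0 ltW | move=> t ht; apply: he; rewrite /= in_itv].
Qed.

End Normed.
End Integral.

Section Existence.
Variables (R : realType) (X : completeNormedModType R).

Lemma complete_sequence (u : nat -> X) :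
  (forall e : R, 0 < e -> exists N, forall n m, (N <= n)%N -> (N <= m)%N -> `|u n - u m| <= e) ->
  exists l, forall e : R, 0 < e -> exists N, forall n, (N <= n)%N -> `|u n - l| <= e.
Proof.
move=> cu; have : cvg (u n @[n --> \oo]).
  apply/cauchy_cvgP/cauchy_exP => e e0.
  have [N hN] := cu (e / 2) (divr_gt0 e0 (ltr0Sn R 1)).
  exists (u N); exists N => // n /= Nn; rewrite -ball_normE /=.
  apply: le_lt_trans (hN N n (leqnn N) Nn) _.
  by rewrite ltr_pdivrMr // ltr_pMr // ltr1n.
move=> /cvg_ex[l hl]; exists l => e e0.
have /cvgr_dist_le/(_ e e0)[N _ hN] := hl.
by exists N => n Nn; rewrite distrC; exact: hN.
Qed.

Section Construction.
Variables (g : R -> X) (a b : R).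
Hypothesis ab : a < b.
Hypothesis ug : ucont g a b.

Let h (N : nat) : R := (b - a) / N.+1%:R.
Let node (N i : nat) : R := a + i%:R * h N.
(** Up to [b], the length of the part of the [i]-th subinterval left of [t]; thus [step N t]
    integrates from [a] to [t] the step function with values [g (node N i)]. *)
Let piece (N i : nat) (t : R) : R := Num.min t (node N i.+1) - Num.min t (node N i).
Let step (N : nat) (t : R) : X := \sum_(i < N.+1) piece N i t *: g (node N i).

Let h_gt0 N : 0 < h N. Proof. by rewrite divr_gt0 ?subr_gt0 ?ltr0n. Qed.

Let h_small d : 0 < d -> exists N0, forall N, (N0 <= N)%N -> h N < d.
Proof.
move=> d0; exists (Num.trunc ((b - a) / d)) => N hN.
rewrite /h ltr_pdivrMr ?ltr0n // mulrC -ltr_pdivrMr //.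
by apply: lt_le_trans (truncnS_gt _) _; rewrite ler_nat ltnS.
Qed.

Let nodeS N i : node N i.+1 = node N i + h N.
Proof. by rewrite /node -natr1; ring. Qed.

Let node0 N : node N 0 = a. Proof. by rewrite /node mul0r addr0. Qed.
Let nodeN N : node N N.+1 = b.
Proof. by rewrite /node /h mulrC divfK ?pnatr_eq0 // subrKC. Qed.

Let node_mem N i : (i <= N)%N -> a <= node N i <= b.
Proof.
move=> iN; rewrite /node lerDl mulr_ge0 ?ler0n ?(ltW (h_gt0 N)) //= -lerBrDl.
rewrite /h mulrCA ler_piMr ?subr_ge0 ?(ltW ab) // ler_pdivrMr ?ltr0n // mul1r.
by rewrite ler_nat leqW.
Qed.

Let piece_sum N t : a <= t <= b -> \sum_(i < N.+1) piece N i t = t - a.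
Proof.
case/andP => at_ tb.
rewrite -(big_mkord xpredT (fun i => piece N i t)) /piece telescope_sumr // nodeN node0.
by rewrite min_l // min_r.
Qed.

Let piece_mono N i u v : u <= v -> 0 <= piece N i v - piece N i u /\
  (piece N i v - piece N i u != 0 -> node N i <= v /\ u <= node N i + h N).
Proof.
move=> uv; rewrite /piece nodeS; have := h_gt0 N; set x := node N i; set k := h N => k0.
rewrite !minEle; case: (leP v (x + k)); case: (leP v x); case: (leP u (x + k));
 case: (leP u x) => *; split; try (by lra); move/eqP => ne; split; lra.
Qed.

Let step_mod e d N u t v : 0 <= e ->
  (forall u v, a <= u <= b -> a <= v <= b -> `|u - v| < d -> `|g u - g v| <= e) ->
  a <= u -> u <= t -> t <= v -> v <= b -> v - u + h N < d ->
  `|step N v - step N u - (v - u) *: g t| <= e * (v - u).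
Proof.
move=> e0 hd au ut tv vb hN; have uv := le_trans ut tv.
have -> : v - u = \sum_(i < N.+1) (piece N i v - piece N i u).
  rewrite sumrB !piece_sum ?au ?vb ?(le_trans au uv) ?(le_trans uv vb) //; ring.
rewrite /step -sumrB scaler_suml -sumrB mulr_sumr.
apply: le_trans (ler_norm_sum _ _ _) _; apply: ler_sum => i _.
have [w0 wn] := piece_mono N i uv.
rewrite -scalerBl -scalerBr normrZ (ger0_norm w0) mulrC.
have [->|/wn[h1 h2]] := eqVneq (piece N i v - piece N i u) 0; first by rewrite !mulr0.
apply: ler_wpM2r => //; apply: hd.
- by apply: node_mem; rewrite -ltnS.
- by rewrite (le_trans au) // (le_trans tv).
have := h_gt0 N; rewrite ltr_norml => ?; apply/andP; split; lra.
Qed.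

Let step_a N : step N a = 0.
Proof.
rewrite /step big1 // => i _; rewrite /piece !min_l ?subrr ?scale0r //.
  by have /andP[] := @node_mem N i (ltn_ord i).
by rewrite nodeS (le_trans (proj1 (andP (@node_mem N i (ltn_ord i))))) // lerDl ltW.
Qed.

Let step_cauchy e d : 0 < d -> 0 <= e ->
  (forall u v, a <= u <= b -> a <= v <= b -> `|u - v| < d -> `|g u - g v| <= e) ->
  exists N0, forall N M t, (N0 <= N)%N -> (N0 <= M)%N -> a <= t <= b ->
    `|step N t - step M t| <= 2 * e * (b - a).
Proof.
move=> d0 e0 hd; have d2 : 0 < d / 2 by rewrite divr_gt0.
have [N0 hN0] := h_small d2; exists N0 => N M t hN hM /andP[at_ tb].
have [<-|at'] := eqVneq a t.
  rewrite !step_a subrr normr0 mulr_ge0 ?subr_ge0 ?(ltW ab) //; exact: mulr_ge0.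
have {at_ at'}at_ : a < t by rewrite lt_neqAle at'.
have [p [tg Hp]] := tagged_exists at_ d2.
have key K : (N0 <= K)%N -> `|\sum_(i < size tg) (p`_i.+1 - p`_i) *: g tg`_i - step K t|
    <= e * (t - a).
  move=> hK; suff hm : prim_mod g (step K) a t e (d / 2).
    by have := prim_riemann hm Hp; rewrite step_a subr0.
  move=> u x v au ux xv vt huv.
  apply: (step_mod e0 hd) => //; first exact: le_trans vt tb.
  by have := hN0 K hK; lra.
set S := \sum_(i < _) _ in key.
have -> : step N t - step M t = (S - step M t) - (S - step N t) by lmod_with R X.
apply: le_trans (ler_normB _ _) _; have := key N hN; have := key M hM.
have : e * (t - a) <= e * (b - a) by rewrite ler_wpM2l // lerD2r.
lra.
Qed.

(** The primitive is the limit of the integrals of step functions. It inherits every modulus of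
    continuity of [g] unchanged, because the mesh [h N] that [step_mod] adds to [v - u] tends to
    zero. *)
Lemma prim_construct : exists G : R -> X, forall e d : R, 0 < d -> 0 <= e ->
  (forall u v, a <= u <= b -> a <= v <= b -> `|u - v| < d -> `|g u - g v| <= e) ->
  prim_mod g G a b e d.
Proof.
have ba : 0 < b - a by rewrite subr_gt0.
have cv t : exists l, a <= t <= b -> forall e : R, 0 < e ->
    exists N, forall n, (N <= n)%N -> `|step n t - l| <= e.
  case: (boolP (a <= t <= b)) => [ht|_]; last by exists 0.
  have [|l hl] := @complete_sequence (step^~ t); last by exists l.
  move=> e e0; have [d d0 hd] := ug (divr_gt0 e0 (mulr_gt0 (ltr0Sn R 1) ba)).
  have [|N0 hN] := step_cauchy d0 _ hd; first by rewrite divr_ge0 ?(ltW e0) // mulr_ge0 // ltW.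
  exists N0 => n m hn hm; apply: le_trans (hN n m t hn hm ht) _.
  by rewrite -mulrA mulrCA divfK ?gt_eqF // mulr_gt0.
have [G hG] := choice cv; exists G => e d d0 e0 hd u t v au ut tv vb hv.
have uv := le_trans ut tv.
apply/ler_addgt0Pr => n n0; have n2 : 0 < n / 2 by rewrite divr_gt0.
have [|N1 hN1] := hG u _ _ n2; first by rewrite au (le_trans uv).
have [|N2 hN2] := hG v _ _ n2; first by rewrite vb (le_trans au).
have [|N3 hN3] := @h_small (d - (v - u)); first by rewrite subr_gt0.
set N := maxn N1 (maxn N2 N3).
have k1 := hN1 N (leq_maxl _ _).
have k2 := hN2 N (leq_trans (leq_maxl _ _) (leq_maxr _ _)).
have k3 := hN3 N (leq_trans (leq_maxr _ _) (leq_maxr _ _)).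
have := @step_mod e d N u t v e0 hd au ut tv vb; rewrite -ltrBrDl => /(_ k3) k4.
have -> : G v - G u - (v - u) *: g t = (step N v - step N u - (v - u) *: g t)
   - (step N v - G v) + (step N u - G u) by lmod_with R X.
have := ler_normD (step N v - step N u - (v - u) *: g t - (step N v - G v)) (step N u - G u).
have := ler_normB (step N v - step N u - (v - u) *: g t) (step N v - G v).
lra.
Qed.

End Construction.

Lemma prim_exists (g : R -> X) a b : a < b -> ucont g a b -> exists G, prim g G a b.
Proof.
move=> ab ug; have [G hG] := prim_construct ab ug; exists G => e e0.
have [d d0 hd] := ug e e0; exists d => //; apply: hG => //; exact: ltW.
Qed.

End Existence.

Section Derivatives.
Variable R : realType.

Lemma prim_derive (f f' : R -> R) (a b : R) : (forall t : R, a <= t <= b -> is_derive t 1 f (f' t)) ->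
  ucont f' a b -> prim f' f a b.
Proof.
move=> df uf e e0; have [d d0 hd] := uf e e0; exists d => // u t v au ut tv vb huv.
have uv := le_trans ut tv.
have mem x : u <= x <= v -> a <= x <= b.
  by case/andP => ux xv; rewrite (le_trans au ux) (le_trans xv vb).
have [||c hc ->] := @MVT_segment R f f' u v uv.
- by move=> x; rewrite in_itv /= => /andP[ux xv]; apply: df; apply: mem; rewrite !ltW.
- apply: derivable_within_continuous => x; rewrite in_itv /= => hx.
  by have [] := df x (mem x hx).
rewrite in_itv /= in hc; rewrite /GRing.scale /= mulrC -mulrBr normrM ger0_norm ?subr_ge0 //.
rewrite mulrC ler_wpM2r ?subr_ge0 //; apply: hd; [exact: mem | by apply: mem; rewrite ut|].
case/andP: hc => h1 h2; rewrite ltr_norml; apply/andP; split; lra.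
Qed.

Lemma prim_lin (X Y : normedModType R) (L : X -> Y) (C : R) g G a b :
  (forall x y, L (x + y) = L x + L y) -> (forall (r : R) x, L (r *: x) = r *: L x) ->
  (forall x, `|L x| <= C * `|x|) -> prim g G a b -> prim (L \o g) (L \o G) a b.
Proof.
move=> LD LZ LC hG e e0.
have C1 : 0 < `|C| + 1 by rewrite ltr_wpDl.
have [d d0 hd] := hG _ (divr_gt0 e0 C1); exists d => // u t v au ut tv vb huv /=.
have LB x y : L (x - y) = L x - L y by rewrite LD -scaleN1r LZ scaleN1r.
rewrite -LZ -!LB; apply: le_trans (LC _) _.
have h := hd u t v au ut tv vb huv.
have vu : 0 <= v - u by rewrite subr_ge0 (le_trans ut).
apply: (@le_trans _ _ ((`|C| + 1) * `|G v - G u - (v - u) *: g t|)).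
  by rewrite ler_wpM2r // (le_trans (ler_norm C)) // lerDl.
apply: le_trans (ler_wpM2l (ltW C1) h) _.
by rewrite mulrA mulrCA divff ?gt_eqF // mulr1.
Qed.

End Derivatives.

(** * Complex-valued functions and line integrals *)

Section ComplexDerivatives.
Variable R : realType.
Local Notation C := (R[i]).
Local Notation Re := (@complex.Re R).
Local Notation Im := (@complex.Im R).
Implicit Types (z w : R -> C).

(** The paths have a real parameter, so the derivative is taken separately on real and imaginary
    parts. *)
Definition cder z z' t := is_derive (t : R) 1 (fun u => Re (z u)) (Re (z' t)) /\
                          is_derive (t : R) 1 (fun u => Im (z u)) (Im (z' t)).

Definition ccont z (t : R) := {for t, continuous (fun u => Re (z u))} /\
                        {for t, continuous (fun u => Im (z u))}.

Lemma is_derive_ext (f g : R -> R) (t a b : R) : f =1 g -> a = b ->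
  is_derive t 1 f a -> is_derive t 1 g b.
Proof. by move=> /funext <- <-. Qed.

Lemma cder_cont z z' t : cder z z' t -> ccont z t.
Proof.
by case=> h1 h2; split; apply/differentiable_continuous/derivable1_diffP; apply: ex_derive.
Qed.

Lemma cder_cst (c : C) t : cder (fun=> c) (fun=> 0) t.
Proof. by split; apply: is_derive_cst. Qed.

Lemma cderD z z' w w' t : cder z z' t -> cder w w' t ->
  cder (fun u => z u + w u) (fun u => z' u + w' u) t.
Proof.
move=> [z1 z2] [w1 w2]; split.
  apply: (is_derive_ext _ _ (is_deriveD z1 w1)) => [u|]; rewrite ?fctE.
    by case: (z u) (w u) => ? ? [].
  by case: (z' t) (w' t) => ? ? [].
apply: (is_derive_ext _ _ (is_deriveD z2 w2)) => [u|]; rewrite ?fctE.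
  by case: (z u) (w u) => ? ? [].
by case: (z' t) (w' t) => ? ? [].
Qed.

Lemma cderM z z' w w' t : cder z z' t -> cder w w' t ->
  cder (fun u => z u * w u) (fun u => z' u * w u + z u * w' u) t.
Proof.
move=> [z1 z2] [w1 w2]; split.
  apply: (is_derive_ext _ _ (is_deriveB (is_deriveM z1 w1) (is_deriveM z2 w2))) => [u|].
    by rewrite !fctE; case: (z u) (w u) => ? ? [].
  rewrite /GRing.scale /=.
  by case: (z' t) (w' t) (z t) (w t) => ? ? [? ?] [? ?] [? ?] /=; ring.
apply: (is_derive_ext _ _ (is_deriveD (is_deriveM z1 w2) (is_deriveM z2 w1))) => [u|].
  rewrite !fctE; case: (z u) (w u) => ? ? [? ?] //=.
rewrite /GRing.scale /=.
by case: (z' t) (w' t) (z t) (w t) => ? ? [? ?] [? ?] [? ?] /=; ring.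
Qed.

Lemma sqr_sum_neq0 (c : C) : c != 0 -> Re c ^+ 2 + Im c ^+ 2 != 0.
Proof.
case: c => a b; rewrite eq_complex /= => h.
by rewrite paddr_eq0 ?sqr_ge0 // !sqrf_eq0.
Qed.

Lemma cderV z z' t : cder z z' t -> z t != 0 ->
  cder (fun u => (z u)^-1) (fun u => - (z' u * (z u)^-1 * (z u)^-1)) t.
Proof.
move=> [z1 z2] z0; have n0 := sqr_sum_neq0 z0.
pose n := (fun u => Re (z u)) * (fun u => Re (z u)) + (fun u => Im (z u)) * (fun u => Im (z u)).
have nd : is_derive t 1 n (Re (z t) *: Re (z' t) + Re (z t) *: Re (z' t) +
     (Im (z t) *: Im (z' t) + Im (z t) *: Im (z' t))).
  exact: (is_deriveD (is_deriveM z1 z1) (is_deriveM z2 z2)).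
have nt : n t != 0 by rewrite /n !fctE -!expr2.
have nv := is_deriveV nt nd.
split.
  apply: (is_derive_ext _ _ (is_deriveM z1 nv)) => [u|].
    by rewrite /n !fctE; case: (z u) => ? ? /=; rewrite !expr2.
  move: n0; rewrite /n !fctE /GRing.scale /=; case: (z t) (z' t) => a b [c d] /= n0.
  by field; rewrite -?expr2 n0.
apply: (is_derive_ext _ _ (is_deriveN (is_deriveM z2 nv))) => [u|].
  by rewrite /n !fctE; case: (z u) => ? ? /=; rewrite !expr2.
move: n0; rewrite /n !fctE /GRing.scale /=; case: (z t) (z' t) => a b [c d] /= n0.
by field; rewrite -?expr2 n0.
Qed.

Lemma ccont_cst (c : C) t : ccont (fun=> c) t.
Proof. by split; apply: cst_continuous. Qed.

Lemma ccont_ext z w t : z =1 w -> ccont z t -> ccont w t.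
Proof. by move=> /funext ->. Qed.

Lemma ccontD z w t : ccont z t -> ccont w t -> ccont (fun u => z u + w u) t.
Proof.
move=> [z1 z2] [w1 w2]; split.
  rewrite (_ : (fun _ => _) = (fun u => Re (z u) + Re (w u))); first exact: continuousD.
  by apply/funext => u; case: (z u) (w u) => ? ? [].
rewrite (_ : (fun _ => _) = (fun u => Im (z u) + Im (w u))); first exact: continuousD.
by apply/funext => u; case: (z u) (w u) => ? ? [].
Qed.

Lemma ccontM z w t : ccont z t -> ccont w t -> ccont (fun u => z u * w u) t.
Proof.
move=> [z1 z2] [w1 w2]; split.
  rewrite (_ : (fun _ => _) = (fun u => Re (z u) * Re (w u) - Im (z u) * Im (w u))).
    by apply: continuousB; exact: continuousM.
  by apply/funext => u; case: (z u) (w u) => ? ? [].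
rewrite (_ : (fun _ => _) = (fun u => Re (z u) * Im (w u) + Im (z u) * Re (w u))).
  by apply: continuousD; exact: continuousM.
by apply/funext => u; case: (z u) (w u) => ? ? [? ?] /=.
Qed.

Lemma ccontV z t : ccont z t -> z t != 0 -> ccont (fun u => (z u)^-1) t.
Proof.
move=> [z1 z2] z0; have n0 := sqr_sum_neq0 z0.
have cn : {for t, continuous (fun u => (Re (z u) * Re (z u) + Im (z u) * Im (z u))^-1)}.
  apply: continuousV; first by rewrite -!expr2.
  by apply: continuousD; exact: continuousM.
split.
  rewrite (_ : (fun _ => _) = (fun u => Re (z u) * (Re (z u) * Re (z u) + Im (z u) * Im (z u))^-1)).
    exact: continuousM.
  by apply/funext => u; case: (z u) => ? ? /=; rewrite !expr2.
rewrite (_ : (fun _ => _) = (fun u => - (Im (z u) * (Re (z u) * Re (z u) + Im (z u) * Im (z u))^-1))).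
  by apply: continuousN; exact: continuousM.
by apply/funext => u; case: (z u) => ? ? /=; rewrite !expr2.
Qed.

Lemma ccontN z t : ccont z t -> ccont (fun u => - z u) t.
Proof.
move=> hz; apply: ccont_ext (ccontM (ccont_cst (-1) t) hz) => u.
by rewrite mulN1r.
Qed.

Lemma ccontX z n t : ccont z t -> ccont (fun u => z u ^+ n) t.
Proof.
move=> hz; elim: n => [|n IH]; first exact: ccont_cst.
by apply: ccont_ext (ccontM hz IH) => u; rewrite exprS.
Qed.

Lemma ccont_horner (p : {poly C}) z t : ccont z t -> ccont (fun u => p.[z u]) t.
Proof.
move=> hz; elim/poly_ind: p => [|p c IH].
  by apply: ccont_ext (ccont_cst 0 t) => u; rewrite horner0.
by apply: ccont_ext (ccontD (ccontM IH hz) (ccont_cst c t)) => u; rewrite hornerMXaddC.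
Qed.

Lemma cder_ext z z' w w' t : z =1 w -> z' t = w' t -> cder z z' t -> cder w w' t.
Proof. by move=> /funext -> h [h1 h2]; split; rewrite -h. Qed.

Lemma cder_horner (p : {poly C}) z z' t : cder z z' t ->
  cder (fun u => p.[z u]) (fun u => p^`().[z u] * z' u) t.
Proof.
move=> hz; elim/poly_ind: p => [|p c IH].
  by apply: cder_ext (cder_cst 0 t) => [u|]; rewrite ?deriv0 ?horner0 ?mul0r.
apply: cder_ext (cderD (cderM IH hz) (cder_cst c t)) => [u|]; first by rewrite hornerMXaddC.
rewrite derivD derivM derivX derivC !addr0 mulr1 hornerD hornerMX; ring.
Qed.

Lemma cderZr c z z' t : cder z z' t -> cder (fun u => c * z u) (fun u => c * z' u) t.
Proof.
move=> hz; apply: cder_ext (cderM (cder_cst c t) hz) => //=.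
by rewrite mul0r add0r.
Qed.

Lemma cder_invX z z' n t : cder z z' t -> z t != 0 ->
  cder (fun u => (z u) ^- n) (fun u => - n%:R * (z' u * (z u) ^- n.+1)) t.
Proof.
move=> hz z0; elim: n => [|n IH].
  by apply: cder_ext (cder_cst 1 t) => [u|]; rewrite ?expr0 ?invr1 ?oppr0 ?mul0r.
apply: cder_ext (cderM (cderV hz z0) IH) => [u|].
  by rewrite exprS invfM.
rewrite !exprS !invfM -natr1; ring.
Qed.

Section Act.
Variables (X : completeNormedModType R) (I : X -> X).
Hypothesis ID : forall x y, I (x + y) = I x + I y.
Hypothesis IZ : forall (a : R) x, I (a *: x) = a *: I x.
Hypothesis II : forall x, I (I x) = - x.
Hypothesis Inorm : forall (a b : R) x, `|a *: x + b *: I x| = Num.sqrt (a ^+ 2 + b ^+ 2) * `|x|.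
Ltac lmod := lmod_with R X.

(** [I] is an isometric complex structure turning [X] into a complex Banach space; it is later right
    multiplication by [J]. *)
Definition cact (c : C) (x : X) := Re c *: x + Im c *: I x.
Local Notation act := cact.

Lemma IN x : I (- x) = - I x. Proof. by rewrite -scaleN1r IZ scaleN1r. Qed.

Lemma I0 : I 0 = 0. Proof. by rewrite -(scale0r 0) IZ !scale0r. Qed.

Lemma actD c x y : act c (x + y) = act c x + act c y.
Proof. by rewrite /act ID; lmod. Qed.

Lemma actDl c d x : act (c + d) x = act c x + act d x.
Proof. by case: c d => [a b] [e f]; rewrite /act /=; lmod. Qed.

Lemma actM c d x : act (c * d) x = act c (act d x).
Proof. by case: c d => [a b] [e f]; rewrite /act /= ID !IZ II; lmod. Qed.

Lemma act1 x : act 1 x = x.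
Proof. by rewrite /act /= scale1r scale0r addr0. Qed.

Lemma act0 c : act c 0 = 0.
Proof. by rewrite /act I0 !scaler0 addr0. Qed.

Lemma act0l x : act 0 x = 0.
Proof. by rewrite /act /= !scale0r addr0. Qed.

Lemma actN c x : act c (- x) = - act c x.
Proof. by rewrite /act IN; lmod. Qed.

Lemma actNl c x : act (- c) x = - act c x.
Proof. by case: c => a b; rewrite /act /=; lmod. Qed.

Lemma actB c x y : act c (x - y) = act c x - act c y.
Proof. by rewrite actD actN. Qed.

Lemma actBl c d x : act (c - d) x = act c x - act d x.
Proof. by rewrite actDl actNl. Qed.

Lemma actZ c (a : R) x : act c (a *: x) = a *: act c x.
Proof. by rewrite /act IZ; lmod. Qed.

Lemma act_norm c x : `|act c x| = normc c * `|x|.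
Proof. by rewrite /act Inorm; case: c. Qed.

Lemma actC c d x : act c (act d x) = act d (act c x).
Proof. by rewrite -!actM mulrC. Qed.

Lemma actK c x : c != 0 -> act c^-1 (act c x) = x.
Proof. by move=> c0; rewrite -actM mulVf // act1. Qed.

Lemma act_sum c (T : Type) (s : seq T) (P : pred T) (F : T -> X) :
  act c (\sum_(i <- s | P i) F i) = \sum_(i <- s | P i) act c (F i).
Proof. by apply: (big_morph (act c)) => [x y|]; [exact: actD | exact: act0]. Qed.

Lemma act_suml (T : Type) (s : seq T) (P : pred T) (F : T -> C) x :
  act (\sum_(i <- s | P i) F i) x = \sum_(i <- s | P i) act (F i) x.
Proof. by apply: (big_morph (act^~ x)) => [y z|]; [exact: actDl | exact: act0l]. Qed.

Lemma ucont_act z x (a b : R) : (forall t, a <= t <= b -> ccont z t) ->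
  ucont (fun t => act (z t) x) a b.
Proof.
move=> hz; have u (f : R -> R) (y : X) : (forall t, a <= t <= b -> {for t, continuous f}) ->
    ucont (fun t => f t *: y : X) a b.
  move=> hf e e0; have y1 : 0 < `|y| + 1 by rewrite ltr_wpDl.
  have [d d0 hd] := ucont_continuous hf (divr_gt0 e0 y1); exists d => // s t hs ht st.
  rewrite -scalerBl normrZ; have := hd s t hs ht st; rewrite ler_pdivlMr //.
  by apply: le_trans; rewrite ler_wpM2l // lerDl.
by apply: ucontD; apply: u => t ht; case: (hz t ht).
Qed.

Lemma prim_act z z' x (a b : R) : (forall t, a <= t <= b -> cder z z' t) ->
  (forall t, a <= t <= b -> ccont z' t) ->
  prim (fun t => act (z' t) x) (fun t => act (z t) x) a b.
Proof.
move=> dz cz.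
have hx (y : X) (f f' : R -> R) : prim f' f a b -> prim (fun t => f' t *: y) (fun t => f t *: y) a b.
  move=> hf; apply: (@prim_lin R R X (fun r => r *: y) `|y|) hf => [r s|r s|r].
  - exact: scalerDl.
  - by rewrite scalerA.
  - by rewrite normrZ mulrC.
apply: primD; apply: hx; apply: prim_derive => [t /dz[]|] //;
by apply: ucont_continuous => t /cz[].
Qed.

Lemma prim_actl (c : C) (g G : R -> X) (a b : R) : prim g G a b ->
  prim (fun t => act c (g t)) (fun t => act c (G t)) a b.
Proof.
apply: (@prim_lin R X X (act c) (normc c)) => [x y|r x|x].
- exact: actD.
- exact: actZ.
- by rewrite act_norm.
Qed.

End Act.
End ComplexDerivatives.

Lemma atanV (R : realType) (x : R) : 0 < x -> atan x + atan x^-1 = pi / 2.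
Proof.
move=> x0; have a0 : 0 < atan x by rewrite -(atan0 R) lt_atan.
have a1 := atan_ltpi2 x.
have -> : x^-1 = tan (pi / 2 - atan x).
  rewrite -[in LHS](atanK x) /tan sinB cosB sin_pihalf cos_pihalf.
  by rewrite !mul1r !mul0r subr0 add0r invf_div.
by rewrite tanK ?subrKC // in_itv /=; apply/andP; split; lra.
Qed.

(** At a corner of a rectangle the primitives of [1/(w - s)] used on the two edges differ by such a
    sum. With [x / 0 = 0] the identity also covers corners on an axis through [s]. *)
Lemma atan_corner (R : realType) (u v : R) :
  atan (u / v) + atan (v / u) = pi / 2 * (Num.sg u * Num.sg v).
Proof.
have key a b : 0 < a -> 0 < b -> atan (a / b) + atan (b / a) = pi / 2 :> R.
  by move=> a0 b0; rewrite -[b / a]invf_div atanV // divr_gt0.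
have [->|u0|u0] := sgrP u; first by rewrite !mul0r mulr0 invr0 mulr0 atan0 addr0.
- have [->|v0|v0] := sgrP v; first by rewrite mul0r invr0 !mulr0 atan0 addr0.
    by rewrite !mulr1 key.
  have := key u (- v) u0; rewrite oppr_gt0 => /(_ v0).
  by rewrite invrN mulrN mulNr !atanN; lra.
have [->|v0|v0] := sgrP v; first by rewrite mul0r invr0 !mulr0 atan0 addr0.
  have := key (- u) v; rewrite oppr_gt0 => /(_ u0 v0).
  by rewrite invrN mulrN mulNr !atanN; lra.
have := key (- u) (- v); rewrite !oppr_gt0 => /(_ u0 v0).
by rewrite !invrN !mulrNN; lra.
Qed.

(** * Integrals along segments *)

Section Edges.
Variables (R : realType) (X : completeNormedModType R) (I : X -> X).
Local Notation C := (R[i]).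
Local Notation Re := (@complex.Re R).
Local Notation Im := (@complex.Im R).
Hypothesis ID : forall x y, I (x + y) = I x + I y.
Hypothesis IZ : forall (a : R) x, I (a *: x) = a *: I x.
Hypothesis II : forall x, I (I x) = - x.
Hypothesis Inorm : forall (a b : R) x, `|a *: x + b *: I x| = Num.sqrt (a ^+ 2 + b ^+ 2) * `|x|.
Local Notation act := (cact I).
Ltac lmod := lmod_with R X.
Implicit Types (g h F : C -> X) (p q s : C).

Definition seg p q (t : R) : C := p + (t +i* 0)%C * (q - p).

Lemma seg0 p q : seg p q 0 = p.
Proof. by rewrite /seg mul0r addr0. Qed.

Lemma seg1 p q : seg p q 1 = q.
Proof. by rewrite /seg mul1r subrKC. Qed.

Lemma seg_Re p q t : Re (seg p q t) = Re p + t * (Re q - Re p).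
Proof. by case: p q => [a b] [c d]; rewrite /seg /=; ring. Qed.

Lemma seg_Im p q t : Im (seg p q t) = Im p + t * (Im q - Im p).
Proof. by case: p q => [a b] [c d]; rewrite /seg /=; ring. Qed.

Lemma cder_seg p q t : cder (seg p q) (fun=> q - p) t.
Proof.
have h : cder (fun u : R => (u +i* 0)%C) (fun=> 1) t.
  by split => /=; [apply: is_derive_id | apply: is_derive_cst].
apply: cder_ext (cderD (cder_cst p t) (cderM h (cder_cst (q - p) t))) => [u|] //=.
by rewrite add0r mul1r mulr0 addr0.
Qed.

Lemma ccont_seg p q t : ccont (seg p q) t.
Proof. exact: cder_cont (cder_seg p q t). Qed.

Definition edge_prim p q g (G : R -> X) := prim (fun t => act (q - p) (g (seg p q t))) G 0 1.

(* [0] if [g] has no antiderivative along the segment *)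
Definition eint p q g : X :=
  if pselect (exists G, edge_prim p q g G) is left h then
    let G := proj1_sig (cid h) in G 1 - G 0 else 0.

Lemma eintE p q g G : edge_prim p q g G -> eint p q g = G 1 - G 0.
Proof.
move=> hG; rewrite /eint; case: pselect => [h|]; last by case; exists G.
by apply: prim_unique hG; [exact: ler01 | exact: (proj2_sig (cid h))].
Qed.

Definition econt p q g := ucont (fun t => g (seg p q t)) 0 1.

Lemma ucont_actl (c : C) (f : R -> X) a b : ucont f a b -> ucont (fun t => act c (f t)) a b.
Proof.
move=> uf e e0; have c1 : 0 < normc c + 1.
  by rewrite ltr_wpDl //; case: (c) => ? ?; exact: sqrtr_ge0.
have [d d0 hd] := uf _ (divr_gt0 e0 c1); exists d => // u v hu hv uv.
rewrite -(actB ID IZ) (act_norm Inorm).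
have := hd u v hu hv uv; rewrite ler_pdivlMr // mulrC.
by apply: le_trans; rewrite ler_wpM2r // lerDl.
Qed.

Lemma edge_prim_exists p q g : econt p q g -> exists G, edge_prim p q g G.
Proof. by move=> hg; apply: prim_exists; [exact: ltr01 | exact: ucont_actl]. Qed.

Lemma eintD p q g h : econt p q g -> econt p q h ->
  eint p q (fun w => g w + h w) = eint p q g + eint p q h.
Proof.
move=> /edge_prim_exists[G hG] /edge_prim_exists[H hH].
rewrite (eintE hG) (eintE hH) (@eintE _ _ _ (fun t => G t + H t)); first by lmod.
by apply: prim_ext (primD hG hH) => t _ //; rewrite (actD ID).
Qed.

Lemma eint_act p q c g : econt p q g -> eint p q (fun w => act c (g w)) = act c (eint p q g).
Proof.
move=> /edge_prim_exists[G hG]; rewrite (eintE hG) (@eintE _ _ _ (fun t => act c (G t))).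
  by rewrite (actB ID IZ).
by apply: prim_ext (prim_actl ID IZ Inorm c hG) => t _ //; rewrite (actC ID IZ II).
Qed.

Lemma eintB p q g h : econt p q g -> econt p q h ->
  eint p q (fun w => g w - h w) = eint p q g - eint p q h.
Proof.
move=> /edge_prim_exists[G hG] /edge_prim_exists[H hH].
rewrite (eintE hG) (eintE hH) (@eintE _ _ _ (fun t => G t - H t)); first by lmod.
by apply: prim_ext (primB hG hH) => t _ //; rewrite (actB ID IZ).
Qed.

Lemma eint_bound p q g M : econt p q g -> (forall t, 0 <= t <= 1 -> `|g (seg p q t)| <= M) ->
  `|eint p q g| <= normc (q - p) * M.
Proof.
move=> /edge_prim_exists[G hG] hM; rewrite (eintE hG).
have -> : normc (q - p) * M = normc (q - p) * M * (1 - 0) by rewrite subr0 mulr1.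
apply: prim_bound hG _ => // t ht; rewrite (act_norm Inorm) ler_wpM2l ?hM //.
by case: (q - p) => ? ?; exact: sqrtr_ge0.
Qed.

Lemma eint_ext p q g h : (forall t, 0 <= t <= 1 -> g (seg p q t) = h (seg p q t)) ->
  eint p q g = eint p q h.
Proof.
move=> gh; rewrite /eint; case: pselect => [e1|n1]; case: pselect => [e2|n2] //.
- apply: (@prim_unique _ _ (fun t => act (q - p) (h (seg p q t)))); first exact: ler01.
    by apply: prim_ext (proj2_sig (cid e1)) => t ht //; rewrite gh.
  exact: (proj2_sig (cid e2)).
- by case: n2; case: e1 => G hG; exists G; apply: prim_ext hG => t ht //; rewrite gh.
- by case: n1; case: e2 => G hG; exists G; apply: prim_ext hG => t ht //; rewrite gh.
Qed.

Lemma econt_ext p q g h : (forall t, 0 <= t <= 1 -> g (seg p q t) = h (seg p q t)) ->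
  econt p q g -> econt p q h.
Proof.
move=> gh hg e e0; have [d d0 hd] := hg e e0; exists d => // u v hu hv uv.
by rewrite -!gh // hd.
Qed.

Lemma econtD p q g h : econt p q g -> econt p q h -> econt p q (fun w => g w + h w).
Proof. exact: ucontD. Qed.

Lemma econt_actl p q c g : econt p q g -> econt p q (fun w => act c (g w)).
Proof. exact: ucont_actl. Qed.

Lemma econtB p q g h : econt p q g -> econt p q h -> econt p q (fun w => g w - h w).
Proof.
move=> hg hh; apply: econt_ext (econtD hg (econt_actl (-1) hh)) => t _.
by rewrite actNl act1.
Qed.

Lemma eint_FTC p q (Z u : C -> C) x :
  (forall t, 0 <= t <= 1 -> cder (Z \o seg p q) (fun t => u (seg p q t) * (q - p)) t) ->
  (forall t, 0 <= t <= 1 -> ccont (u \o seg p q) t) ->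
  eint p q (fun w => act (u w) x) = act (Z q - Z p) x.
Proof.
move=> dZ cu; rewrite (@eintE _ _ _ (fun t => act (Z (seg p q t)) x)).
  by rewrite seg0 seg1 actBl.
have h : prim (fun t => act (u (seg p q t) * (q - p)) x) (fun t => act (Z (seg p q t)) x) 0 1.
  apply: (@prim_act _ _ I (Z \o seg p q) (fun t => u (seg p q t) * (q - p))) => t ht.
    exact: dZ.
  by apply: ccontM (ccont_cst _ _); exact: cu.
by apply: prim_ext h => t _ //; rewrite mulrC (actM ID IZ II).
Qed.

Lemma poly_primitive (p : {poly C}) : exists P : {poly C}, P^`() = p.
Proof.
exists (\poly_(i < (size p).+1) (if i is j.+1 then p`_j / j.+1%:R else 0)).
apply/polyP => i; rewrite coef_deriv coef_poly ltnS.
case: ltnP => [ip|pi]; last by rewrite mul0rn nth_default.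
by rewrite -[LHS]mulr_natr divfK // pnatr_eq0.
Qed.

Lemma eint_horner (P : {poly C}) p q x :
  eint p q (fun w => act P^`().[w] x) = act (P.[q] - P.[p]) x.
Proof.
apply: (eint_FTC (Z := fun w => P.[w])) => t _; first exact: cder_horner (cder_seg p q t).
exact: ccont_horner (ccont_seg p q t).
Qed.

Lemma eint_invX n p q x : (forall t, 0 <= t <= 1 -> seg p q t != 0) ->
  eint p q (fun w => act (w ^- n.+2) x) =
  act (- (n.+1)%:R^-1 * q ^- n.+1 - - (n.+1)%:R^-1 * p ^- n.+1) x.
Proof.
move=> h0; apply: (eint_FTC (Z := fun w => - (n.+1)%:R^-1 * w ^- n.+1)) => t ht.
  apply: cder_ext (cderZr (- (n.+1)%:R^-1) (cder_invX n.+1 (cder_seg p q t) (h0 t ht))) => //=.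
  by rewrite mulrA mulrNN mulVf ?pnatr_eq0 // mul1r mulrC.
apply: (ccontV (z := fun u => seg p q u ^+ n.+2)); last by rewrite expf_neq0 ?h0.
by apply: ccontX; exact: ccont_seg.
Qed.

End Edges.

(** * Cauchy's theorem on grids *)

Section Rectangles.
Variables (R : realType) (X : completeNormedModType R) (I : X -> X).
Local Notation C := (R[i]).
Local Notation Re := (@complex.Re R).
Local Notation Im := (@complex.Im R).
Hypothesis ID : forall x y, I (x + y) = I x + I y.
Hypothesis IZ : forall (a : R) x, I (a *: x) = a *: I x.
Hypothesis II : forall x, I (I x) = - x.
Hypothesis Inorm : forall (a b : R) x, `|a *: x + b *: I x| = Num.sqrt (a ^+ 2 + b ^+ 2) * `|x|.
Local Notation act := (cact I).
Local Notation eint := (eint I).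
Ltac lmod := lmod_with R X.
Implicit Types (g h F : C -> X) (p q s : C).

(** For [c = 0] the quotient is 0 by convention and both sides vanish; this is the case of an edge
    on a line through the pole. *)
Lemma is_derive_atan_div (f : R -> R) (f' c t : R) : f t ^+ 2 + c ^+ 2 != 0 ->
  is_derive t 1 f f' ->
  is_derive t 1 (fun u => atan (f u / c)) (f' * c / (f t ^+ 2 + c ^+ 2)).
Proof.
move=> n0 df; have [c0|c0] := eqVneq c 0.
  rewrite c0 mulr0 mul0r; apply: (is_derive_ext _ _ (is_derive_cst (0 : R) t 1)) => // u.
  by rewrite invr0 mulr0 atan0.
have df2 : is_derive t 1 (fun u => f u / c) (f' / c).
  apply: (is_derive_ext _ _ (is_deriveZ c^-1 df)) => [u|]; rewrite ?fctE /GRing.scale /= mulrC //.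
have d3 := @is_derive1_comp _ atan (fun u => f u / c) t _ _ (is_derive1_atan (f t / c)) df2.
apply: (is_derive_ext _ _ d3) => //.
have n1 : 1 + (f t / c) ^+ 2 != 0.
  by rewrite gt_eqF // ltr_pwDl // sqr_ge0.
move: n0 n1; rewrite !expr2 => n0 n1; field; rewrite c0 /=.
by apply/andP; split; rewrite // addrC.
Qed.

Definition lnsq s w : R := 2^-1 * ln ((Re w - Re s) ^+ 2 + (Im w - Im s) ^+ 2).
(** [hlog] on horizontal and [vlog] on vertical segments avoiding [s] are logarithms of [w - s] up
    to constants: there the argument changes as minus the arctangent of one ratio, respectively as
    that of the inverse ratio. *)
Definition hlog s w : C := (lnsq s w +i* - atan ((Re w - Re s) / (Im w - Im s)))%C.
Definition vlog s w : C := (lnsq s w +i* atan ((Im w - Im s) / (Re w - Re s)))%C.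

Lemma lnsq_derive s (z z' : R -> C) t : cder z z' t -> z t != s ->
  is_derive t 1 (fun u => lnsq s (z u)) (Re ((z t - s)^-1 * z' t)).
Proof.
move=> dz h0; have n0 : 0 < (Re (z t) - Re s) ^+ 2 + (Im (z t) - Im s) ^+ 2.
  rewrite lt_neqAle addr_ge0 ?sqr_ge0 // andbT eq_sym.
  have := @sqr_sum_neq0 R (z t - s); rewrite subr_eq0 => /(_ h0).
  by case: (z t) (s) => ? ? [].
have [d1 d2] : cder (fun u => z u - s) z' t.
  apply: cder_ext (cderD dz (cder_cst (- s) t)) => //=; by rewrite addr0.
have d := is_deriveD (is_deriveM d1 d1) (is_deriveM d2 d2).
set n := (X in is_derive _ _ X _) in d.
have nE u : n u = (Re (z u) - Re s) ^+ 2 + (Im (z u) - Im s) ^+ 2.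
  by rewrite /n !fctE; case: (z u) (s) => ? ? [? ?] /=; rewrite !expr2.
have nt : 0 < n t by rewrite nE.
have dl := is_deriveZ 2^-1 (is_derive1_comp (is_derive1_ln nt) d).
apply: (is_derive_ext _ _ dl) => [u|]; first by rewrite !fctE /= nE.
rewrite /GRing.scale /= nE; move: n0 {dl nt nE d d1 d2 n}.
case: (z t) (s) (z' t) => a b [c e] [f g] /= /lt0r_neq0 n0.
by field; move: n0; rewrite !expr2.
Qed.

Lemma ccont_inv s p q t : seg p q t != s -> ccont ((fun w => (w - s)^-1) \o seg p q) t.
Proof.
move=> h; apply: (ccontV (z := fun u => seg p q u - s)); last by rewrite subr_eq0.
exact: ccontD (ccont_seg p q t) (ccont_cst (- s) t).
Qed.

Lemma eint_inv_h s p q x : Im p = Im q -> (forall t, 0 <= t <= 1 -> seg p q t != s) ->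
  eint p q (fun w => act (w - s)^-1 x) = act (hlog s q - hlog s p) x.
Proof.
move=> pq h0; apply: (eint_FTC ID IZ II (Z := hlog s) (u := fun w => (w - s)^-1)) => t ht.
  split; first exact: lnsq_derive (cder_seg p q t) (h0 t ht).
  have e u : Im (seg p q u) - Im s = Im p - Im s by rewrite seg_Im pq subrr mulr0 addr0.
  have n0 : (Re (seg p q t) - Re s) ^+ 2 + (Im p - Im s) ^+ 2 != 0.
    rewrite -(e t); have := @sqr_sum_neq0 R (seg p q t - s); rewrite subr_eq0 => /(_ (h0 t ht)).
    by case: (seg p q t) (s) => ? ? [].
  have df : is_derive t 1 (fun u => Re (seg p q u) - Re s) (Re q - Re p).
    have [d _] := cderD (cder_seg p q t) (cder_cst (- s) t).
    apply: is_derive_ext d => [u|]; first by case: (seg p q u) (s) => ? ? [].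
    by rewrite addr0; case: (q) (p) => ? ? [].
  have d3 := is_deriveN (is_derive_atan_div (f := fun u => Re (seg p q u) - Re s) (t := t) n0 df).
  apply: (is_derive_ext _ _ d3) => [u|].
    by rewrite /= fctE e.
  have qp : Im (q - p) = 0 by case: (q) (p) pq => ? ? [? ?] /= ->; rewrite subrr.
  move: n0; rewrite -(e t) => n0.
  have -> : Re q - Re p = Re (q - p) by case: (q) (p) => ? ? [].
  move: n0; case: (seg p q t) (s) (q - p) qp => a b [c d] [f g] /= -> n0.
  by field; move: n0; rewrite !expr2.
exact: ccont_inv (h0 t ht).
Qed.

Lemma eint_inv_v s p q x : Re p = Re q -> (forall t, 0 <= t <= 1 -> seg p q t != s) ->
  eint p q (fun w => act (w - s)^-1 x) = act (vlog s q - vlog s p) x.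
Proof.
move=> pq h0; apply: (eint_FTC ID IZ II (Z := vlog s) (u := fun w => (w - s)^-1)) => t ht.
  split; first exact: lnsq_derive (cder_seg p q t) (h0 t ht).
  have e u : Re (seg p q u) - Re s = Re p - Re s by rewrite seg_Re pq subrr mulr0 addr0.
  have n0 : (Im (seg p q t) - Im s) ^+ 2 + (Re p - Re s) ^+ 2 != 0.
    rewrite addrC -(e t); have := @sqr_sum_neq0 R (seg p q t - s); rewrite subr_eq0 => /(_ (h0 t ht)).
    by case: (seg p q t) (s) => ? ? [].
  have df : is_derive t 1 (fun u => Im (seg p q u) - Im s) (Im q - Im p).
    have [_ d] := cderD (cder_seg p q t) (cder_cst (- s) t).
    apply: is_derive_ext d => [u|]; first by case: (seg p q u) (s) => ? ? [].
    by rewrite addr0; case: (q) (p) => ? ? [].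
  have d3 := is_derive_atan_div (f := fun u => Im (seg p q u) - Im s) (t := t) n0 df.
  apply: (is_derive_ext _ _ d3) => [u|].
    by rewrite /= e.
  have qp : Re (q - p) = 0 by case: (q) (p) pq => ? ? [? ?] /= ->; rewrite subrr.
  move: n0; rewrite -(e t) => n0.
  have -> : Im q - Im p = Im (q - p) by case: (q) (p) => ? ? [].
  move: n0; case: (seg p q t) (s) (q - p) qp => a b [c d] [f g] /= -> n0.
  by field; move: n0; rewrite !expr2 addrC.
exact: ccont_inv (h0 t ht).
Qed.

Definition veval (P : seq ({poly C} * X)) (w : C) : X := \sum_(e <- P) act e.1.[w] e.2.

(** Stands in for holomorphy near [S]. A power series provides it, it passes to uniform limits, and
    it reduces integral theorems to polynomials. *)
Definition polyapprox (S : set C) (F : C -> X) :=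
  forall e : R, 0 < e -> exists P, forall w, S w -> `|F w - veval P w| <= e.

Lemma polyapprox_sub (S S' : set C) F : S' `<=` S -> polyapprox S F -> polyapprox S' F.
Proof. by move=> ss h e /h[P hP]; exists P => w /ss; exact: hP. Qed.

Lemma normc_ge0 (c : C) : 0 <= normc c.
Proof. by case: c => ? ?; exact: sqrtr_ge0. Qed.

Lemma normc_le_sum (c : C) : normc c <= `|Re c| + `|Im c|.
Proof.
case: c => a b /=; rewrite -(ger0_norm (addr_ge0 (normr_ge0 a) (normr_ge0 b))) -sqrtr_sqr.
rewrite ler_wsqrtr // sqrrD !real_normK ?num_real // addrAC lerDl mulrn_wge0 //.
Qed.

Lemma Re_le_normc (c : C) : `|Re c| <= normc c.
Proof.
by case: c => a b /=; rewrite -sqrtr_sqr ler_wsqrtr // lerDl sqr_ge0.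
Qed.

Lemma Im_le_normc (c : C) : `|Im c| <= normc c.
Proof.
by case: c => a b /=; rewrite -sqrtr_sqr ler_wsqrtr // lerDr sqr_ge0.
Qed.

Lemma ccont_bounded (z : R -> C) (a b : R) : (forall t, a <= t <= b -> ccont z t) ->
  exists2 M : R, 0 < M & forall t, a <= t <= b -> normc (z t) <= M.
Proof.
move=> hz.
have [M1 M10 h1] := ucont_bound (ucont_continuous (fun t ht => proj1 (hz t ht))).
have [M2 M20 h2] := ucont_bound (ucont_continuous (fun t ht => proj2 (hz t ht))).
exists (M1 + M2 + 1) => [|t ht]; first by rewrite ltr_wpDl // addr_ge0.
apply: le_trans (normc_le_sum _) _; have := h1 t ht; have := h2 t ht; lra.
Qed.

Lemma ucont_mul (z : R -> C) (f : R -> X) (a b : R) : (forall t, a <= t <= b -> ccont z t) ->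
  (forall e : R, 0 < e -> exists P (y : R -> C), (forall t, a <= t <= b -> ccont y t) /\
     forall t, a <= t <= b -> `|f t - veval P (y t)| <= e) ->
  ucont (fun t => act (z t) (f t)) a b.
Proof.
move=> hz hf; have [M M0 hM] := ccont_bounded hz.
apply: ucont_limit => e e0; have [P [y [cy hP]]] := hf _ (divr_gt0 e0 M0).
exists (fun t => act (z t) (veval P (y t))); last first.
  move=> t ht; rewrite -(actB ID IZ) (act_norm Inorm) -(divfK (lt0r_neq0 M0) e) mulrC.
  by apply: ler_pM; rewrite ?normc_ge0 ?normr_ge0 ?hP ?hM.
rewrite /veval; elim: P {hP} => [|[p x] P IH].
  apply: (@ucont_limit _ _ _ a b) => n n0; exists (fun=> 0); last first.
    by move=> t _; rewrite big_nil (act0 IZ) subrr normr0 ltW.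
  by move=> n' n0'; exists 1 => // u v _ _ _; rewrite subrr normr0 ltW.
under eq_fun do rewrite big_cons (actD ID) -(actM ID IZ II) /=.
apply: ucontD IH; apply: (ucont_act I (z := fun t => z t * p.[y t])) => t ht.
by apply: ccontM (hz t ht) _; apply: ccont_horner; exact: cy.
Qed.

Lemma econt_mul (S : set C) (u : C -> C) F p q : (forall t, 0 <= t <= 1 -> S (seg p q t)) ->
  (forall t, 0 <= t <= 1 -> ccont (u \o seg p q) t) -> polyapprox S F ->
  econt p q (fun w => act (u w) (F w)).
Proof.
move=> hS hu hF; apply: (ucont_mul (z := u \o seg p q) (f := F \o seg p q)) => // e e0.
have [P hP] := hF e e0; exists P, (seg p q); split=> [t _|t ht]; first exact: ccont_seg.
by apply: hP; exact: hS.
Qed.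

Lemma polyapprox_veval S P : polyapprox S (veval P).
Proof. by move=> e e0; exists P => w _; rewrite subrr normr0 ltW. Qed.

Lemma econt_approx (S : set C) F p q : (forall t, 0 <= t <= 1 -> S (seg p q t)) ->
  polyapprox S F -> econt p q F.
Proof.
move=> hS hF; have := econt_mul (u := fun=> 1) hS (fun t _ => ccont_cst 1 t) hF.
by apply: econt_ext => t _; rewrite act1.
Qed.

Lemma polyapproxB S F P : polyapprox S F -> polyapprox S (fun w => F w - veval P w).
Proof.
move=> hF e e0; have [Q hQ] := hF e e0.
exists (Q ++ [seq (- e.1, e.2) | e <- P]) => w Sw; rewrite {2}/veval big_cat big_map /=.
rewrite -/(veval Q w); have -> : \sum_(j <- P) act (- j.1).[w] j.2 = - veval P w.
  by rewrite /veval -sumrN; apply: eq_bigr => i _; rewrite hornerN actNl.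
by have := hQ w Sw; rewrite opprD opprK addrACA addNr addr0.
Qed.

Definition box (x1 x2 y1 y2 : R) : set C := [set w | x1 <= Re w <= x2 /\ y1 <= Im w <= y2].

Lemma seg_between (a b t x y : R) : x <= a <= y -> x <= b <= y -> 0 <= t <= 1 ->
  x <= a + t * (b - a) <= y.
Proof. by move=> /andP[? ?] /andP[? ?] /andP[? ?]; apply/andP; split; nra. Qed.

Lemma seg_box x1 x2 y1 y2 p q t : box x1 x2 y1 y2 p -> box x1 x2 y1 y2 q -> 0 <= t <= 1 ->
  box x1 x2 y1 y2 (seg p q t).
Proof.
by move=> [p1 p2] [q1 q2] ht; split; rewrite ?seg_Re ?seg_Im; apply: seg_between.
Qed.

Definition rect (x1 x2 y1 y2 : R) (g : C -> X) : X :=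
  eint (x1 +i* y1)%C (x2 +i* y1)%C g + eint (x2 +i* y1)%C (x2 +i* y2)%C g
  - eint (x1 +i* y2)%C (x2 +i* y2)%C g - eint (x1 +i* y1)%C (x1 +i* y2)%C g.

Definition on_edges (x1 x2 y1 y2 : R) (P : C -> C -> Prop) : Prop :=
  [/\ P (x1 +i* y1)%C (x2 +i* y1)%C, P (x2 +i* y1)%C (x2 +i* y2)%C,
      P (x1 +i* y2)%C (x2 +i* y2)%C & P (x1 +i* y1)%C (x1 +i* y2)%C].

Lemma on_edges_box x1 x2 y1 y2 (P : C -> C -> Prop) : x1 <= x2 -> y1 <= y2 ->
  (forall p q, box x1 x2 y1 y2 p -> box x1 x2 y1 y2 q -> P p q) -> on_edges x1 x2 y1 y2 P.
Proof. by move=> hx hy h; split; apply: h; rewrite /box /= ?lexx ?hx ?hy. Qed.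

Section OneRectangle.
Variables x1 x2 y1 y2 : R.
Hypotheses (hx : x1 <= x2) (hy : y1 <= y2).
Local Notation B := (box x1 x2 y1 y2).
Local Notation rect := (rect x1 x2 y1 y2).
Local Notation on_edges := (on_edges x1 x2 y1 y2).

Lemma rectD g h : on_edges (fun p q => econt p q g) -> on_edges (fun p q => econt p q h) ->
  rect (fun w => g w + h w) = rect g + rect h.
Proof.
move=> [g1 g2 g3 g4] [h1 h2 h3 h4]; rewrite /rect !(eintD ID IZ Inorm) //.
by lmod.
Qed.

Lemma rectB g h : on_edges (fun p q => econt p q g) -> on_edges (fun p q => econt p q h) ->
  rect (fun w => g w - h w) = rect g - rect h.
Proof.
move=> [g1 g2 g3 g4] [h1 h2 h3 h4]; rewrite /rect !(eintB ID IZ Inorm) //.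
by lmod.
Qed.

Lemma rect_ext g h : on_edges (fun p q => forall t, 0 <= t <= 1 -> g (seg p q t) = h (seg p q t)) ->
  rect g = rect h.
Proof. by move=> [h1 h2 h3 h4]; rewrite /rect (eint_ext I h1) (eint_ext I h2) (eint_ext I h3) (eint_ext I h4). Qed.

Lemma rect_bound g M : on_edges (fun p q => econt p q g) ->
  on_edges (fun p q => forall t, 0 <= t <= 1 -> `|g (seg p q t)| <= M) ->
  `|rect g| <= 2 * ((x2 - x1) + (y2 - y1)) * M.
Proof.
move=> [g1 g2 g3 g4] [h1 h2 h3 h4].
have len (a b : R) : 0 <= a -> (normc (a +i* 0)%C = a) * (normc (0 +i* a)%C = a).
  by move=> a0; rewrite /normc /= expr0n /= addr0 add0r sqrtr_sqr ger0_norm.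
have := eint_bound ID IZ Inorm g1 h1; have := eint_bound ID IZ Inorm g2 h2.
have := eint_bound ID IZ Inorm g3 h3; have := eint_bound ID IZ Inorm g4 h4.
have sb (a b c d : R) : ((c +i* d)%C - (a +i* b)%C) = ((c - a) +i* (d - b))%C by [].
rewrite !sb !subrr !len ?subr_ge0 // => k4 k3 k2 k1.
rewrite /rect; apply: le_trans (ler_normB _ _) _.
have e : 2 * ((x2 - x1) + (y2 - y1)) * M =
   (x2 - x1) * M + (y2 - y1) * M + (x2 - x1) * M + (y2 - y1) * M by ring.
rewrite e; apply: lerD k4; apply: le_trans (ler_normB _ _) _; apply: lerD k3.
by apply: le_trans (ler_normD _ _) _; apply: lerD.
Qed.

Lemma econt_horner (p : {poly C}) x a b : econt a b (fun w => act p.[w] x).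
Proof.
by apply: (ucont_act I) => t _; apply: ccont_horner; exact: ccont_seg.
Qed.

Lemma rect_poly (p : {poly C}) x : rect (fun w => act p.[w] x) = 0.
Proof.
have [P <-] := poly_primitive p.
by rewrite /rect !(eint_horner ID IZ II) !actBl; lmod.
Qed.

Lemma rect_veval P : rect (veval P) = 0.
Proof.
elim: P => [|[p x] P IH].
  rewrite (@rect_ext _ (fun w => act (0 : {poly C}).[w] 0)) ?rect_poly //.
  by split=> t _; rewrite /veval big_nil horner0 act0l.
rewrite (@rect_ext _ (fun w => act p.[w] x + veval P w)); last first.
  by split=> t _; rewrite /veval big_cons.
by rewrite rectD ?rect_poly ?IH ?addr0 //; split;
  (apply: econt_horner || apply: (econt_approx (S := setT)) => //; apply: polyapprox_veval).
Qed.

(** Both sides are continuous in [F] for the uniform norm on the box, so an identity for vector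
    polynomials extends. When [c = 0] the value at [s] drops out and [s] may lie outside. *)
Lemma rect_limit (u : C -> C) F c s :
  on_edges (fun p q => forall t, 0 <= t <= 1 -> ccont (u \o seg p q) t) ->
  polyapprox B F -> c = 0 \/ B s ->
  (forall P, rect (fun w => act (u w) (veval P w)) = act c (veval P s)) ->
  rect (fun w => act (u w) (F w)) = act c (F s).
Proof.
move=> hu hF hs hP.
have bs p q : B p -> B q -> forall t, 0 <= t <= 1 -> B (seg p q t).
  by move=> Bp Bq t; exact: seg_box.
have eB := on_edges_box hx hy bs.
have ec G : polyapprox B G -> on_edges (fun p q => econt p q (fun w => act (u w) (G w))).
  by move=> hG; case: hu eB => u1 u2 u3 u4 [b1 b2 b3 b4]; split; apply: econt_mul hG.
have [M M0 hM] : exists2 M : R, 0 < M &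
    on_edges (fun p q => forall t, 0 <= t <= 1 -> normc (u (seg p q t)) <= M).
  case: hu => /ccont_bounded[M1 m1 h1] /ccont_bounded[M2 m2 h2] /ccont_bounded[M3 m3 h3]
    /ccont_bounded[M4 m4 h4].
  exists (M1 + M2 + M3 + M4); first lra.
  split=> t ht; [have := h1 t ht|have := h2 t ht|have := h3 t ht|have := h4 t ht];
  rewrite /=; lra.
apply/eqP; rewrite -subr_eq0 -normr_le0; apply/ler_addgt0Pr => e e0; rewrite add0r.
(* Perimeter times the bound [M] of the weight for the integral, [normc c] for the value at [s], and
   1 for positivity. *)
set W := 2 * ((x2 - x1) + (y2 - y1)) * M + normc c + 1.
have W0 : 0 < W.
  have := normc_ge0 c; have : 0 <= 2 * ((x2 - x1) + (y2 - y1)) * M.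
    by rewrite mulr_ge0 ?(ltW M0) // mulr_ge0 // addr_ge0 // subr_ge0.
  rewrite /W; lra.
have [P hPe] := hF _ (divr_gt0 e0 W0); set e' := e / W in hPe.
have e'0 : 0 < e' by rewrite divr_gt0.
have -> : rect (fun w => act (u w) (F w)) - act c (F s) =
    rect (fun w => act (u w) (F w - veval P w)) - act c (F s - veval P s).
  rewrite [in RHS](@rect_ext _ (fun w => act (u w) (F w) - act (u w) (veval P w))); last first.
    by split=> t _; rewrite /= (actB ID IZ).
  rewrite rectB ?hP ?(actB ID IZ); [by lmod | exact: ec | by apply: ec; exact: polyapprox_veval].
have k1 : `|rect (fun w => act (u w) (F w - veval P w))| <=
    2 * ((x2 - x1) + (y2 - y1)) * (M * e').
  apply: rect_bound; first by apply: ec; exact: polyapproxB.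
  have k p q : (forall t, 0 <= t <= 1 -> normc (u (seg p q t)) <= M) ->
      (forall t, 0 <= t <= 1 -> B (seg p q t)) ->
      forall t, 0 <= t <= 1 -> `|act (u (seg p q t)) (F (seg p q t) - veval P (seg p q t))| <= M * e'.
    move=> hm hb t ht; rewrite (act_norm Inorm).
    apply: ler_pM; [exact: normc_ge0|exact: normr_ge0|exact: hm|exact: hPe (hb t ht)].
  by case: hM eB => m1 m2 m3 m4 [b1 b2 b3 b4]; split; apply: k.
have k2 : `|act c (F s - veval P s)| <= normc c * e'.
  case: hs => [->|Bs]; last by rewrite (act_norm Inorm) ler_wpM2l ?normc_ge0 ?hPe.
  by rewrite act0l normr0 mulr_ge0 ?normc_ge0 ?ltW.
apply: le_trans (ler_normB _ _) _.
have -> : e = W * e' by rewrite /e' mulrC divfK ?gt_eqF.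
rewrite /W !mulrDl mul1r -(mulrA _ M); lra.
Qed.

Lemma rect_cauchy (p : {poly C}) F : polyapprox B F -> rect (fun w => act p.[w] (F w)) = 0.
Proof.
move=> hF; rewrite (rect_limit (c := 0) (s := 0) _ hF) ?act0l //; last 2 first.
- by left.
- move=> P; rewrite act0l -(rect_veval [seq (p * e.1, e.2) | e <- P]).
  apply: rect_ext; split=> t _; rewrite /veval big_map (act_sum ID IZ);
  by apply: eq_bigr => e _ /=; rewrite hornerM (actM ID IZ II).
by split=> t _; apply: ccont_horner; exact: ccont_seg.
Qed.

Definition off_edges s := on_edges (fun p q => forall t, 0 <= t <= 1 -> seg p q t != s).

(** Four times the winding number of the boundary about a point off the edges: a factor is 2 when
    the corresponding coordinate of [s] lies strictly between the sides. *)
Definition rect_index s : R :=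
  (Num.sg (x2 - Re s) - Num.sg (x1 - Re s)) * (Num.sg (y2 - Im s) - Num.sg (y1 - Im s)).

(** The logarithmic real parts cancel around the rectangle. At each corner [hlog] and [vlog] leave
    the arctangents of a ratio and of its inverse, which [atan_corner] converts into signs. *)
Lemma rect_inv s x : off_edges s ->
  rect (fun w => act (w - s)^-1 x) = act (0 +i* (pi / 2 * rect_index s))%C x.
Proof.
move=> [h1 h2 h3 h4]; rewrite /rect (eint_inv_h _ _ h1) // (eint_inv_h _ _ h3) //.
rewrite (eint_inv_v _ _ h2) // (eint_inv_v _ _ h4) // -!(actDl, actBl); congr act.
rewrite /hlog /vlog /rect_index; apply/eqP; rewrite eq_complex /=; apply/andP; split; apply/eqP.
  by rewrite /lnsq /=; ring.
have := atan_corner (x1 - Re s) (y1 - Im s); have := atan_corner (x1 - Re s) (y2 - Im s).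
have := atan_corner (x2 - Re s) (y1 - Im s); have := atan_corner (x2 - Re s) (y2 - Im s).
by lra.
Qed.

(** Division of every coefficient polynomial by [w - s]: the Cauchy kernel times a vector polynomial
    is a vector polynomial plus a pure pole. *)
Lemma quotient_veval s P : exists Q, forall w, w != s ->
  act (w - s)^-1 (veval P w) = veval Q w + act (w - s)^-1 (veval P s).
Proof.
elim: P => [|[p x] P [Q hQ]].
  by exists [::] => w _; rewrite /veval !big_nil (act0 IZ) addr0.
have : root (p - p.[s]%:P) s by rewrite rootE hornerD hornerN hornerC subrr.
case/factor_theorem => q hq; exists ((q, x) :: Q) => w ws.
have e : p.[w] = q.[w] * (w - s) + p.[s].
  have := congr1 (fun r => r.[w]) hq.
  by rewrite !hornerE => <-; rewrite subrK.
rewrite /veval !big_cons /= (actD ID _ (act p.[w] x)) (actD ID _ (act p.[s] x)) -/(veval P w) hQ //.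
rewrite -!(actM ID IZ II) e.
rewrite mulrDr mulrCA mulVf ?subr_eq0 // mulr1 actDl -/(veval P s) -/(veval Q w).
by rewrite addrACA.
Qed.

Lemma rect_formula F s : polyapprox B F -> off_edges s -> B s \/ rect_index s = 0 ->
  rect (fun w => act (w - s)^-1 (F w)) = act (0 +i* (pi / 2 * rect_index s))%C (F s).
Proof.
move=> hF off hs; have eo : on_edges (fun p q => forall t, 0 <= t <= 1 ->
    ccont ((fun w => (w - s)^-1) \o seg p q) t).
  by case: off => h1 h2 h3 h4; split=> t ht; apply: ccont_inv; [exact: h1|exact: h2|exact: h3|exact: h4].
apply: rect_limit => //; first by case: hs => [?|->]; [right|left; rewrite mulr0].
move=> P; have [Q hQ] := quotient_veval s P.
rewrite (@rect_ext _ (fun w => veval Q w + act (w - s)^-1 (veval P s))); last first.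
  by case: off => h1 h2 h3 h4; split=> t ht; apply: hQ; [exact: h1|exact: h2|exact: h3|exact: h4].
rewrite rectD ?rect_veval ?add0r ?rect_inv //.
  by split; apply: (econt_approx (S := setT)) => //; exact: polyapprox_veval.
by case: eo => h1 h2 h3 h4; split; apply: (ucont_act I).
Qed.

End OneRectangle.

End Rectangles.

Section Grid.
Variables (R : realType) (X : completeNormedModType R) (I : X -> X).
Local Notation C := (R[i]).
Hypothesis ID : forall x y, I (x + y) = I x + I y.
Hypothesis IZ : forall (a : R) x, I (a *: x) = a *: I x.
Hypothesis II : forall x, I (I x) = - x.
Hypothesis Inorm : forall (a b : R) x, `|a *: x + b *: I x| = Num.sqrt (a ^+ 2 + b ^+ 2) * `|x|.
Local Notation eint := (eint I).
Local Notation rect := (rect I).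
Ltac lmod := lmod_with R X.
Implicit Types (g h F : C -> X) (p q s : C).

Definition chain := seq (R * (C * C)).

Definition chain_sum (ch : chain) g : X := \sum_(e <- ch) e.1 *: eint e.2.1 e.2.2 g.
Local Notation csum := chain_sum.

Lemma csum_cat c1 c2 g : csum (c1 ++ c2) g = csum c1 g + csum c2 g.
Proof. by rewrite /csum big_cat. Qed.

Lemma csum_cons e c g : csum (e :: c) g = e.1 *: eint e.2.1 e.2.2 g + csum c g.
Proof. by rewrite /csum big_cons. Qed.

Lemma csum_filter c g : csum [seq e <- c | e.1 != 0] g = csum c g.
Proof.
rewrite /csum big_filter big_mkcond; apply: eq_bigr => e _.
by case: eqP => //= ->; rewrite scale0r.
Qed.

(** Summation by parts, turning a sum over cells into one over the edges between them, weighted by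
    the jumps of [c], with both ends split off. *)
Lemma abel_summation (n : nat) (c : nat -> R) (a : nat -> X) :
  \sum_(0 <= j < n.+1) c j *: (a j - a j.+1) =
  c 0%N *: a 0%N - c n *: a n.+1 + \sum_(0 <= j < n) (c j.+1 - c j) *: a j.+1.
Proof.
elim: n => [|n IH]; first by rewrite big_nat1 big_geq // addr0 scalerBr.
rewrite big_nat_recr //= IH [in RHS]big_nat_recr //=.
set S := \sum_(0 <= i < n) _; lmod.
Qed.

Section Mesh.
Variables (L : R) (n : nat).
Hypothesis L0 : 0 < L.
Let h : R := 2 * L / n.+1%:R.
Definition gx (i : nat) : R := - L + i%:R * h.
Definition grid_node (i j : nat) : C := (gx i +i* gx j)%C.
Local Notation node := grid_node.
Definition hE i j g := eint (node i j) (node i.+1 j) g.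
Definition vE i j g := eint (node i j) (node i j.+1) g.
Definition grid_cell (i j : nat) : set C := box (gx i) (gx i.+1) (gx j) (gx j.+1).

Let h0 : 0 < h. Proof. by rewrite divr_gt0 ?mulr_gt0 // ltr0n. Qed.

Lemma gx0 : gx 0 = - L. Proof. by rewrite /gx mul0r addr0. Qed.

Lemma gxN : gx n.+1 = L.
Proof. by rewrite /gx /h mulrCA divff ?pnatr_eq0 // mulr1; ring. Qed.

Lemma gxS i : gx i.+1 = gx i + h.
Proof. by rewrite /gx -natr1; ring. Qed.

Lemma gx_le i j : (i <= j)%N -> gx i <= gx j.
Proof. by move=> ij; rewrite /gx lerD2l ler_wpM2r ?(ltW h0) // ler_nat. Qed.

Lemma gx_lt i j : (i < j)%N -> gx i < gx j.
Proof. by move=> ij; rewrite /gx ltrD2l ltr_pM2r // ltr_nat. Qed.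

Lemma gxSle i : gx i <= gx i.+1. Proof. exact: gx_le. Qed.

Lemma gx_locate (x : R) : - L <= x <= L -> exists2 i, (i < n.+1)%N & gx i <= x <= gx i.+1.
Proof.
rewrite -gx0 -gxN => /andP[x0 xn].
have key k : x <= gx k -> (0 < k)%N -> exists2 i, (i < k)%N & gx i <= x <= gx i.+1.
  elim: k => [|k IH] // hk _; have [kx|/ltW xk] := leP (gx k) x; first by exists k => //; rewrite kx.
  case: k IH xk hk => [|k] IH xk hk; last first.
    by have [i ik hi] := IH xk isT; exists i => //; exact: leqW.
  by exists 0%N => //; rewrite x0.
exact: key.
Qed.

Variable chi : nat -> nat -> bool.
Let c (i j : nat) : R := (chi i j)%:R.

(** An edge carries the difference of the indicators of the two cells it separates. Removing weight
    0 matters: between two unselected cells nothing is known about the integrand, whereas a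
    remaining edge always borders a selected and an unselected cell. *)
Definition inner_chain : chain :=
  [seq e <- [seq (c i j.+1 - c i j, (node i j.+1, node i.+1 j.+1)) | i <- iota 0 n.+1, j <- iota 0 n] ++
    [seq (c i j - c i.+1 j, (node i.+1 j, node i.+1 j.+1)) | j <- iota 0 n.+1, i <- iota 0 n]
  | e.1 != 0].

Definition outer_chain : chain :=
  [seq (1, (node i 0, node i.+1 0)) | i <- iota 0 n.+1] ++
  [seq (-1, (node i n.+1, node i.+1 n.+1)) | i <- iota 0 n.+1] ++
  [seq (1, (node n.+1 j, node n.+1 j.+1)) | j <- iota 0 n.+1] ++
  [seq (-1, (node 0 j, node 0 j.+1)) | j <- iota 0 n.+1].

Definition cell_int i j g := rect (gx i) (gx i.+1) (gx j) (gx j.+1) g.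

Lemma cell_intE i j g : cell_int i j g = hE i j g + vE i.+1 j g - hE i j.+1 g - vE i j g.
Proof. by []. Qed.

Lemma csum_outer g : csum outer_chain g =
  \sum_(0 <= i < n.+1) (hE i 0 g - hE i n.+1 g) + \sum_(0 <= j < n.+1) (vE n.+1 j g - vE 0 j g).
Proof.
rewrite /outer_chain !csum_cat /csum !big_map -!/(index_iota 0 n.+1) /index_iota subn0.
by rewrite !sumrB -!scaler_sumr !scale1r !scaleN1r addrA.
Qed.

Hypothesis chi_bdry : forall i, (i <= n)%N -> [/\ chi i 0, chi i n, chi 0 i & chi n i].

(** Edges common to two selected cells cancel, and since every border cell is selected, the border
    contributes the whole outer square. *)
Lemma grid_sum g : \sum_(0 <= i < n.+1) \sum_(0 <= j < n.+1) c i j *: cell_int i j g =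
  csum inner_chain g + csum outer_chain g.
Proof.
rewrite csum_outer csum_filter csum_cat /csum !big_allpairs_dep.
have io k : iota 0 k = index_iota 0 k by rewrite /index_iota subn0.
rewrite (io n.+1) (io n).
have -> : \sum_(0 <= i < n.+1) \sum_(0 <= j < n.+1) c i j *: cell_int i j g =
  \sum_(0 <= i < n.+1) \sum_(0 <= j < n.+1) c i j *: (hE i j g - hE i j.+1 g) +
  \sum_(0 <= j < n.+1) \sum_(0 <= i < n.+1) c i j *: (vE i.+1 j g - vE i j g).
  rewrite [X in _ = _ + X]exchange_big -big_split; apply: eq_bigr => i _ /=.
  rewrite -big_split; apply: eq_bigr => j _ /=; rewrite cell_intE; lmod.
have e1 : \sum_(0 <= i < n.+1) \sum_(0 <= j < n.+1) c i j *: (hE i j g - hE i j.+1 g) =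
  \sum_(0 <= i < n.+1) (hE i 0 g - hE i n.+1 g) +
  \sum_(0 <= i < n.+1) \sum_(0 <= j < n) (c i j.+1 - c i j) *: hE i j.+1 g.
  rewrite -big_split; apply: eq_big_nat => i; rewrite ltnS => /andP[_ hi] /=.
  rewrite abel_summation; have [a1 a2 _ _] := chi_bdry hi.
  by rewrite /c a1 a2 !scale1r.
have e2 : \sum_(0 <= j < n.+1) \sum_(0 <= i < n.+1) c i j *: (vE i.+1 j g - vE i j g) =
  \sum_(0 <= j < n.+1) (vE n.+1 j g - vE 0 j g) +
  \sum_(0 <= j < n.+1) \sum_(0 <= i < n) (c i j - c i.+1 j) *: vE i.+1 j g.
  rewrite -big_split; apply: eq_big_nat => j; rewrite ltnS => /andP[_ hj] /=.
  have := abel_summation n (c^~ j) (fun i => - vE i j g) => /= ab.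
  have [_ _ a1 a2] := chi_bdry hj.
  have -> : \sum_(0 <= i < n.+1) c i j *: (vE i.+1 j g - vE i j g) =
      \sum_(0 <= j0 < n.+1) c j0 j *: (- vE j0 j g - - vE j0.+1 j g).
    by apply: eq_bigr => i _; rewrite opprK addrC.
  rewrite ab /c a1 a2 !scale1r opprK; congr (_ + _); first by rewrite addrC.
  by apply: eq_bigr => i _; rewrite scalerN -scaleNr opprB.
by rewrite e1 e2 addrACA [RHS]addrC.
Qed.

End Mesh.
End Grid.

Section GridCauchy.
Variables (R : realType) (X : completeNormedModType R) (I : X -> X).
Local Notation C := (R[i]).
Local Notation Re := (@complex.Re R).
Local Notation Im := (@complex.Im R).
Hypothesis ID : forall x y, I (x + y) = I x + I y.
Hypothesis IZ : forall (a : R) x, I (a *: x) = a *: I x.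
Hypothesis II : forall x, I (I x) = - x.
Hypothesis Inorm : forall (a b : R) x, `|a *: x + b *: I x| = Num.sqrt (a ^+ 2 + b ^+ 2) * `|x|.
Local Notation act := (cact I).
Local Notation eint := (eint I).
Local Notation polyapprox := (polyapprox I).
Local Notation csum := (chain_sum I).
Ltac lmod := lmod_with R X.
Implicit Types (g h F : C -> X) (p q s : C).

Definition square (r : R) s : set C := [set w | `|Re w - Re s| <= r /\ `|Im w - Im s| <= r].

(** Allows a pole to move from the interior of a cell to a point on a grid line. *)
Lemma eint_inv_continuous p q F s0 : (exists2 S, polyapprox S F & forall t, 0 <= t <= 1 -> S (seg p q t)) ->
  (forall t, 0 <= t <= 1 -> seg p q t != s0) -> forall e : R, 0 < e ->
  exists2 d : R, 0 < d & forall s, normc (s - s0) < d -> (forall t, 0 <= t <= 1 -> seg p q t != s) ->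
    `|eint p q (fun w => act (w - s)^-1 (F w)) - eint p q (fun w => act (w - s0)^-1 (F w))| <= e.
Proof.
move=> [S hF hS] off e e0.
have [M M0 hM] := ccont_bounded (fun t ht => ccont_inv (off t ht)).
have [K K0 hK] := ucont_bound (econt_approx ID IZ II Inorm hS hF).
set W := normc (q - p) * (2 * M * M * K) + 1.
have W0 : 0 < W.
  have h := normc_ge0 (q - p).
  by rewrite /W ltr_wpDl // !mulr_ge0 // ltW.
(* [M] bounds the kernel at [s0]. Within distance [1/(2M)] of [s0] the kernel at [s] is at most
   [2M], so the two kernels differ by at most [2 M M] times the distance of the poles. *)
exists (Num.min (2 * M)^-1 (e / W)); first by rewrite lt_min invr_gt0 mulr_gt0 // divr_gt0.
move=> s; rewrite lt_min => /andP[s1 s2] offs.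
have ec s' : (forall t, 0 <= t <= 1 -> seg p q t != s') -> econt p q (fun w => act (w - s')^-1 (F w)).
  move=> hs'; apply: (econt_mul (I := I) ID IZ II Inorm (S := S) (u := fun w => (w - s')^-1)) => // t ht.
  exact: ccont_inv (hs' t ht).
rewrite -(eintB ID IZ Inorm (ec _ offs) (ec _ off)).
have bound t : 0 <= t <= 1 -> `|act (seg p q t - s)^-1 (F (seg p q t)) -
    act (seg p q t - s0)^-1 (F (seg p q t))| <= 2 * M * M * K * normc (s - s0).
  move=> ht; set w := seg p q t.
  have h1 := hM t ht; rewrite /= -/w normcV in h1.
  have w0 : w - s0 != 0 by rewrite subr_eq0 off.
  have ws : w - s != 0 by rewrite subr_eq0 offs.
  have nw0 : 0 < normc (w - s0).
    rewrite lt_neqAle normc_ge0 andbT eq_sym; apply/eqP => /eq0_normc/eqP.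
    by rewrite (negPf w0).
  have h2 : M^-1 <= normc (w - s0).
    by rewrite -[leRHS]invrK lef_pV2 ?posrE ?invr_gt0.
  have h3 : (2 * M)^-1 <= normc (w - s).
    have : normc (w - s0) <= normc (w - s) + normc (s - s0).
      by have -> : w - s0 = (w - s) + (s - s0) by [rewrite subrKA]; exact: le_normcD.
    have e2 : M^-1 = (2 * M)^-1 + (2 * M)^-1 by field; rewrite gt_eqF.
    move: h2 s1; rewrite e2; lra.
  have h4 : normc (w - s)^-1 <= 2 * M.
    rewrite normcV -[leRHS]invrK lef_pV2 // ?posrE ?invr_gt0 ?mulr_gt0 //.
    by apply: lt_le_trans h3; rewrite invr_gt0 mulr_gt0.
  rewrite -(actBl) (act_norm Inorm).
  have -> : (w - s)^-1 - (w - s0)^-1 = (w - s)^-1 * (w - s0)^-1 * (s - s0).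
    by field; rewrite ws w0.
  rewrite !normcM [X in _ * X * _ * _]normcV.
  have -> : 2 * M * M * K * normc (s - s0) = 2 * M * M * normc (s - s0) * K by ring.
  apply: ler_pM; rewrite ?normr_ge0 ?mulr_ge0 ?invr_ge0 ?normc_ge0 //; last exact: hK.
  by rewrite ler_wpM2r ?normc_ge0 //; apply: ler_pM; rewrite ?invr_ge0 ?normc_ge0.
apply: le_trans (eint_bound ID IZ Inorm _ bound) _; first exact: econtB (ec _ offs) (ec _ off).
apply: (@le_trans _ _ (W * normc (s - s0))).
  by rewrite mulrA ler_wpM2r ?normc_ge0 // /W lerDl.
by rewrite mulrC -ler_pdivlMr // ltW.
Qed.

Lemma csum_inv_continuous (ch : chain R) F s0 : (forall e, e \in ch ->
    exists2 S, polyapprox S F & forall t, 0 <= t <= 1 -> S (seg e.2.1 e.2.2 t)) ->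
  (forall e, e \in ch -> forall t, 0 <= t <= 1 -> seg e.2.1 e.2.2 t != s0) -> forall e : R, 0 < e ->
  exists2 d : R, 0 < d & forall s, normc (s - s0) < d ->
    (forall e, e \in ch -> forall t, 0 <= t <= 1 -> seg e.2.1 e.2.2 t != s) ->
    `|csum ch (fun w => act (w - s)^-1 (F w)) - csum ch (fun w => act (w - s0)^-1 (F w))| <= e.
Proof.
elim: ch => [|[a [p q]] ch IH] hS off e e0.
  by exists 1 => // s _ _; rewrite /chain_sum !big_nil subrr normr0 ltW.
have e2 : 0 < e / 2 by rewrite divr_gt0.
have inT x : x \in ch -> x \in (a, (p, q)) :: ch by rewrite in_cons orbC => ->.
have [d1 d10 h1] := IH (fun x hx => hS x (inT x hx)) (fun x hx => off x (inT x hx)) _ e2.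
have a1 : 0 < `|a| + 1 by rewrite ltr_wpDl.
have [d2 d20 h2] := eint_inv_continuous (hS _ (mem_head _ _)) (off _ (mem_head _ _)) (divr_gt0 e2 a1).
exists (Num.min d1 d2); first by rewrite lt_min d10.
move=> s; rewrite lt_min => /andP[s1 s2] hs; rewrite !csum_cons /=.
have := h1 s s1 (fun x hx => hs x (inT x hx)).
have := h2 s s2 (hs _ (mem_head _ _)) => /=.
set E1 := eint p q _; set E0 := eint p q _; set T1 := csum ch _; set T0 := csum ch _ => k1 k2.
have -> : a *: E1 + T1 - (a *: E0 + T0) = a *: (E1 - E0) + (T1 - T0) by lmod.
apply: le_trans (ler_normD _ _) _; rewrite (splitr e) lerD // normrZ.
move: k1; rewrite ler_pdivlMr // mulrC; apply: le_trans.
by rewrite ler_wpM2r // lerDl.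
Qed.

Section Main.
Variables (D : set C) (F : C -> X) (L r : R).
Hypotheses (L0 : 0 < L) (r0 : 0 < r).
Hypothesis hF : forall s, box (- L) L (- L) L s -> ~ D s -> polyapprox (square r s) F.
Hypothesis hD : forall s, D s -> `|Re s| < L /\ `|Im s| < L.

Section Fixed.
Variable n : nat.
Hypothesis hn : 2 * L / n.+1%:R <= r.
Local Notation gx := (gx L n).
Local Notation node := (grid_node L n).
Local Notation cell := (grid_cell L n).

(* the cells meeting the complement of [D]: [F] need not be approximable on the others *)
Definition chi (i j : nat) : bool := `[< exists2 s, cell i j s & ~ D s >].

Lemma cell_box i j : (i <= n)%N -> (j <= n)%N -> cell i j `<=` box (- L) L (- L) L.
Proof.
move=> hi hj s [/andP[a b] /andP[c d]].
have g0 k : - L <= gx k by rewrite -(gx0 L n); exact: gx_le.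
have gN k : (k <= n)%N -> gx k.+1 <= L by move=> hk; rewrite -[leRHS](gxN L n); exact: gx_le.
split; apply/andP; split.
- exact: le_trans (g0 i) a.
- exact: le_trans b (gN i hi).
- exact: le_trans (g0 j) c.
- exact: le_trans d (gN j hj).
Qed.

(** A selected cell contains a point outside [D], and its side is at most [r], so it lies in the
    square of radius [r] about that point. *)
Lemma cell_polyapprox i j : (i <= n)%N -> (j <= n)%N -> chi i j -> polyapprox (cell i j) F.
Proof.
move=> hi hj /asboolP[s cs Ds]; apply: polyapprox_sub (hF (cell_box hi hj cs) Ds).
move=> w [/andP[a b] /andP[c d]]; case: cs => /andP[a' b'] /andP[c' d'].
move: b b' d d' hn; rewrite !gxS; move: (2 * L / _) => k b b' d d' hk.
by split; rewrite ler_norml; apply/andP; split; lra.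
Qed.

Lemma not_chi i j s : ~~ chi i j -> cell i j s -> D s.
Proof. by move=> /asboolP hc cs; apply: contrapT => nd; apply: hc; exists s. Qed.

Lemma cell_node i j : [/\ cell i j (node i j), cell i j (node i.+1 j),
   cell i j (node i j.+1) & cell i j (node i.+1 j.+1)].
Proof.
have a k := gxSle n L0 k.
by split; rewrite /grid_cell /box /grid_node /= ?lexx ?a.
Qed.

Lemma chi_bdry i : (i <= n)%N -> [/\ chi i 0, chi i n, chi 0 i & chi n i].
Proof.
have gN : gx n.+1 = L := gxN L n.
move=> hi; split; apply/asboolP.
- exists (node i 0); first by have [] := cell_node i 0.
  by move=> /hD[_]; rewrite /grid_node [Im _]/= gx0 normrN gtr0_norm // ltxx.
- exists (node i n.+1); first by have [] := cell_node i n.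
  by move=> /hD[_]; rewrite /grid_node [Im _]/= gN gtr0_norm // ltxx.
- exists (node 0 i); first by have [] := cell_node 0 i.
  by move=> /hD[]; rewrite /grid_node [Re _]/= gx0 normrN gtr0_norm // ltxx.
- exists (node n.+1 i); first by have [] := cell_node n i.
  by move=> /hD[]; rewrite /grid_node [Re _]/= gN gtr0_norm // ltxx.
Qed.

(** Of the two cells at the edge, the selected one makes [F] approximable along it and the
    unselected one places it inside [D]. *)
Lemma inner_edge e : e \in inner_chain L n chi -> exists i j i' j',
  [/\ ((i <= n) && (j <= n))%N, chi i j, ~~ chi i' j',
      cell i j e.2.1 /\ cell i j e.2.2 & cell i' j' e.2.1 /\ cell i' j' e.2.2].
Proof.
rewrite mem_filter mem_cat => /andP[e0 /orP[]/allpairsP[[i j] [hi hj ee]]];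
rewrite ee in e0 *; rewrite /= in e0; move: hi hj; rewrite !mem_iota !add0n !leq0n !andTb ltnS [fst _]/= [snd _]/= => hi hj.
  have [a1 a2 a3 a4] := cell_node i j; have [b1 b2 b3 b4] := cell_node i j.+1.
  case E1 : (chi i j.+1) e0; case E2 : (chi i j); rewrite ?subrr ?eqxx //= => _.
    by exists i, j.+1, i, j; split=> //; rewrite ?E2 // hi.
  by exists i, j, i, j.+1; split=> //; rewrite ?E1 // hi ltnW.
have [a1 a2 a3 a4] := cell_node j i; have [b1 b2 b3 b4] := cell_node j.+1 i.
case E1 : (chi j.+1 i) e0; case E2 : (chi j i); rewrite ?subrr ?eqxx //= => _.
  by exists j.+1, i, j, i; split=> //; rewrite ?E2 // hi hj.
by exists j, i, j.+1, i; split=> //; rewrite ?E1 // hi ltnW.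
Qed.

Lemma outer_edge e : e \in outer_chain L n ->
  (exists i j, [/\ ((i <= n) && (j <= n))%N, chi i j & cell i j e.2.1 /\ cell i j e.2.2]) /\
  ((Re e.2.1 = Re e.2.2 /\ `|Re e.2.1| = L) \/ (Im e.2.1 = Im e.2.2 /\ `|Im e.2.1| = L)).
Proof.
have gN : gx n.+1 = L := gxN L n.
have g0 : gx 0 = - L := gx0 L n.
have L1 : `|L| = L by rewrite gtr0_norm.
rewrite !mem_cat => /orP[|/orP[|/orP[]]] /mapP[i hi ->]; move: hi;
rewrite mem_iota add0n leq0n andTb ltnS => hi; have [c1 c2 c3 c4] := chi_bdry hi.
- split; last by right; rewrite /grid_node [Im _]/= g0 normrN.
  by exists i, 0%N; split=> //; [rewrite hi | have [] := cell_node i 0].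
- split; last by right; rewrite /grid_node [Im _]/= gN.
  by exists i, n; split=> //; [rewrite hi leqnn | have [] := cell_node i n].
- split; last by left; rewrite /grid_node [Re _]/= gN.
  by exists n, i; split=> //; [rewrite hi leqnn | have [] := cell_node n i].
- split; last by left; rewrite /grid_node [Re _]/= g0 normrN.
  by exists 0%N, i; split=> //; have [] := cell_node 0 i.
Qed.

Lemma inner_in_D e t : e \in inner_chain L n chi -> 0 <= t <= 1 -> D (seg e.2.1 e.2.2 t).
Proof.
move=> /inner_edge[i [j [i' [j' [_ _ nc _ [c1 c2]]]]]] ht.
by apply: (not_chi nc); exact: seg_box.
Qed.

Lemma edges_approx e : e \in inner_chain L n chi ++ outer_chain L n ->
  exists2 S, polyapprox S F & forall t, 0 <= t <= 1 -> S (seg e.2.1 e.2.2 t).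
Proof.
rewrite mem_cat => /orP[/inner_edge[i [j [i' [j' [/andP[hi hj] hc _ [c1 c2] _]]]]]|].
  exists (cell i j); first exact: cell_polyapprox.
  by move=> t; exact: seg_box.
move=> /outer_edge[[i [j [/andP[hi hj] hc [c1 c2]]]] _].
exists (cell i j); first exact: cell_polyapprox.
by move=> t; exact: seg_box.
Qed.

Lemma outer_far e t : e \in outer_chain L n -> 0 <= t <= 1 ->
  L <= `|Re (seg e.2.1 e.2.2 t)| \/ L <= `|Im (seg e.2.1 e.2.2 t)|.
Proof.
move=> /outer_edge[_ [[h1 h2]|[h1 h2]]] _; [left|right].
  by rewrite seg_Re -h1 subrr mulr0 addr0 h2.
by rewrite seg_Im -h1 subrr mulr0 addr0 h2.
Qed.

Lemma grid_cauchy (p : {poly C}) :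
  csum (inner_chain L n chi) (fun w => act p.[w] (F w)) +
  csum (outer_chain L n) (fun w => act p.[w] (F w)) = 0.
Proof.
rewrite -(grid_sum I L chi_bdry) big_nat big1 // => i; rewrite ltnS => /andP[_ hi].
rewrite big_nat big1 // => j; rewrite ltnS => /andP[_ hj].
case E : (chi i j); last by rewrite scale0r.
rewrite /cell_int (rect_cauchy ID IZ II Inorm) ?scaler0 //; try exact: gxSle.
exact: cell_polyapprox.
Qed.

Lemma sg_between (a b x : R) : a < x < b -> Num.sg (b - x) - Num.sg (a - x) = 2.
Proof.
move=> /andP[ax xb]; rewrite gtr0_sg ?subr_gt0 // ltr0_sg ?subr_lt0 //; ring.
Qed.

Lemma sg_outside i i0 x : gx i0 < x < gx i0.+1 -> i != i0 ->
  Num.sg (gx i.+1 - x) - Num.sg (gx i - x) = 0.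
Proof.
move=> /andP[ax xb]; rewrite neq_ltn => /orP[hi|hi].
  have h1 : gx i.+1 <= gx i0 by exact: gx_le.
  have h2 := gxSle n L0 i.
  by rewrite !ltr0_sg ?subr_lt0 ?subrr //; lra.
have h1 : gx i0.+1 <= gx i by exact: gx_le.
have h2 := gxSle n L0 i.
by rewrite !gtr0_sg ?subr_gt0 ?subrr //; lra.
Qed.

Lemma gx_neq i i0 (x : R) : gx i0 < x < gx i0.+1 -> gx i != x.
Proof.
move=> /andP[ax xb]; have [h|h] := leqP i i0.
  by rewrite lt_eqF // (le_lt_trans _ ax) //; exact: gx_le.
by rewrite gt_eqF // (lt_le_trans xb) //; exact: gx_le.
Qed.

Lemma cell_off_edges i j i0 j0 s : gx i0 < Re s < gx i0.+1 -> gx j0 < Im s < gx j0.+1 ->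
  off_edges (gx i) (gx i.+1) (gx j) (gx j.+1) s.
Proof.
move=> hx hy; split=> t _; apply/eqP => e.
- by have /eqP := congr1 Im e; rewrite seg_Im /= subrr mulr0 addr0 (negPf (gx_neq _ hy)).
- by have /eqP := congr1 Re e; rewrite seg_Re /= subrr mulr0 addr0 (negPf (gx_neq _ hx)).
- by have /eqP := congr1 Im e; rewrite seg_Im /= subrr mulr0 addr0 (negPf (gx_neq _ hy)).
- by have /eqP := congr1 Re e; rewrite seg_Re /= subrr mulr0 addr0 (negPf (gx_neq _ hx)).
Qed.

(** [rect_formula] yields [2 pi i F(s)] on the cell around [s], whose index is 4, and zero on every
    other selected cell. *)
Lemma grid_formula_interior i0 j0 s : (i0 <= n)%N -> (j0 <= n)%N -> chi i0 j0 ->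
  gx i0 < Re s < gx i0.+1 -> gx j0 < Im s < gx j0.+1 ->
  csum (inner_chain L n chi) (fun w => act (w - s)^-1 (F w)) +
  csum (outer_chain L n) (fun w => act (w - s)^-1 (F w)) = act (0 +i* (2 * pi))%C (F s).
Proof.
move=> hi0 hj0 hc hx hy; rewrite -(grid_sum I L chi_bdry).
have val i j : (i <= n)%N -> (j <= n)%N -> (chi i j)%:R *: cell_int I L n i j (fun w => act (w - s)^-1 (F w)) =
    if (i == i0) && (j == j0) then act (0 +i* (2 * pi))%C (F s) else 0.
  move=> hi hj; case E : (chi i j); last first.
    rewrite scale0r; case: eqP => [ei|//]; case: eqP => [ej|//].
    by move: hc; rewrite -ei -ej E.
  have idx : rect_index (gx i) (gx i.+1) (gx j) (gx j.+1) s = if (i == i0) && (j == j0) then 4 else 0.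
    rewrite /rect_index; case: (eqVneq i i0) => [->|ii]; last by rewrite (sg_outside hx ii) mul0r.
    case: (eqVneq j j0) => [->|jj]; last by rewrite (sg_outside hy jj) mulr0.
    by rewrite (sg_between hx) (sg_between hy) /=; ring.
  rewrite scale1r /cell_int (rect_formula ID IZ II Inorm); try exact: gxSle.
  - rewrite idx; case: (_ && _); last by rewrite mulr0 act0l.
    by congr act; congr (_ +i* _)%C; field.
  - exact: cell_polyapprox.
  - exact: cell_off_edges hx hy.
  - rewrite idx; case: (eqVneq i i0) => [->|ii]; last by right.
    case: (eqVneq j j0) => [->|jj]; last by right.
    by left; case/andP: hx => ? ?; case/andP: hy => ? ?; split; apply/andP; split; apply: ltW.
set T := act _ _ in val *.
have row i : (i <= n)%N -> \sum_(0 <= j < n.+1) (chi i j)%:R *: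
    cell_int I L n i j (fun w => act (w - s)^-1 (F w)) = if i == i0 then T else 0.
  move=> hi; rewrite (eq_big_nat _ _ (F2 := fun j => if (i == i0) && (j == j0) then T else 0)).
    case: (i == i0) => /=; last by rewrite big1.
    by rewrite -big_mkcond big_nat1_eq /= ltnS hj0.
  by move=> j; rewrite ltnS => /andP[_ hj]; exact: val.
rewrite (eq_big_nat _ _ (F2 := fun i => if i == i0 then T else 0)).
  by rewrite -big_mkcond big_nat1_eq /= ltnS hi0.
by move=> i; rewrite ltnS => /andP[_ hi]; exact: row.
Qed.

End Fixed.
End Main.
End GridCauchy.

Section GridLimit.
Variables (R : realType) (X : completeNormedModType R) (I : X -> X).
Local Notation C := (R[i]).
Local Notation Re := (@complex.Re R).
Local Notation Im := (@complex.Im R).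
Hypothesis ID : forall x y, I (x + y) = I x + I y.
Hypothesis IZ : forall (a : R) x, I (a *: x) = a *: I x.
Hypothesis II : forall x, I (I x) = - x.
Hypothesis Inorm : forall (a b : R) x, `|a *: x + b *: I x| = Num.sqrt (a ^+ 2 + b ^+ 2) * `|x|.
Local Notation act := (cact I).
Local Notation polyapprox := (polyapprox I).
Local Notation csum := (chain_sum I).
Ltac lmod := lmod_with R X.
Implicit Types (g h F : C -> X) (p q s : C).

Lemma chain_on_grid L n chi e : e \in inner_chain L n chi ++ outer_chain L n ->
  (exists k : nat, Re e.2.1 = gx L n k /\ Re e.2.2 = gx L n k) \/
  (exists k : nat, Im e.2.1 = gx L n k /\ Im e.2.2 = gx L n k).
Proof.
rewrite mem_cat mem_filter mem_cat => /orP[/andP[_ /orP[]/allpairsP[[i j] [_ _ ->]]]|].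
- by right; exists j.+1.
- by left; exists j.+1.
rewrite !mem_cat => /orP[|/orP[|/orP[]]] /mapP[i _ ->].
- by right; exists 0%N.
- by right; exists n.+1.
- by left; exists n.+1.
- by left; exists 0%N.
Qed.

(** [s0] may lie on a grid line, so it is approached from the centre of a selected cell containing
    it. Inner edges lie in [D] and outer ones on the large square, so no edge of the chains meets
    [s0] and both sides are continuous there. *)
Lemma grid_formula (D : set C) F (L r : R) n s0 : 0 < L -> 0 < r ->
  (forall s, box (- L) L (- L) L s -> ~ D s -> polyapprox (square r s) F) ->
  (forall s, D s -> `|Re s| < L /\ `|Im s| < L) -> 2 * L / n.+1%:R <= r ->
  `|Re s0| < L -> `|Im s0| < L -> ~ D s0 ->
  csum (inner_chain L n (chi D L n)) (fun w => act (w - s0)^-1 (F w)) +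
  csum (outer_chain L n) (fun w => act (w - s0)^-1 (F w)) = act (0 +i* (2 * pi))%C (F s0).
Proof.
move=> L0 r0 hF hD hn hRe hIm nD.
set ch := inner_chain L n (chi D L n) ++ outer_chain L n.
rewrite -csum_cat -/ch.
have loc (x : R) : `|x| < L -> exists2 i, (i < n.+1)%N & gx L n i <= x <= gx L n i.+1.
  by rewrite ltr_norml => /andP[h1 h2]; apply: gx_locate => //; rewrite !ltW.
have [i hi hx] := loc _ hRe; have [j hj hy] := loc _ hIm.
have cs0 : grid_cell L n i j s0 by [].
have hc : chi D L n i j by apply/asboolP; exists s0.
have gi := gx_lt n L0 (ltnSn i); have gj := gx_lt n L0 (ltnSn j).
set ctr : C := ((gx L n i + gx L n i.+1) / 2 +i* ((gx L n j + gx L n j.+1) / 2))%C.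
have cctr : grid_cell L n i j ctr by split; apply/andP; split; rewrite /=; lra.
have inside t : 0 < t <= 1 -> gx L n i < Re (seg s0 ctr t) < gx L n i.+1 /\
    gx L n j < Im (seg s0 ctr t) < gx L n j.+1.
  case/andP => t0 t1; rewrite seg_Re seg_Im [Re ctr]/= [Im ctr]/=.
  move: hx hy gi gj => /andP[]; move: (gx L n i) (gx L n i.+1) => a b h1 h2 /andP[].
  move: (gx L n j) (gx L n j.+1) => c d h3 h4 ab cd.
  by split; apply/andP; split; nra.
have key t : 0 < t <= 1 -> csum ch (fun w => act (w - seg s0 ctr t)^-1 (F w)) =
    act (0 +i* (2 * pi))%C (F (seg s0 ctr t)).
  move=> ht; have [h1 h2] := inside t ht; rewrite csum_cat.
  exact: (grid_formula_interior ID IZ II Inorm L0 hF hD hn hi hj hc h1 h2).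
have happ := edges_approx L0 hF hD hn.
have off e : e \in ch -> forall t, 0 <= t <= 1 -> seg e.2.1 e.2.2 t != s0.
  rewrite mem_cat => /orP[he|he] t ht; apply/eqP => es.
    by apply: nD; rewrite -es; exact: inner_in_D he ht.
  by case: (outer_far L0 hD he ht); rewrite es leNgt ?hRe ?hIm.
have off' t : 0 < t <= 1 -> forall e, e \in ch -> forall u, 0 <= u <= 1 ->
    seg e.2.1 e.2.2 u != seg s0 ctr t.
  move=> ht e he u hu; have [h1 h2] := inside t ht; apply/eqP => es.
  case: (chain_on_grid he) => -[k [k1 k2]].
    have /eqP := congr1 Re es; rewrite seg_Re k1 k2 subrr mulr0 addr0.
    by rewrite (negPf (gx_neq L0 k h1)).
  have /eqP := congr1 Im es; rewrite seg_Im k1 k2 subrr mulr0 addr0.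
  by rewrite (negPf (gx_neq L0 k h2)).
apply/eqP; rewrite -subr_eq0 -normr_le0; apply/ler_addgt0Pr => e e0; rewrite add0r.
have e2 : 0 < e / 2 by rewrite divr_gt0.
have [d1 d10 hd1] := csum_inv_continuous ID IZ II Inorm happ off e2.
have ec : econt s0 ctr F.
  apply: (econt_approx ID IZ II Inorm (S := grid_cell L n i j)); first by move=> t; exact: seg_box.
  exact: (cell_polyapprox L0 hF hn hi hj hc).
have [d2 d20 hd2] := ucont_actl ID IZ Inorm (0 +i* (2 * pi))%C ec e2.
have W0 : 0 < normc (ctr - s0) + 1 by rewrite ltr_wpDl // normc_ge0.
pose t := Num.min 1 (Num.min (d2 / 2) (d1 / 2 / (normc (ctr - s0) + 1))).
have t0 : 0 < t by rewrite !lt_min ltr01 !divr_gt0.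
have t1 : t <= 1 by rewrite ge_min lexx.
have td2 : t <= d2 / 2 by rewrite !ge_min lexx !orbT.
have td1 : t <= d1 / 2 / (normc (ctr - s0) + 1) by rewrite !ge_min lexx !orbT.
have ht : 0 < t <= 1 by rewrite t0.
have near : normc (seg s0 ctr t - s0) < d1.
  have -> : seg s0 ctr t - s0 = (t +i* 0)%C * (ctr - s0) by rewrite /seg addrAC subrr add0r.
  rewrite normcM; have -> : normc (t +i* 0)%C = t.
    by rewrite /normc /= expr0n /= addr0 sqrtr_sqr gtr0_norm.
  have : t * (normc (ctr - s0) + 1) <= d1 / 2 by rewrite -ler_pdivlMr.
  by rewrite mulrDr mulr1; move: t0 d10; lra.
have k1 := hd1 _ near (off' t ht).
rewrite (key t ht) in k1.
have k2 := hd2 0 t; rewrite seg0 lexx ler01 t1 (ltW t0) sub0r normrN gtr0_norm // in k2.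
have {}k2 : `|act (0 +i* (2 * pi))%C (F s0) - act (0 +i* (2 * pi))%C (F (seg s0 ctr t))| <= e / 2.
  by apply: k2 => //; apply: le_lt_trans td2 _; rewrite ltr_pdivrMr // ltr_pMr // ltr1n.
set A := act _ (F s0) in k2 *; set B := act _ (F (seg s0 ctr t)) in k1 k2.
set S := csum ch _ in k1 *.
have -> : S - A = - (A - B) - (B - S) by lmod.
by apply: le_trans (ler_normB _ _) _; rewrite normrN (splitr e) lerD.
Qed.

Lemma csum_act ch c g : (forall e, e \in ch -> econt e.2.1 e.2.2 g) ->
  csum ch (fun w => act c (g w)) = act c (csum ch g).
Proof.
elim: ch => [|e ch IH] h; first by rewrite /chain_sum !big_nil (act0 IZ).
rewrite !csum_cons IH => [|x hx]; last by apply: h; rewrite in_cons hx orbT.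
rewrite (eint_act ID IZ II Inorm); last exact: h (mem_head _ _).
by rewrite (actD ID _ (_ *: _)) (actZ IZ).
Qed.

Lemma csumD ch g h : (forall e, e \in ch -> econt e.2.1 e.2.2 g) ->
  (forall e, e \in ch -> econt e.2.1 e.2.2 h) ->
  csum ch (fun w => g w + h w) = csum ch g + csum ch h.
Proof.
elim: ch => [|e ch IH] hg hh; first by rewrite /chain_sum !big_nil addr0.
rewrite !csum_cons IH => [|x hx|x hx]; last 2 first.
- by apply: hg; rewrite in_cons hx orbT.
- by apply: hh; rewrite in_cons hx orbT.
rewrite (eintD ID IZ Inorm (hg _ (mem_head _ _)) (hh _ (mem_head _ _))).
by rewrite scalerDr addrACA.
Qed.

Lemma csum_sum ch (T : Type) (r : seq T) (g : T -> C -> X) :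
  (forall k e, e \in ch -> econt e.2.1 e.2.2 (g k)) ->
  csum ch (fun w => \sum_(k <- r) g k w) = \sum_(k <- r) csum ch (g k) /\
  (forall e, e \in ch -> econt e.2.1 e.2.2 (fun w => \sum_(k <- r) g k w)).
Proof.
move=> h; elim: r => [|k r [IH1 IH2]].
  have z (e : R * (C * C)) : econt e.2.1 e.2.2 (fun=> 0 : X).
    by move=> d d0; exists 1 => // u v _ _ _; rewrite subrr normr0 ltW.
  split=> [|e _].
    rewrite big_nil; under [X in csum ch X]eq_fun do rewrite big_nil.
    rewrite /chain_sum big1 // => e _.
    rewrite (@eintE _ _ I _ _ _ (fun=> 0)) ?subrr ?scaler0 //.
    by apply: prim_ext (prim0 X 0 1) => t _ //; rewrite (act0 IZ).
  by under [X in econt _ _ X]eq_fun do rewrite big_nil; exact: z.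
split=> [|e he].
  under [X in csum ch X]eq_fun do rewrite big_cons.
  rewrite big_cons csumD ?IH1 //; exact: h.
under [X in econt _ _ X]eq_fun do rewrite big_cons.
exact: (econtD (h k e he) (IH2 e he)).
Qed.

Definition clength (ch : chain R) : R := \sum_(e <- ch) `|e.1| * normc (e.2.2 - e.2.1).

Lemma clength_ge0 ch : 0 <= clength ch.
Proof. by apply: sumr_ge0 => e _; rewrite mulr_ge0 ?normr_ge0 ?normc_ge0. Qed.

Lemma csum_bound ch g M : (forall e, e \in ch -> econt e.2.1 e.2.2 g) ->
  (forall e, e \in ch -> forall t, 0 <= t <= 1 -> `|g (seg e.2.1 e.2.2 t)| <= M) ->
  `|csum ch g| <= clength ch * M.
Proof.
elim: ch => [|e ch IH] hc hb; first by rewrite /chain_sum /clength !big_nil normr0 mul0r.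
rewrite csum_cons /clength big_cons mulrDl; apply: le_trans (ler_normD _ _) _; apply: lerD.
  rewrite normrZ -mulrA ler_wpM2l // (eint_bound ID IZ Inorm) //; first exact: hc (mem_head _ _).
  exact: hb (mem_head _ _).
by apply: IH => x hx; [apply: hc | apply: hb]; rewrite in_cons hx orbT.
Qed.

Lemma csum_ext ch g h : (forall e, e \in ch -> forall t, 0 <= t <= 1 ->
   g (seg e.2.1 e.2.2 t) = h (seg e.2.1 e.2.2 t)) -> csum ch g = csum ch h.
Proof.
by move=> gh; apply: eq_big_seq => e he; rewrite (eint_ext I (gh e he)).
Qed.

End GridLimit.

(** * Integrals over the outer square *)

Section Laurent.
Variables (R : realType) (X : completeNormedModType R) (I : X -> X).
Local Notation C := (R[i]).
Local Notation Re := (@complex.Re R).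
Local Notation Im := (@complex.Im R).
Hypothesis ID : forall x y, I (x + y) = I x + I y.
Hypothesis IZ : forall (a : R) x, I (a *: x) = a *: I x.
Hypothesis II : forall x, I (I x) = - x.
Hypothesis Inorm : forall (a b : R) x, `|a *: x + b *: I x| = Num.sqrt (a ^+ 2 + b ^+ 2) * `|x|.
Local Notation act := (cact I).
Local Notation csum := (chain_sum I).
Implicit Types (g h F : C -> X) (p q s : C).

Section Boundary.
Variables (L : R) (n : nat).
Hypothesis L0 : 0 < L.
Local Notation oc := (outer_chain L n).
Local Notation a := (- L +i* - L)%C.
Local Notation b := (L +i* - L)%C.
Local Notation c := (L +i* L)%C.
Local Notation d := (- L +i* L)%C.

Lemma node_corners : [/\ grid_node L n 0 0 = a, grid_node L n n.+1 0 = b,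
  grid_node L n n.+1 n.+1 = c & grid_node L n 0 n.+1 = d].
Proof. by rewrite /grid_node gxN gx0. Qed.

(** Horizontal and vertical edges may use different primitives, as the logarithm requires; only the
    values at the four corners survive. *)
Lemma csum_outer_telescope g (P Q : C -> C) x :
  (forall i j, (j = 0%N) \/ (j = n.+1) -> hE I L n i j g = act (P (grid_node L n i.+1 j) - P (grid_node L n i j)) x) ->
  (forall i j, (i = 0%N) \/ (i = n.+1) -> vE I L n i j g = act (Q (grid_node L n i j.+1) - Q (grid_node L n i j)) x) ->
  csum oc g = act (P b - P a - (P c - P d) + (Q c - Q b) - (Q d - Q a)) x.
Proof.
move=> hP hQ; rewrite csum_outer !sumrB.
have tel (f : nat -> X) : \sum_(0 <= i < n.+1) (f i.+1 - f i) = f n.+1 - f 0%N by rewrite telescope_sumr.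
have eh j : (j = 0%N) \/ (j = n.+1) -> \sum_(0 <= i < n.+1) hE I L n i j g =
    act (P (grid_node L n n.+1 j) - P (grid_node L n 0 j)) x.
  move=> hj; rewrite actBl -(tel (fun i => act (P (grid_node L n i j)) x)).
  by apply: eq_bigr => i _; rewrite hP // actBl.
have ev i : (i = 0%N) \/ (i = n.+1) -> \sum_(0 <= j < n.+1) vE I L n i j g =
    act (Q (grid_node L n i n.+1) - Q (grid_node L n i 0)) x.
  move=> hi; rewrite actBl -(tel (fun j => act (Q (grid_node L n i j)) x)).
  by apply: eq_bigr => j _; rewrite hQ // actBl.
have [e1 e2 e3 e4] := node_corners.
rewrite (eh 0%N (or_introl erefl)) (eh n.+1 (or_intror erefl)).
rewrite (ev 0%N (or_introl erefl)) (ev n.+1 (or_intror erefl)).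
by rewrite e1 e2 e3 e4 -!(actBl, actDl) addrA.
Qed.

Lemma outer_neq0 i j t : (j = 0%N) \/ (j = n.+1) ->
  seg (grid_node L n i j) (grid_node L n i.+1 j) t != 0 /\ seg (grid_node L n j i) (grid_node L n j i.+1) t != 0.
Proof.
move=> hj; have gj : gx L n j != 0.
  by case: hj => ->; rewrite ?gx0 ?gxN ?oppr_eq0 gt_eqF.
split; apply/eqP => e.
  by have /eqP := congr1 Im e; rewrite seg_Im /= subrr mulr0 addr0 (negPf gj).
by have /eqP := congr1 Re e; rewrite seg_Re /= subrr mulr0 addr0 (negPf gj).
Qed.

Lemma outer_poly (p : {poly C}) x : csum oc (fun w => act p.[w] x) = 0.
Proof.
have [P <-] := poly_primitive p.
rewrite (@csum_outer_telescope _ (fun w => P.[w]) (fun w => P.[w]) x).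
- set A := P.[a]; set B := P.[b]; set E := P.[c]; set G := P.[d].
  by rewrite (_ : _ + _ - _ = 0) ?act0l //; ring.
- by move=> i j _; exact: (eint_horner ID IZ II).
- by move=> i j _; exact: (eint_horner ID IZ II).
Qed.

Lemma outer_invX k x : csum oc (fun w => act (w ^- k.+2) x) = 0.
Proof.
pose P (w : C) := - (k.+1)%:R^-1 * w ^- k.+1.
rewrite (@csum_outer_telescope _ P P x).
- set A := P a; set B := P b; set E := P c; set G := P d.
  by rewrite (_ : _ + _ - _ = 0) ?act0l //; ring.
- by move=> i j hj; apply: (eint_invX ID IZ II) => t _; have [] := outer_neq0 i t hj.
- by move=> j i hj; apply: (eint_invX ID IZ II) => t _; have [] := outer_neq0 i t hj.
Qed.

(** The subdivision is immaterial: telescoping leaves the corner values of one rectangle, which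
    [rect_inv] evaluates. *)
Lemma outer_inv x : csum oc (fun w => act (w^-1) x) = act (0 +i* (2 * pi))%C x.
Proof.
have sub0 w : w^-1 = (w - 0)^-1 :> C by rewrite subr0.
have lt0 : - L < 0 by rewrite oppr_lt0.
have off : off_edges (- L) L (- L) L (0 : C).
  split=> t _; apply/eqP => e.
  - by have := congr1 Im e; rewrite seg_Im /= subrr mulr0 addr0; lra.
  - by have := congr1 Re e; rewrite seg_Re /= subrr mulr0 addr0; lra.
  - by have := congr1 Im e; rewrite seg_Im /= subrr mulr0 addr0; lra.
  - by have := congr1 Re e; rewrite seg_Re /= subrr mulr0 addr0; lra.
have -> : act (0 +i* (2 * pi))%C x = rect I (- L) L (- L) L (fun w => act (w - 0)^-1 x).
  rewrite (rect_inv ID IZ II x off) /rect_index /= !subr0 gtr0_sg // ltr0_sg //.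
  by congr act; congr (_ +i* _)%C; field.
under eq_fun do rewrite sub0.
rewrite (@csum_outer_telescope _ (hlog 0) (vlog 0) x).
- case: off => h1 h2 h3 h4; rewrite /rect (eint_inv_h ID IZ II _ _ h1) // (eint_inv_h ID IZ II _ _ h3) //.
  rewrite (eint_inv_v ID IZ II _ _ h2) // (eint_inv_v ID IZ II _ _ h4) // -!(actDl, actBl).
  by congr act; ring.
- move=> i j hj; apply: (eint_inv_h ID IZ II) => // t _; by have [] := outer_neq0 i t hj.
- move=> j i hj; apply: (eint_inv_v ID IZ II) => // t _; by have [] := outer_neq0 i t hj.
Qed.

Lemma outer_chain_neq0 e t : e \in oc -> seg e.2.1 e.2.2 t != 0.
Proof.
rewrite !mem_cat => /orP[|/orP[|/orP[]]] /mapP[i _ ->].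
- by have [] := outer_neq0 i t (or_introl (erefl 0%N)).
- by have [] := outer_neq0 i t (or_intror (erefl n.+1)).
- by have [_] := outer_neq0 i t (or_intror (erefl n.+1)).
- by have [_] := outer_neq0 i t (or_introl (erefl 0%N)).
Qed.

Lemma econt_invX e m k x : e \in oc ->
  econt e.2.1 e.2.2 (fun w => act (w ^+ m * w ^- k) x).
Proof.
move=> he; apply: (ucont_act I (z := fun t => seg e.2.1 e.2.2 t ^+ m * seg e.2.1 e.2.2 t ^- k)) => t _.
apply: ccontM; first by apply: ccontX; exact: ccont_seg.
apply: (ccontV (z := fun u => seg e.2.1 e.2.2 u ^+ k)).
  by apply: ccontX; exact: ccont_seg.
by rewrite expf_neq0 // outer_chain_neq0.
Qed.

Lemma outer_monomial m k x : csum oc (fun w => act (w ^+ m * w ^- k.+1) x) =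
  if k == m then act (0 +i* (2 * pi))%C x else 0.
Proof.
have [km|mk|->] := ltngtP k m.
- rewrite -(outer_poly 'X^(m - k.+1) x); apply: csum_ext => e he t _.
  have w0 := outer_chain_neq0 t he; rewrite hornerXn.
  by rewrite -{1}(subnK km) exprD -mulrA divff ?mulr1 // expf_neq0.
- rewrite -(outer_invX (k - m.+1) x); apply: csum_ext => e he t _.
  have w0 := outer_chain_neq0 t he; congr act.
  have -> : k.+1 = (m + (k - m.+1).+2)%N by rewrite !addnS -addSn subnKC.
  by rewrite exprD invfM mulrA divff ?mul1r // expf_neq0.
- rewrite -outer_inv; apply: csum_ext => e he t _.
  have w0 := outer_chain_neq0 t he; congr act.
  by rewrite exprS invfM mulrCA divff ?mulr1 // expf_neq0.
Qed.

Lemma outer_laurent F (x : nat -> X) m :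
  (forall e, e \in oc -> econt e.2.1 e.2.2 F) ->
  (forall eps : R, 0 < eps -> exists N0, forall N, (N0 <= N)%N -> forall e, e \in oc ->
     forall t, 0 <= t <= 1 -> let w := seg e.2.1 e.2.2 t in
     `|F w - \sum_(k < N) act (w ^- k.+1) (x k)| <= eps) ->
  (forall e, e \in oc -> econt e.2.1 e.2.2 (fun w => act (w ^+ m) (F w))) ->
  csum oc (fun w => act (w ^+ m) (F w)) = act (0 +i* (2 * pi))%C (x m).
Proof.
move=> cF hF cmF; apply/eqP; rewrite -subr_eq0 -normr_le0; apply/ler_addgt0Pr => eps e0; rewrite add0r.
have [M M0 hM] : exists2 M : R, 0 < M & forall e, e \in oc -> forall t, 0 <= t <= 1 ->
    normc (seg e.2.1 e.2.2 t ^+ m) <= M.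
  have: forall ch : chain R, exists2 M : R, 0 < M & forall e, e \in ch -> forall t, 0 <= t <= 1 ->
    normc (seg e.2.1 e.2.2 t ^+ m) <= M; last exact.
  elim=> [|e ch [M M0 IH]]; first by exists 1.
  have [K K0 hK] := @ccont_bounded R (fun t => seg e.2.1 e.2.2 t ^+ m) 0 1
    (fun t _ => ccontX m (ccont_seg e.2.1 e.2.2 t)).
  exists (M + K) => [|e']; first exact: addr_gt0.
  rewrite in_cons => /orP[/eqP ->|/IH h] t ht.
    by apply: le_trans (hK t ht) _; rewrite lerDr ltW.
  by apply: le_trans (h t ht) _; rewrite lerDl ltW.
have W0 : 0 < clength oc * M + 1.
  by rewrite ltr_wpDl // mulr_ge0 ?clength_ge0 // ltW.
(* Taking [N] above [m] ensures that the only term with a residue is among those summed. *)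
have [N0 hN] := hF _ (divr_gt0 e0 W0); set N := maxn N0 m.+1.
have {}hN := hN N (leq_maxl _ _).
pose g (k : 'I_N) (w : C) := act (w ^+ m * w ^- k.+1) (x k).
have [s1 s2] := csum_sum ID IZ Inorm (ch := oc) (index_enum 'I_N) (g := g)
  (fun k e he => econt_invX m k.+1 (x k) he).
have mN : (m < N)%N by rewrite leq_maxr.
have val : csum oc (fun w => \sum_(k < N) g k w) = act (0 +i* (2 * pi))%C (x m).
  rewrite s1 (bigD1 (Ordinal mN)) //= big1 ?addr0 ?outer_monomial ?eqxx // => k hk.
  rewrite outer_monomial; case: eqP => // km.
  by move: hk; rewrite -val_eqE /= km eqxx.
rewrite -val.
have -> : csum oc (fun w => act (w ^+ m) (F w)) - csum oc (fun w => \sum_(k < N) g k w) =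
    csum oc (fun w => act (w ^+ m) (F w) - \sum_(k < N) g k w).
  have := csum_act ID IZ II Inorm (-1) s2; rewrite actNl act1 => <-.
  rewrite -(csumD ID IZ Inorm cmF) => [|e he]; last first.
    by apply: (econt_actl ID IZ Inorm); exact: s2.
  by apply: csum_ext => e he t ht; rewrite actNl act1.
apply: (@le_trans _ _ (clength oc * (M * (eps / (clength oc * M + 1))))).
  apply: (csum_bound ID IZ Inorm) => e he.
    have h : econt e.2.1 e.2.2 (fun w => act (w ^+ m) (F w) - (\sum_(k < N) g k w)).
      exact: (econtB ID IZ Inorm (cmF e he) (s2 e he)).
    exact: h.
  move=> t ht; set w := seg e.2.1 e.2.2 t.
  have -> : act (w ^+ m) (F w) - \sum_(k < N) g k w =
      act (w ^+ m) (F w - \sum_(k < N) act (w ^- k.+1) (x k)).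
    rewrite (actB ID IZ) (act_sum ID IZ); congr (_ - _); apply: eq_bigr => k _.
    by rewrite /g (actM ID IZ II).
  rewrite (act_norm Inorm); apply: ler_pM; rewrite ?normc_ge0 ?normr_ge0 //.
    exact: hM.
  exact: hN.
rewrite mulrA mulrCA ger_pMr // ler_pdivrMr // mul1r lerDl //.
Qed.

End Boundary.
End Laurent.

(** * Exchange of contours *)

Section Swap.
Variables (R : realType) (X : completeNormedModType R) (I : X -> X).
Local Notation C := (R[i]).
Hypothesis ID : forall x y, I (x + y) = I x + I y.
Hypothesis IZ : forall (a : R) x, I (a *: x) = a *: I x.
Hypothesis II : forall x, I (I x) = - x.
Hypothesis Inorm : forall (a b : R) x, `|a *: x + b *: I x| = Num.sqrt (a ^+ 2 + b ^+ 2) * `|x|.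
Local Notation act := (cact I).
Local Notation eint := (eint I).
Local Notation csum := (chain_sum I).
Local Notation polyapprox := (polyapprox I).
Ltac lmod := lmod_with R X.

Variables (n : nat) (c c' : 'I_n -> R -> C) (a b : 'I_n -> R) (m : nat).
Hypothesis ab : forall k, a k < b k.
Hypothesis dc : forall k t, cder (c k) (c' k) t.
Hypothesis cc' : forall k t, ccont (c' k) t.

Definition on_curves (s : C) := exists k t, a k <= t <= b k /\ s = c k t.

(* [V] is the value of the contour integral of [w^m phi w dw] over all the curves, in
   the weak sense that [phi] is a uniform limit of functions whose integrals exist *)
Definition weak_contour (phi : C -> X) (V : X) : Prop :=
  forall e : R, 0 < e -> exists (psi : C -> X) (H : 'I_n -> R -> X),
  [/\ forall s, on_curves s -> `|phi s - psi s| <= e,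
      forall k, prim (fun t => act (c k t ^+ m * c' k t) (psi (c k t))) (H k) (a k) (b k)
    & `|\sum_(k < n) (H k (b k) - H k (a k)) - V| <= e].

Lemma weak_contourZD (r : R) phi1 V1 phi2 V2 : weak_contour phi1 V1 -> weak_contour phi2 V2 ->
  weak_contour (fun s => r *: phi1 s + phi2 s) (r *: V1 + V2).
Proof.
move=> h1 h2 e e0; have r1 : 0 < `|r| + 1 by rewrite ltr_wpDl.
have e2 : 0 < e / 2 by rewrite divr_gt0.
have [psi1 [H1 [p1 q1 v1]]] := h1 _ (divr_gt0 e2 r1).
have [psi2 [H2 [p2 q2 v2]]] := h2 _ e2.
have small x : x <= e / 2 / (`|r| + 1) -> 0 <= x -> `|r| * x <= e / 2.
  rewrite ler_pdivlMr // => h x0; apply: le_trans h; rewrite mulrC ler_wpM2l //.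
  by rewrite lerDl.
exists (fun s => r *: psi1 s + psi2 s), (fun k t => r *: H1 k t + H2 k t); split.
- move=> s hs.
  have -> : r *: phi1 s + phi2 s - (r *: psi1 s + psi2 s) =
    r *: (phi1 s - psi1 s) + (phi2 s - psi2 s) by lmod.
  apply: le_trans (ler_normD _ _) _; rewrite (splitr e) lerD ?p2 // normrZ.
  by apply: small; rewrite ?p1.
- move=> k; apply: prim_ext (primZD r (q1 k) (q2 k)) => t _ //.
  by rewrite (actD ID _ (r *: psi1 (c k t))) (actZ IZ).
have -> : \sum_(k < n) (r *: H1 k (b k) + H2 k (b k) - (r *: H1 k (a k) + H2 k (a k))) =
  r *: (\sum_(k < n) (H1 k (b k) - H1 k (a k))) + \sum_(k < n) (H2 k (b k) - H2 k (a k)).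
  rewrite scaler_sumr -big_split; apply: eq_bigr => k _ /=; lmod.
set S1 := \sum_(k < n) (H1 k _ - _) in v1 *; set S2 := \sum_(k < n) (H2 k _ - _) in v2 *.
have -> : r *: S1 + S2 - (r *: V1 + V2) = r *: (S1 - V1) + (S2 - V2) by lmod.
apply: le_trans (ler_normD _ _) _; rewrite (splitr e) lerD // normrZ.
exact: small.
Qed.

Lemma weak_contour0 : weak_contour (fun=> 0) 0.
Proof.
move=> e e0; exists (fun=> 0), (fun=> fun=> 0); split.
- by move=> s _; rewrite subrr normr0 ltW.
- by move=> k; apply: prim_ext (prim0 X (a k) (b k)) => t _ //; rewrite (act0 IZ).
- by rewrite big1 ?subrr ?normr0 ?ltW // => k _; rewrite subrr.
Qed.

Lemma curve_bounded k : exists2 M : R, 0 < M & forall t, a k <= t <= b k ->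
  normc (c k t ^+ m * c' k t) <= M.
Proof.
apply: (ccont_bounded (z := fun t => c k t ^+ m * c' k t)) => t _.
by apply: ccontM => //; apply: ccontX; exact: cder_cont (dc k t).
Qed.

(** Replacing [phi] by an approximant changes the contour integrals by at most its uniform error
    times the total of weight bound times parameter length. *)
Lemma weak_contour_value phi V (G : 'I_n -> R -> X) : weak_contour phi V ->
  (forall k, prim (fun t => act (c k t ^+ m * c' k t) (phi (c k t))) (G k) (a k) (b k)) ->
  \sum_(k < n) (G k (b k) - G k (a k)) = V.
Proof.
move=> hw hG.
have hb k : exists M : R, 0 < M /\ forall t, a k <= t <= b k -> normc (c k t ^+ m * c' k t) <= M.
  by have [M M0 hM] := curve_bounded k; exists M.
have [M hM] := choice hb.
pose W := \sum_(k < n) M k * (b k - a k) + 1.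
have W0 : 0 < W.
  rewrite ltr_wpDl // sumr_ge0 // => k _; rewrite mulr_ge0 ?subr_ge0 ?(ltW (ab k)) //.
  by have [/ltW] := hM k.
apply/eqP; rewrite -subr_eq0 -normr_le0; apply/ler_addgt0Pr => e e0; rewrite add0r.
have [psi [H [p q v]]] := hw _ (divr_gt0 e0 W0); set e' := e / W in p v.
have d k : `|(G k (b k) - G k (a k)) - (H k (b k) - H k (a k))| <= M k * e' * (b k - a k).
  have -> : G k (b k) - G k (a k) - (H k (b k) - H k (a k)) =
    (G k (b k) - H k (b k)) - (G k (a k) - H k (a k)) by lmod.
  apply: (prim_bound (ltW (ab k)) (primB (hG k) (q k))) => t ht.
  rewrite -(actB ID IZ) (act_norm Inorm).
  apply: ler_pM; rewrite ?normc_ge0 ?normr_ge0 //; first by have [_] := hM k; exact.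
  by apply: p; exists k, t.
set SG := \sum_(k < n) (G k _ - _); set SH := \sum_(k < n) (H k _ - _) in v.
have dS : `|SG - SH| <= (\sum_(k < n) M k * (b k - a k)) * e'.
  rewrite -sumrB mulr_suml; apply: le_trans (ler_norm_sum _ _ _) _; apply: ler_sum => k _.
  by rewrite mulrAC d.
have -> : SG - V = (SG - SH) + (SH - V) by rewrite subrKA.
apply: le_trans (ler_normD _ _) _.
have -> : e = W * e' by rewrite /e' mulrC divfK ?gt_eqF.
by rewrite /W mulrDl mul1r lerD.
Qed.

(** In the applications [o] is minus [2 pi i] times the total winding number of the curves about
    [w]; the minus sign is due to the kernel [(w - z)^-1] in place of [(z - w)^-1]. *)
Definition pole_value (w : C) (o : C) : Prop := forall y, exists K : 'I_n -> R -> X,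
  (forall k, prim (fun t => act (c k t ^+ m * c' k t * (w - c k t)^-1) y) (K k) (a k) (b k)) /\
  \sum_(k < n) (K k (b k) - K k (a k)) = act (o * w ^+ m) y.

(** A Riemann sum over the edge approximates the inner integral uniformly in [s] on the curves,
    since these keep the distance [rho] from the edge. Its contour integral is known term by term
    from [pole_value], and is again a Riemann sum over the edge, now for the claimed value. *)
Lemma weak_contour_edge p q F o (rho : R) : 0 < rho ->
  (exists2 S, polyapprox S F & forall t, 0 <= t <= 1 -> S (seg p q t)) ->
  (forall t s, 0 <= t <= 1 -> on_curves s -> rho <= normc (seg p q t - s)) ->
  (forall t, 0 <= t <= 1 -> pole_value (seg p q t) o) ->
  weak_contour (fun s => eint p q (fun w => act (w - s)^-1 (F w)))
    (eint p q (fun w => act (o * w ^+ m) (F w))).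
Proof.
move=> rho0 [S hF hS] far pole e e0.
have uF : econt p q F := econt_approx ID IZ II Inorm hS hF.
have [K K0 hK] := ucont_bound uF.
set l := normc (q - p); have l0 : 0 <= l := normc_ge0 _.
have off s : on_curves s -> forall t, 0 <= t <= 1 -> seg p q t != s.
  move=> hs t ht; apply/eqP => h; have := far t s ht hs.
  by rewrite h subrr normc0 leNgt rho0.
have frho t s : 0 <= t <= 1 -> on_curves s -> normc (seg p q t - s)^-1 <= rho^-1.
  move=> ht hs; rewrite normcV lef_pV2 ?posrE ?far //.
  exact: lt_le_trans (far t s ht hs).
have e2 : 0 < e / 2 by rewrite divr_gt0.
(* [A] controls the change of [F] along the edge against the bounded kernel, [B] the change of the
   kernel against the bound [K] of [F]. *)
pose A := l * rho^-1 + 1; pose B := l * (l * rho^-1 * rho^-1 * K) + 1.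
have A0 : 0 < A by rewrite ltr_wpDl // mulr_ge0 // invr_ge0 ltW.
have ri0 : 0 <= rho^-1 by rewrite invr_ge0 ltW.
have B0 : 0 < B by rewrite ltr_wpDl // !mulr_ge0.
have [d1 d10 hd1] := uF _ (divr_gt0 e2 A0).
pose f s t := act (q - p) (act (seg p q t - s)^-1 (F (seg p q t))).
have fmod s u v : on_curves s -> 0 <= u <= 1 -> 0 <= v <= 1 ->
    `|u - v| < Num.min d1 (e / 2 / B) -> `|f s u - f s v| <= e.
  move=> hs hu hv; rewrite lt_min => /andP[k1 k2].
  have h1 := hd1 u v hu hv k1.
  rewrite /f; set wu := seg p q u; set wv := seg p q v in h1 *.
  rewrite -/wu in h1.
  have -> : act (q - p) (act (wu - s)^-1 (F wu)) - act (q - p) (act (wv - s)^-1 (F wv)) =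
      act ((q - p) * (wu - s)^-1) (F wu - F wv) +
      act ((q - p) * ((wu - s)^-1 - (wv - s)^-1)) (F wv).
    rewrite !(actM ID IZ II) (actBl I (wu - s)^-1 (wv - s)^-1) !(actB ID IZ).
    by rewrite addrA subrK.
  have k3 : `|act ((q - p) * (wu - s)^-1) (F wu - F wv)| <= e / 2.
    rewrite (act_norm Inorm) normcM -/l.
    apply: (@le_trans _ _ (A * `|F wu - F wv|)).
      rewrite ler_wpM2r // /A; apply: le_trans (_ : l * rho^-1 <= _); last by rewrite lerDl.
      by rewrite ler_wpM2l // frho.
    by rewrite mulrC -ler_pdivlMr.
  have k4 : `|act ((q - p) * ((wu - s)^-1 - (wv - s)^-1)) (F wv)| <= e / 2.
    have wu0 : wu - s != 0 by rewrite subr_eq0 off.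
    have wv0 : wv - s != 0 by rewrite subr_eq0 off.
    have -> : (wu - s)^-1 - (wv - s)^-1 = (wv - wu) * (wu - s)^-1 * (wv - s)^-1.
      by field; rewrite wu0 wv0.
    have duv : normc (wv - wu) = `|u - v| * l.
      have -> : wv - wu = ((v - u) +i* 0)%C * (q - p).
        by rewrite /wv /wu /seg; case: (p) (q) => ? ? [? ?]; apply/eqP; rewrite eq_complex /=;
          apply/andP; split; apply/eqP; ring.
      by rewrite normcM /normc /= expr0n /= addr0 sqrtr_sqr distrC.
    rewrite (act_norm Inorm) !normcM duv -/l.
    apply: (@le_trans _ _ (B * `|u - v|)).
      apply: (@le_trans _ _ (l * (`|u - v| * l * rho^-1 * rho^-1) * K)).
        apply: ler_pM; rewrite ?mulr_ge0 ?normc_ge0 ?normr_ge0 //; last exact: hK.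
        rewrite ler_wpM2l //; apply: ler_pM; rewrite ?mulr_ge0 ?normc_ge0 ?normr_ge0 ?frho //.
        by rewrite ler_wpM2l ?mulr_ge0 ?frho.
      have -> : l * (`|u - v| * l * rho^-1 * rho^-1) * K = l * (l * rho^-1 * rho^-1 * K) * `|u - v| by ring.
      by rewrite ler_wpM2r // /B lerDl.
    by rewrite mulrC -ler_pdivlMr // ltW.
  by apply: le_trans (ler_normD _ _) _; rewrite (splitr e) lerD.
have cm t : 0 <= t <= 1 -> ccont ((fun w => o * w ^+ m) \o seg p q) t.
  move=> _; apply: ccontM (ccont_cst _ _) _; apply: ccontX; exact: ccont_seg.
have [GV hGV] := edge_prim_exists ID IZ Inorm (econt_mul (u := fun w => o * w ^+ m) ID IZ II Inorm hS cm hF).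
have [d3 d30 hd3] := hGV e e0.
pose d := Num.min (Num.min d1 (e / 2 / B)) d3.
have d0 : 0 < d by rewrite !lt_min d10 d30 divr_gt0.
have [pt [tg Hp]] := tagged_exists ltr01 d0.
pose wi i := seg p q tg`_i.
have tgm i : (i < size tg)%N -> 0 <= tg`_i <= 1.
  move=> hi. exact: (tagged_mem Hp hi).
have exK i : exists KK : 'I_n -> R -> X, (i < size tg)%N ->
   (forall k, prim (fun t => act (c k t ^+ m * c' k t * (wi i - c k t)^-1) (F (wi i))) (KK k) (a k) (b k)) /\
   \sum_(k < n) (KK k (b k) - KK k (a k)) = act (o * wi i ^+ m) (F (wi i)).
  case: (ltnP i (size tg)) => hi; last by exists (fun=> fun=> 0).
  by have [K' hK'] := pole _ (tgm i hi) (F (wi i)); exists K' => _.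
have [KK hKK] := choice exK.
have tp_d (d' : R) : d <= d' -> tagged_part 0 1 pt tg d'.
  move=> dd; case: Hp => h1 [h2 [h3 h4]]; split=> //; split=> //; split=> // i hi.
  have [h5 /andP[h6 h7]] := h4 i hi; split=> //; rewrite h6; exact: lt_le_trans dd.
exists (fun s => \sum_(i < size tg) (pt`_i.+1 - pt`_i) *: f s tg`_i),
  (fun k t => \sum_(i < size tg) (pt`_i.+1 - pt`_i) *: act (q - p) (KK i k t)); split.
- move=> s hs; have uf : ucont (f s) 0 1.
    apply: ucont_actl => //; apply: (econt_mul ID IZ II Inorm (u := fun w => (w - s)^-1) hS _ hF) => t ht.
    exact: ccont_inv (off s hs t ht).
  have [G hG] := prim_construct ltr01 uf.
  have mind0 : 0 < Num.min d1 (e / 2 / B) by rewrite lt_min d10 divr_gt0.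
  have pm := hG e _ mind0 (ltW e0) (fun u v hu hv => fmod s u v hs hu hv).
  have hGp : edge_prim I p q (fun w => act (w - s)^-1 (F w)) G.
    move=> e' e'0; have [d' d'0 hd'] := uf e' e'0; exists d' => //.
    exact: hG (ltW e'0) hd'.
  rewrite (eintE hGp) distrC; have := prim_riemann pm (tp_d _ _).
  by rewrite subr0 mulr1; apply; rewrite ge_min lexx.
- move=> k; have h (i : 'I_(size tg)) : prim (fun t => (pt`_i.+1 - pt`_i) *:
      act (q - p) (act (c k t ^+ m * c' k t * (wi i - c k t)^-1) (F (wi i))))
      (fun t => (pt`_i.+1 - pt`_i) *: act (q - p) (KK i k t)) (a k) (b k).
    by apply: primZ; apply: (prim_actl ID IZ Inorm); have [] := hKK i (ltn_ord i).
  apply: prim_ext (prim_sum (index_enum _) h) => t _ //.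
  rewrite (act_sum ID IZ); apply: eq_bigr => i _; rewrite (actZ IZ) /f; congr (_ *: _).
  by rewrite (actC ID IZ II _ (q - p)) (actM ID IZ II (_ * _)) .
have -> : \sum_(k < n) (\sum_(i < size tg) (pt`_i.+1 - pt`_i) *: act (q - p) (KK i k (b k)) -
      \sum_(i < size tg) (pt`_i.+1 - pt`_i) *: act (q - p) (KK i k (a k))) =
    \sum_(i < size tg) (pt`_i.+1 - pt`_i) *: act (q - p) (act (o * wi i ^+ m) (F (wi i))).
  under eq_bigr do rewrite -sumrB.
  rewrite exchange_big; apply: eq_bigr => i _ /=.
  have [_ <-] := hKK i (ltn_ord i); rewrite (act_sum ID IZ) scaler_sumr; apply: eq_bigr => k _.
  by rewrite (actB ID IZ) scalerBr.
rewrite (eintE hGV); have := prim_riemann hd3 (tp_d _ _).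
by rewrite subr0 mulr1; apply; rewrite ge_min lexx orbT.
Qed.

Lemma weak_contour_chain (ch : chain R) F o (rho : R) : 0 < rho ->
  (forall e, e \in ch -> exists2 S, polyapprox S F & forall t, 0 <= t <= 1 -> S (seg e.2.1 e.2.2 t)) ->
  (forall e, e \in ch -> forall t s, 0 <= t <= 1 -> on_curves s -> rho <= normc (seg e.2.1 e.2.2 t - s)) ->
  (forall e, e \in ch -> forall t, 0 <= t <= 1 -> pole_value (seg e.2.1 e.2.2 t) o) ->
  weak_contour (fun s => csum ch (fun w => act (w - s)^-1 (F w)))
    (csum ch (fun w => act (o * w ^+ m) (F w))).
Proof.
move=> rho0; elim: ch => [|e ch IH] h1 h2 h3.
  rewrite /chain_sum big_nil; under eq_fun do rewrite big_nil.
  exact: weak_contour0.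
under eq_fun do rewrite csum_cons; rewrite csum_cons.
have inT x : x \in ch -> x \in e :: ch by rewrite in_cons orbC => ->.
apply: weak_contourZD; last first.
  by apply: IH => x /inT; [exact: h1|exact: h2|exact: h3].
exact: (weak_contour_edge rho0 (h1 _ (mem_head _ _)) (h2 _ (mem_head _ _)) (h3 _ (mem_head _ _))).
Qed.

Lemma swap_cauchy (Ein Eout : chain R) F (rho : R) (G : 'I_n -> R -> X) : 0 < rho ->
  (forall e, e \in Ein ++ Eout -> exists2 S, polyapprox S F & forall t, 0 <= t <= 1 -> S (seg e.2.1 e.2.2 t)) ->
  (forall e, e \in Ein ++ Eout -> forall t s, 0 <= t <= 1 -> on_curves s -> rho <= normc (seg e.2.1 e.2.2 t - s)) ->
  (forall e, e \in Ein -> forall t, 0 <= t <= 1 -> pole_value (seg e.2.1 e.2.2 t) (- (0 +i* (2 * pi))%C)) ->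
  (forall e, e \in Eout -> forall t, 0 <= t <= 1 -> pole_value (seg e.2.1 e.2.2 t) 0) ->
  (forall s, on_curves s -> csum Ein (fun w => act (w - s)^-1 (F w)) +
    csum Eout (fun w => act (w - s)^-1 (F w)) = act (0 +i* (2 * pi))%C (F s)) ->
  (forall k, prim (fun t => act (c k t ^+ m * c' k t) (F (c k t))) (G k) (a k) (b k)) ->
  \sum_(k < n) (G k (b k) - G k (a k)) = - csum Ein (fun w => act (w ^+ m) (F w)).
Proof.
move=> rho0 h1 h2 h3 h4 h5 hG; set P2 := (0 +i* (2 * pi))%C in h3 h5.
have inl x : x \in Ein -> x \in Ein ++ Eout by rewrite mem_cat => ->.
have inr x : x \in Eout -> x \in Ein ++ Eout by rewrite mem_cat orbC => ->.
have w1 := @weak_contour_chain Ein F (- P2) rho rho0 (fun x hx => h1 x (inl x hx)) (fun x hx => h2 x (inl x hx)) h3.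
have w2 := @weak_contour_chain Eout F 0 rho rho0 (fun x hx => h1 x (inr x hx)) (fun x hx => h2 x (inr x hx)) h4.
have w := weak_contourZD 1 w1 w2.
have hGP k : prim (fun t => act (c k t ^+ m * c' k t) (1 *: csum Ein (fun w => act (w - c k t)^-1 (F w)) +
    csum Eout (fun w => act (w - c k t)^-1 (F w)))) (fun t => act P2 (G k t)) (a k) (b k).
  apply: prim_ext (prim_actl ID IZ Inorm P2 (hG k)) => t ht //.
  have on : on_curves (c k t) by exists k, t.
  by rewrite scale1r (h5 _ on) [RHS](actC ID IZ II).
have e := weak_contour_value w hGP.
have P20 : P2 != 0.
  by rewrite eq_complex /= negb_and mulf_neq0 ?orbT // gt_eqF // pi_gt0.
have ecE : forall e, e \in Ein -> econt e.2.1 e.2.2 (fun w => act (w ^+ m) (F w)).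
  move=> x hx; have [S hS hs] := h1 x (inl x hx).
  apply: (econt_mul ID IZ II Inorm (u := fun w => w ^+ m) hs _ hS) => t _.
  by apply: ccontX; exact: ccont_seg.
have e1 : csum Ein (fun w => act (- P2 * w ^+ m) (F w)) = - act P2 (csum Ein (fun w => act (w ^+ m) (F w))).
  rewrite -actNl -(csum_act ID IZ II Inorm _ ecE); apply: csum_ext => x hx t ht.
  by rewrite (actM ID IZ II).
have e2 : csum Eout (fun w => act (0 * w ^+ m) (F w)) = 0.
  have z : csum Eout (fun w => act 0 (F w)) = act 0 (csum Eout F).
    apply: (csum_act ID IZ II Inorm) => x hx; have [S hS hs] := h1 x (inr x hx).
    exact: (econt_approx ID IZ II Inorm hs hS).
  by rewrite -[RHS](act0l I (csum Eout F)) -z; apply: csum_ext => x hx t ht; rewrite mul0r.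
move: e; rewrite e1 e2 scale1r addr0.
have -> : \sum_(k < n) (act P2 (G k (b k)) - act P2 (G k (a k))) = act P2 (\sum_(k < n) (G k (b k) - G k (a k))).
  by rewrite (act_sum ID IZ); apply: eq_bigr => k _; rewrite (actB ID IZ).
move=> /(congr1 (act P2^-1)); rewrite (actN IZ).
by rewrite !(actK ID IZ II).
Qed.

End Swap.

(** * Winding numbers of Jordan curves *)

Section Curves.
Variables (R : realType).
Local Notation C := (R[i]).
Local Notation Re := (@complex.Re R).
Local Notation Im := (@complex.Im R).

Definition cz (k : pcurve R) (t : R) : C := (cx k t +i* cy k t)%C.
Definition cz' (k : pcurve R) (t : R) : C := (derive1 (cx k) t +i* derive1 (cy k) t)%C.

Variables (k : pcurve R).
Hypothesis hk : C1_jordan k.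

Lemma jordan_ab : ca k < cb k. Proof. by case: hk. Qed.

Lemma cz_closed : cz k (cb k) = cz k (ca k).
Proof. by case: hk => [_ [_ [_ [_ [_ [h1 [h2 _]]]]]]]; rewrite /cz h1 h2. Qed.

Lemma cz_der t : cder (cz k) (cz' k) t.
Proof.
case: hk => _ [h1 [h2 _]]; split => /=; rewrite derive1E; exact/derivableP.
Qed.

Lemma cz'_cont t : ccont (cz' k) t.
Proof. by case: hk => _ [_ [_ [h1 [h2 _]]]]; split; [exact: h1|exact: h2]. Qed.

Lemma wind_integrandE (w : C) t :
  wind_integrand k (Re w, Im w) t = Im ((cz k t - w)^-1 * cz' k t).
Proof.
rewrite /wind_integrand /cz /cz' /=; case: w => a b /=.
set n := (_ ^+ 2 + _); ring.
Qed.

Lemma off_curve_ne (w : C) t : ~ curve_img k (Re w, Im w) -> ca k <= t <= cb k -> cz k t != w.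
Proof.
move=> h ht; apply/eqP => e; apply: h; exists t => //.
by rewrite -e.
Qed.

Section Index.
Variables (w : C) (wk : R).
Hypothesis off : ~ curve_img k (Re w, Im w).
Hypothesis hr : is_rint (wind_integrand k (Re w, Im w)) (ca k) (cb k) wk.

Lemma log_der_cont t : ca k <= t <= cb k -> ccont (fun t => (cz k t - w)^-1 * cz' k t) t.
Proof.
move=> ht; apply: ccontM (cz'_cont t); apply: ccontV.
  exact: ccontD (cder_cont (cz_der t)) (ccont_cst (- w) t).
by rewrite subr_eq0 off_curve_ne.
Qed.

(** The prescribed Riemann integral and the increment of a primitive are limits of the same sums. *)
Lemma wind_prim : exists2 W : R -> R,
  prim (fun t => Im ((cz k t - w)^-1 * cz' k t)) W (ca k) (cb k) & W (cb k) - W (ca k) = wk.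
Proof.
have uc : ucont (fun t => Im ((cz k t - w)^-1 * cz' k t)) (ca k) (cb k).
  by apply: ucont_continuous => t /log_der_cont[].
have [W hW] := prim_exists jordan_ab uc; exists W => //.
apply/eqP; rewrite -subr_eq0 -normr_le0; apply/ler_addgt0Pr => e e0; rewrite add0r.
have ba : 0 < cb k - ca k by rewrite subr_gt0 jordan_ab.
have e2 : 0 < e / 2 by rewrite divr_gt0.
have [d1 d10 h1] := hW _ (divr_gt0 e2 ba).
have [d2 d20 h2] := hr e2.
have d0 : 0 < Num.min d1 d2 by rewrite lt_min d10.
have [p [tg Hp]] := tagged_exists jordan_ab d0.
have sub (d : R) : Num.min d1 d2 <= d -> tagged_part (ca k) (cb k) p tg d.
  move=> dd; case: Hp => q1 [q2 [q3 q4]]; split=> //; split=> //; split=> // i hi.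
  have [h5 /andP[h6 h7]] := q4 i hi; split=> //; rewrite h6; exact: lt_le_trans dd.
have := prim_riemann h1 (sub _ _); rewrite ge_min lexx => /(_ isT).
rewrite divfK ?gt_eqF //.
have := h2 _ _ (sub _ _); rewrite ge_min lexx orbT => /(_ isT).
under eq_bigr do rewrite wind_integrandE.
set S1 := (X in `|X - wk|); rewrite -[X in `|X - (_ - _)|]/S1 => k1 k2.
have -> : W (cb k) - W (ca k) - wk = (S1 - wk) - (S1 - (W (cb k) - W (ca k))) by ring.
apply: le_trans (ler_normB _ _) _; rewrite (splitr e) lerD //; exact: ltW.
Qed.

Variables (X : completeNormedModType R) (I : X -> X).
Local Notation act := (cact I).

(** The logarithm of the modulus returns to its value along a closed curve, so the winding number is
    all that remains. *)
Lemma log_der_prim y : exists2 K,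
  prim (fun t => act ((cz k t - w)^-1 * cz' k t) y) K (ca k) (cb k) &
  K (cb k) - K (ca k) = act (0 +i* wk)%C y.
Proof.
have hx (u : X) (f f' : R -> R) : prim f' f (ca k) (cb k) ->
    prim (fun t => f' t *: u) (fun t => f t *: u) (ca k) (cb k).
  move=> hf; apply: (@prim_lin R R X (fun r => r *: u) `|u|) hf => [r s|r s|r].
  - exact: scalerDl.
  - by rewrite scalerA.
  - by rewrite normrZ mulrC.
have [W hW eW] := wind_prim.
exists (fun t => lnsq w (cz k t) *: y + W t *: I y); last first.
  rewrite cz_closed -eW /cact /= scale0r add0r scalerBl opprD addrACA subrr add0r //.
apply: primD; apply: hx => //; apply: prim_derive => [t ht|].
  by apply: lnsq_derive (cz_der t) _; exact: off_curve_ne.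
by apply: ucont_continuous => t /log_der_cont[].
Qed.

End Index.

Section Closed.
Variables (X : completeNormedModType R) (I : X -> X).
Local Notation act := (cact I).

Lemma horner_prim (p : {poly C}) y : exists2 K,
  prim (fun t => act (p.[cz k t] * cz' k t) y) K (ca k) (cb k) & K (cb k) - K (ca k) = 0.
Proof.
have [P dP] := poly_primitive p.
exists (fun t => act P.[cz k t] y); last by rewrite cz_closed subrr.
apply: prim_act => t ht.
  by apply: cder_ext (cder_horner P (cz_der t)) => //; rewrite dP.
apply: ccontM (cz'_cont t); apply: ccont_horner; exact: cder_cont (cz_der t).
Qed.

End Closed.
End Curves.

Section PoleValue.
Variables (R : realType) (X : completeNormedModType R) (I : X -> X).
Local Notation C := (R[i]).
Local Notation Re := (@complex.Re R).
Local Notation Im := (@complex.Im R).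
Hypothesis ID : forall x y, I (x + y) = I x + I y.
Hypothesis IZ : forall (a : R) x, I (a *: x) = a *: I x.
Hypothesis II : forall x, I (I x) = - x.
Hypothesis Inorm : forall (a b : R) x, `|a *: x + b *: I x| = Num.sqrt (a ^+ 2 + b ^+ 2) * `|x|.
Local Notation act := (cact I).

(** Writing [z^m = w^m + q(z)(z - w)], the polynomial [q] integrates to zero over closed curves and
    the other term yields the winding numbers. *)
Lemma pole_value_index (n : nat) (cs : 'I_n -> pcurve R) (m : nat) (w : C) (wk : 'I_n -> R) :
  (forall k, C1_jordan (cs k)) -> (forall k, ~ curve_img (cs k) (Re w, Im w)) ->
  (forall k, is_rint (wind_integrand (cs k) (Re w, Im w)) (ca (cs k)) (cb (cs k)) (wk k)) ->
  pole_value I (fun k => cz (cs k)) (fun k => cz' (cs k)) (fun k => ca (cs k)) (fun k => cb (cs k))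
    m w (- (0 +i* (\sum_(k < n) wk k))%C).
Proof.
move=> hcs off hr y.
have [q qE] : exists q : {poly C}, 'X^m - (w ^+ m)%:P = q * ('X - w%:P).
  by apply/factor_theorem; rewrite /root !hornerE subrr.
have [K1 hK1] := choice (fun k => let: ex_intro2 K a b := horner_prim (hcs k) I q y in ex_intro _ K (conj a b)).
have [K2 hK2] := choice (fun k => let: ex_intro2 K a b := log_der_prim (hcs k) (off k) (hr k) I y in ex_intro _ K (conj a b)).
exists (fun k t => (-1) *: (K1 k t + act (w ^+ m) (K2 k t))); split=> [k|].
  apply: prim_ext (primZ (-1) (primD (hK1 k).1 (prim_actl ID IZ Inorm (w ^+ m) (hK2 k).1))) => t ht //.
  rewrite -(actM ID IZ II) -actDl scaleN1r -actNl; congr (act _ y).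
  have n0 : cz (cs k) t != w := off_curve_ne (off k) ht.
  have qc : q.[cz (cs k) t] = (cz (cs k) t ^+ m - w ^+ m) / (cz (cs k) t - w).
    have := congr1 (fun p => p.[cz (cs k) t]) qE; rewrite !hornerE => ->.
    by rewrite mulfK // subr_eq0.
  rewrite qc; move: n0; move: (cz _ _) (cz' _ _) => z z'; move: (z ^+ m) (w ^+ m) => zm wm n0.
  field; rewrite !subr_eq0 n0 eq_sym n0 //.
rewrite (eq_bigr (fun k => act (- (w ^+ m * (0 +i* wk k)%C)) y)); last first.
  move=> k _; rewrite -!scalerBr opprD addrACA (hK1 k).2 add0r -(actB ID IZ) (hK2 k).2.
  by rewrite -(actM ID IZ II) scaleN1r actNl.
rewrite -act_suml; congr (act _ y).
have -> : (0 +i* \sum_(k < n) wk k)%C = \sum_(k < n) (0 +i* wk k)%C :> C.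
  elim/big_rec2: _ => [//|k x s _ <-]; by apply/eqP; rewrite eq_complex /= add0r !eqxx.
by rewrite sumrN -mulr_sumr mulNr mulrC.
Qed.

End PoleValue.

Section Winding.
Variables (R : realType).
Local Notation C := (R[i]).
Local Notation Re := (@complex.Re R).
Local Notation Im := (@complex.Im R).

Lemma is_derive_arg (z z' : R -> C) t : cder z z' t -> 0 < Re (z t) ->
  is_derive t 1 (fun u => atan (Im (z u) / Re (z u))) (Im ((z t)^-1 * z' t)).
Proof.
move=> [d1 d2] r0; have r1 := lt0r_neq0 r0.
have d3 := is_deriveM d2 (is_deriveV r1 d1).
have d := @is_derive1_comp _ atan _ t _ _ (is_derive1_atan _) d3.
apply: (is_derive_ext _ _ d) => [u //|].
rewrite !fctE /GRing.scale /=; move: r1; case: (z t) (z' t) => a b [c e] /= a0.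
have n0 : a ^+ 2 + b ^+ 2 != 0.
  by rewrite gt_eqF // ltr_pwDl ?sqr_ge0 // exprn_even_gt0.
have n1 : 1 + (b * a^-1) ^+ 2 != 0 by rewrite gt_eqF // ltr_pwDl // sqr_ge0.
have n2 : b ^+ 2 + a ^+ 2 != 0 by rewrite addrC.
by field; rewrite a0 ?n0 -?expr2 ?n2.
Qed.

Variables (k : pcurve R).
Hypothesis hk : C1_jordan k.
Local Notation a := (ca k).
Local Notation b := (cb k).

Definition logd (w : C) t := (cz k t - w)^-1 * cz' k t.

Definition wnd (w : C) (r : R) :=
  exists2 W : R -> R, prim (fun t => Im (logd w t)) W a b & W b - W a = r.

Definition off (w : C) := ~ curve_img k (Re w, Im w).

Lemma wnd_exists w : off w -> exists r, wnd w r.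
Proof.
move=> ow; have uc : ucont (fun t => Im (logd w t)) a b.
  by apply: ucont_continuous => t /(log_der_cont hk ow)[].
by have [W hW] := prim_exists (jordan_ab hk) uc; exists (W b - W a), W.
Qed.

(* [(c - w') / (c - w)] stays in the right half plane, where the argument has no monodromy *)
Lemma wnd_local w w' r : (forall t, a <= t <= b -> normc (w - w') < normc (cz k t - w)) ->
  wnd w r -> wnd w' r.
Proof.
move=> near [W hW <-].
have n0 t : a <= t <= b -> cz k t - w != 0.
  move=> /near; apply: contraTneq => ->; rewrite normc0 -leNgt; exact: normc_ge0.
have n1 t : a <= t <= b -> cz k t - w' != 0.
  move=> /near; apply: contraTneq => /eqP; rewrite subr_eq0 => /eqP ->.
  by rewrite -normcN opprB ltxx.
pose u t := (cz k t - w') * (cz k t - w)^-1.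
have dsub v t : cder (fun t => cz k t - v) (cz' k) t.
  by apply: cder_ext (cderD (cz_der hk t) (cder_cst (- v) t)) => //=; rewrite addr0.
pose u' t := cz' k t * (cz k t - w)^-1 + (cz k t - w') * (- (cz' k t * (cz k t - w)^-1 * (cz k t - w)^-1)).
have du t : a <= t <= b -> cder u u' t.
  move=> ht; exact: (cderM (dsub w' t) (cderV (dsub w t) (n0 t ht))).
have Ru t : a <= t <= b -> 0 < Re (u t).
  move=> ht; have -> : u t = 1 + (w - w') * (cz k t - w)^-1.
    by rewrite /u; move: (n0 t ht) => h; field.
  have := Re_le_normc ((w - w') * (cz k t - w)^-1).
  have : normc ((w - w') * (cz k t - w)^-1) < 1.
    rewrite normcM normcV ltr_pdivrMr ?mul1r ?near //.
    exact: le_lt_trans (normc_ge0 _) (near t ht).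
  case: (_ * _) => p q /= h1 h2; have := ler_norm (- p); rewrite normrN; lra.
have uE t : a <= t <= b -> (u t)^-1 * u' t = logd w' t - logd w t.
  move=> ht; rewrite /logd /u /u'; move: (n0 t ht) (n1 t ht).
  by move: (cz k t) (cz' k t) => z z' h0 h1; field; rewrite h0 h1.
exists (fun t => W t + atan (Im (u t) / Re (u t))); last first.
  by rewrite /u (cz_closed hk); ring.
have pa : prim (fun t => Im ((u t)^-1 * u' t)) (fun t => atan (Im (u t) / Re (u t))) a b.
  apply: prim_derive => [t ht|]; first exact: (is_derive_arg (du t ht) (Ru t ht)).
  apply: ucont_continuous => t ht.
  have [_ h] : ccont (fun t => (u t)^-1 * u' t) t.
    have cs v := cder_cont (dsub v t).
    apply: ccontM; first by apply: ccontV (cder_cont (du t ht)) _; rewrite mulf_neq0 ?invr_eq0 ?n0 ?n1.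
    have cv := ccontV (cs w) (n0 t ht).
    apply: ccontD; first exact: ccontM (cz'_cont hk t) cv.
    apply: ccontM (cs w') _; apply: ccontN; exact: ccontM (ccontM (cz'_cont hk t) cv) cv.
  exact: h.
apply: prim_ext (primD hW pa) => t ht //=.
by rewrite (uE t ht) raddfB /= subrKC.
Qed.

Lemma offP w : (forall t, a <= t <= b -> cz k t != w) -> off w.
Proof. by move=> hw [t ht e]; have := hw t ht; rewrite /cz; case: w {hw} e => ? ? [-> ->] /=; rewrite eqxx. Qed.

Lemma off_far w x y : (forall t, x <= t <= y -> cz k t != w) ->
  exists2 e : R, 0 < e & forall t, x <= t <= y -> e <= normc (cz k t - w).
Proof.
move=> hw; have n0 t : x <= t <= y -> cz k t - w != 0 by rewrite subr_eq0; exact: hw.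
have [t ht|M M0 hM] := @ccont_bounded R (fun t => (cz k t - w)^-1) x y.
  by apply: ccontV (ccontD (cder_cont (cz_der hk t)) (ccont_cst (- w) t)) _; exact: n0.
exists M^-1; first by rewrite invr_gt0.
move=> t ht; have := hM t ht; rewrite normcV -[X in _ <= X -> _]invrK lef_pV2 ?posrE ?invr_gt0 //.
by rewrite lt_neqAle normc_ge0 andbT eq_sym; apply: contra (n0 t ht) => /eqP /eq0_normc ->.
Qed.

Lemma off_nbhs w : off w -> exists2 e : R, 0 < e & forall w', normc (w - w') < e ->
  off w' /\ forall r, wnd w r <-> wnd w' r.
Proof.
move=> ow; have [e e0 he] := off_far (fun t => off_curve_ne ow (t := t)).
exists (e / 2); first by rewrite divr_gt0.
move=> w' hw; have far t : a <= t <= b -> e / 2 <= normc (cz k t - w').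
  move=> /he h; have := le_normcD (cz k t - w') (w' - w); rewrite subrKA.
  have : normc (w' - w) < e / 2 by rewrite -normcN opprB.
  lra.
have e20 : 0 < e / 2 by rewrite divr_gt0.
split; first by apply: offP => t /far; apply: contraTneq => ->; rewrite subrr normc0 -ltNge.
move=> r; split; apply: wnd_local => t ht.
  by apply: lt_le_trans hw (le_trans _ (he t ht)); rewrite ler_pdivrMr // ler_pMr // ler1n.
by apply: lt_le_trans (far t ht); rewrite -normcN opprB.
Qed.

(** By [off_nbhs] the points where the winding number is [r] and those where it is not both form
    open sets off the curve. *)
Lemma wnd_const (D : set (R * R)) z1 z2 r : open D -> connected D ->
  (forall z, D z -> ~ curve_img k z) -> D z1 -> D z2 ->
  wnd (z1.1 +i* z1.2)%C r -> wnd (z2.1 +i* z2.2)%C r.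
Proof.
move=> oD cD dis D1 D2 h1; pose toC (z : R * R) : C := (z.1 +i* z.2)%C.
have offD z : D z -> off (toC z) by case: z => x y /dis.
have loc (P : set (R * R)) : (forall z z', off (toC z) -> off (toC z') ->
    (forall r, wnd (toC z) r <-> wnd (toC z') r) -> P z -> P z') -> open [set z | off (toC z) /\ P z].
  move=> hP; rewrite openE => z [oz Pz]; have [e e0 he] := off_nbhs oz.
  apply/nbhs_ballP; exists (e / 2) => /=; first by rewrite divr_gt0.
  move=> z' [/= b1 b2]; have [f1 f2] : (off (toC z') /\ forall r, wnd (toC z) r <-> wnd (toC z') r).
    apply: he; apply: le_lt_trans (normc_le_sum _) _; rewrite (splitr e).
    by rewrite ltrD.
  by split => //; apply: hP Pz.
suff E : D = D `&` [set z | off (toC z) /\ wnd (toC z) r] by move: D2; rewrite {1}E => -[_ []].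
apply/esym/cD.
- by exists z1; split => //; split => //; apply: offD.
- eexists; last by []; apply: loc => z z' _ _ h; exact: (h r).1.
exists (~` [set z | off (toC z) /\ ~ wnd (toC z) r]).
  apply: open_closedC; apply: loc => z z' _ _ h h' h''; exact: (h' ((h r).2 h'')).
apply/seteqP; split=> z [Dz hz]; split => //.
  by move=> [_]; apply; case: hz.
split; first exact: offD.
by apply: contrapT => h; apply: hz; split => //; exact: offD.
Qed.

End Winding.

Section Family.
Variables (R : realType).
Local Notation C := (R[i]).
Local Notation Re := (@complex.Re R).
Local Notation Im := (@complex.Im R).

Lemma normcB_ge (x y : C) : normc x - normc y <= normc (x - y).
Proof. by have := le_normcD (x - y) y; rewrite subrK; lra. Qed.

Lemma cz_ccont (k : pcurve R) t : C1_jordan k -> ccont (cz k) t.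
Proof. by move=> hk; exact: cder_cont (cz_der hk t). Qed.

Lemma wnd_bound (k : pcurve R) (w : C) (r M rho : R) : C1_jordan k -> 0 < rho ->
  (forall t, ca k <= t <= cb k -> rho <= normc (cz k t - w)) ->
  (forall t, ca k <= t <= cb k -> normc (cz' k t) <= M) ->
  wnd k w r -> `|r| <= M / rho * (cb k - ca k).
Proof.
move=> hk rho0 far hM [W hW <-]; apply: (prim_bound (ltW (jordan_ab hk)) hW) => t ht.
apply: le_trans (Im_le_normc _) _; rewrite /logd normcM normcV mulrC.
apply: ler_pM; rewrite ?invr_ge0 ?normc_ge0 ?hM // lef_pV2 ?posrE ?far //.
exact: lt_le_trans (far t ht).
Qed.

Variables (n : nat) (cs : 'I_n -> pcurve R) (D : set (R * R)).
Hypothesis Hcs : pos_bdry_param D cs.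
Hypothesis oD : open D.
Local Notation toC z := ((z.1 +i* z.2)%C : C).

Lemma fam_jordan k : C1_jordan (cs k). Proof. by case: Hcs. Qed.

Lemma open_not_bdry z : D z -> ~ bdry D z.
Proof. by move=> Dz [_]; apply; move: oD; rewrite openE => /(_ z Dz). Qed.

Lemma curve_bdry k z : curve_img (cs k) z -> bdry D z.
Proof. by case: Hcs => _ [-> _] h; exists k. Qed.

Lemma curve_notD k t : ca (cs k) <= t <= cb (cs k) -> ~ D (cx (cs k) t, cy (cs k) t).
Proof. by move=> ht /open_not_bdry nb; apply: nb; apply: (@curve_bdry k); exists t. Qed.

Lemma fam_bounded : exists2 M : R, 0 < M & forall k t, ca (cs k) <= t <= cb (cs k) ->
  normc (cz (cs k) t) <= M /\ normc (cz' (cs k) t) <= M.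
Proof.
have h k : exists M : R, 0 < M /\ forall t, ca (cs k) <= t <= cb (cs k) ->
    normc (cz (cs k) t) <= M /\ normc (cz' (cs k) t) <= M.
  have [t _|M1 M10 h1] := @ccont_bounded R (cz (cs k)) (ca (cs k)) (cb (cs k)).
    exact: cz_ccont (fam_jordan k).
  have [t _|M2 M20 h2] := @ccont_bounded R (cz' (cs k)) (ca (cs k)) (cb (cs k)).
    exact: cz'_cont (fam_jordan k) t.
  exists (M1 + M2); split=> [|t ht]; first by rewrite addr_gt0.
  by split; [apply: le_trans (h1 t ht) _; rewrite lerDl ltW|apply: le_trans (h2 t ht) _; rewrite lerDr ltW].
have [M hM] := choice h; exists (\sum_k M k + 1) => [|k t ht].
  by rewrite ltr_wpDl // sumr_ge0 // => k _; apply/ltW/(hM k).1.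
have le : M k <= \sum_k M k + 1.
  rewrite (bigD1 k) //= -addrA lerDl addr_ge0 // sumr_ge0 // => j _; exact/ltW/(hM j).1.
by have [h1 h2] := (hM k).2 t ht; split; apply: le_trans le.
Qed.

Lemma fam_wnd z : ~ bdry D z -> exists wk : 'I_n -> R,
  (forall k, wnd (cs k) (toC z) (wk k)) /\
  \sum_(k < n) wk k = (if pselect (D z) then 2 * pi else 0).
Proof.
move=> nz; case: (Hcs) => _ [_ /(_ z nz)[wk [h1 h2]]]; exists wk; split => // k.
apply: (wind_prim (w := toC z) (fam_jordan k)); last by case: (z) (h1 k).
by move=> /= h; apply: nz; case: z h {h1 h2} => x y; exact: curve_bdry.
Qed.

(** The winding numbers sum to [2 pi] at each point of [D], but far from the curves the integrand
    bound forces the sum below 1. The distance [M S + 1] beyond the radius [M] suffices. *)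
Lemma D_bounded : exists2 L : R, 0 < L & forall z, D z -> `|z.1| < L /\ `|z.2| < L.
Proof.
have [M M0 hM] := fam_bounded.
pose S := \sum_(k < n) (cb (cs k) - ca (cs k)).
have S0 : 0 <= S by apply: sumr_ge0 => k _; rewrite subr_ge0; apply/ltW/jordan_ab; exact: fam_jordan.
pose rho := M * S + 1; have rho0 : 0 < rho by rewrite ltr_wpDl // mulr_ge0 // ltW.
exists (M + rho); first exact: addr_gt0.
move=> z Dz; suff h : normc (toC z) < M + rho.
  by have := Re_le_normc (toC z); have := Im_le_normc (toC z) => /= h1 h2; split; apply: le_lt_trans h.
rewrite ltNge; apply/negP => far.
have [wk [h1 h2]] := fam_wnd (open_not_bdry Dz); move: h2; case: pselect => [_|//] /= h2.
have : `|\sum_(k < n) wk k| <= \sum_(k < n) (M / rho * (cb (cs k) - ca (cs k))).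
  apply: le_trans (ler_norm_sum _ _ _) _; apply: ler_sum => k _.
  apply: (wnd_bound (fam_jordan k) rho0 _ _ (h1 k)) => t ht; last by have [] := hM k t ht.
  rewrite -normcN opprB; apply: le_trans (normcB_ge _ _).
  have [] := hM k t ht; lra.
rewrite -mulr_sumr -/S h2 => h.
have : M / rho * S < 1 by rewrite mulrAC ltr_pdivrMr // mul1r /rho ltrDl.
have := ler_norm (2 * pi : R); have := pi_ge2 R; lra.
Qed.

Lemma path_far p q : (forall t, 0 <= t <= 1 -> D (Re (seg p q t), Im (seg p q t))) ->
  exists2 rho : R, 0 < rho & forall t s, 0 <= t <= 1 -> ~ D (Re s, Im s) ->
    rho <= normc (seg p q t - s).
Proof.
move=> hD; pose l := normc (q - p) + 1.
have l0 : 0 < l by rewrite ltr_wpDl // normc_ge0.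
have [|d d' x /andP[d0 dd] h s hs|x hx|d d0 hd] := @compact_uniform R R `[0, 1]%classic
    (fun d t => forall s, ~ D (Re s, Im s) -> d <= normc (seg p q t - s)).
- exact: segment_compact.
- exact: le_trans (h s hs).
- have hx' : 0 <= x <= 1 by move: hx; rewrite /= in_itv.
  have := hD x hx'; move: oD; rewrite openE => /[apply] /nbhs_ballP[e /= e0 he].
  have e2 : 0 < e / 2 by rewrite divr_gt0.
  exists (Num.min (e / 2) (e / 2 / l)); first by rewrite lt_min e2 divr_gt0.
  move=> y hy; rewrite /ball /= lt_min => /andP[_ xy] s hs.
  have h1 : e <= normc (seg p q x - s).
    rewrite leNgt; apply/negP => h; apply: hs; apply: he; split; rewrite /ball /=.
      by have := Re_le_normc (seg p q x - s); rewrite raddfB /= => h'; exact: le_lt_trans h' h.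
    by have := Im_le_normc (seg p q x - s); rewrite raddfB /= => h'; exact: le_lt_trans h' h.
  have h2 : normc (seg p q x - seg p q y) <= e / 2.
    have -> : seg p q x - seg p q y = ((x - y) +i* 0)%C * (q - p).
      by rewrite /seg; case: (p) (q) => ? ? [? ?]; apply/eqP; rewrite eq_complex /=;
        apply/andP; split; apply/eqP; ring.
    rewrite normcM /normc /= expr0n /= addr0 sqrtr_sqr -/(normc _).
    move: xy; rewrite ltr_pdivlMr // => /ltW; apply: le_trans.
    by rewrite ler_wpM2l // /l lerDl.
  have := normcB_ge (seg p q x - s) (seg p q x - seg p q y).
  have -> : seg p q x - s - (seg p q x - seg p q y) = seg p q y - s by ring.
  move=> h3.
  by rewrite ge_min; apply/orP; left; lra.
by exists d => // t s ht; apply: hd; rewrite /= in_itv.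
Qed.

Lemma chain_far (ch : chain R) : (forall e, e \in ch -> forall t, 0 <= t <= 1 ->
    D (Re (seg e.2.1 e.2.2 t), Im (seg e.2.1 e.2.2 t))) ->
  exists2 rho : R, 0 < rho & forall e, e \in ch -> forall t s, 0 <= t <= 1 -> ~ D (Re s, Im s) ->
    rho <= normc (seg e.2.1 e.2.2 t - s).
Proof.
elim: ch => [|e ch IH] h; first by exists 1.
have [r1 r10 h1] := path_far (h e (mem_head _ _)).
have [x hx|r2 r20 h2] := IH; first by apply: h; rewrite in_cons hx orbT.
exists (Num.min r1 r2); first by rewrite lt_min r10.
move=> x; rewrite in_cons => /orP[/eqP ->|hx] t s ht hs; rewrite ge_min; apply/orP.
  by left; apply: h1.
by right; apply: h2.
Qed.

End Family.

Ltac ilra := repeat match goal with H : is_true (_ && _) |- _ => case/andP: H => ? ? end;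
  try (apply/andP; split); lra.

(** * Jump of the winding number across a real arc *)

Section RealArc.
Variables (R : realType).
Local Notation C := (R[i]).
Local Notation Im := (@complex.Im R).

(** A continuous injective function on an interval is strictly monotone, so the end values lie on
    opposite sides of the middle one. *)
Lemma inj_opposite (f : R -> R) t0 t1 t2 : t0 < t1 -> t1 < t2 ->
  (forall t, {for t, continuous f}) ->
  (forall t u, t0 <= t <= t2 -> t0 <= u <= t2 -> f t = f u -> t = u) ->
  (f t0 - f t1) * (f t2 - f t1) < 0.
Proof.
move=> h01 h12 cf inj.
have m0 : t0 <= t0 <= t2 by rewrite lexx ltW // (lt_trans h01).
have m1 : t0 <= t1 <= t2 by rewrite !ltW.
have m2 : t0 <= t2 <= t2 by rewrite lexx ltW // (lt_trans h01).
have mono := @itv_continuous_inj_mono R f `[t0, t2].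
case: mono => [||inc|dec].
- by apply: continuous_subspaceT => t; exact: cf.
- by move=> t u; rewrite !in_itv; exact: inj.
- have k1 : f t0 < f t1 by rewrite inc ?in_itv.
  have k2 : f t1 < f t2 by rewrite inc ?in_itv.
  by rewrite nmulr_rlt0 ?subr_gt0 // subr_lt0.
have k1 : f t1 < f t0 by rewrite dec ?in_itv.
have k2 : f t2 < f t1 by rewrite dec ?in_itv.
by rewrite pmulr_rlt0 ?subr_gt0 // subr_lt0.
Qed.

(** Each arctangent has absolute value at least [pi / 4], and their signs are opposite. *)
Lemma atan_opposite (A B : R) : 1 <= `|A| -> 1 <= `|B| -> A * B < 0 ->
  pi / 2 <= `|atan A - atan B|.
Proof.
have key x y : 1 <= x -> y <= -1 -> pi / 2 <= `|atan x - atan y| :> R.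
  move=> hx hy; have := @le_atan R _ _ hx; have := @le_atan R _ _ hy.
  by rewrite atanN atan1 => h1 h2; apply: le_trans (ler_norm _); lra.
move=> hA hB AB; have [a0|a0] := leP 0 A; have [b0|b0] := leP 0 B.
- by move: AB; rewrite ltNge mulr_ge0.
- by apply: key; [rewrite -(ger0_norm a0)|rewrite lerNr -(ltr0_norm b0)].
- by rewrite distrC; apply: key; [rewrite -(ger0_norm b0)|rewrite lerNr -(ltr0_norm a0)].
by move: AB; rewrite ltNge mulr_le0 // ltW.
Qed.

Variables (k : pcurve R) (t0 t1 t2 : R).
Hypothesis hk : C1_jordan k.
Hypotheses (h0 : ca k < t0) (h01 : t0 < t1) (h12 : t1 < t2) (h2 : t2 < cb k).
Hypothesis real : forall t, t0 <= t <= t2 -> cy k t = 0.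
Local Notation a := (ca k).
Local Notation b := (cb k).
Local Notation x1 := (cx k t1).

Let inj t u : a <= t < b -> a <= u < b -> cz k t = cz k u -> t = u.
Proof.
by case: hk => _ [_ [_ [_ [_ [_ [_ h]]]]]] ht hu [e1 e2]; apply: h => //; rewrite e1 e2.
Qed.

Let czr t : t0 <= t <= t2 -> cz k t = (cx k t +i* 0)%C.
Proof. by move=> ht; rewrite /cz real. Qed.

(** Injectivity is available on the half-open parameter interval; at the end point [b] the curve
    closes up, so it is compared through [a]. *)
Let avoid t : a <= t <= b -> t <= t0 \/ t2 <= t -> cz k t != (x1 +i* 0)%C.
Proof.
move=> /andP[at_ tb] out; rewrite -(czr (t := t1)); last by rewrite !ltW.
have m1 : a <= t1 < b.
  by rewrite (lt_trans h12 h2) andbT ltW // (lt_trans h0).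
apply/eqP => e; move: tb; rewrite le_eqVlt => /orP[/eqP tb|tb].
  have ma : a <= a < b by rewrite lexx jordan_ab.
  have e' : cz k a = cz k t1 by rewrite -(cz_closed hk) -tb.
  have tt := inj ma m1 e'; move: h0 h01; rewrite -tt => p1 p2; lra.
have mt : a <= t < b by rewrite at_.
by have := inj mt m1 e => tt; move: out h01 h12; rewrite tt => -[]; lra.
Qed.

(* crossing the arc changes the winding number by [2 pi] *)
Lemma real_arc_jump : exists2 eta0 : R, 0 < eta0 & forall eta r, 0 < eta < eta0 ->
  wnd k (x1 +i* eta)%C r -> wnd k (x1 +i* - eta)%C r -> False.
Proof.
have ab := jordan_ab hk.
have at0 : a <= t0 by rewrite ltW.
have t2b : t2 <= b by rewrite ltW.
have t02 : t0 < t2 := lt_trans h01 h12.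
have t2b' := h2.
have [e1 e10 f1] : exists2 e : R, 0 < e & forall t, a <= t <= t0 -> e <= normc (cz k t - (x1 +i* 0)%C).
  by apply: off_far => // t /andP[i1 i2]; apply: avoid; [ilra|left].
have [e2 e20 f2] : exists2 e : R, 0 < e & forall t, t2 <= t <= b -> e <= normc (cz k t - (x1 +i* 0)%C).
  by apply: off_far => // t /andP[i1 i2]; apply: avoid; [ilra|right].
pose e := Num.min e1 e2; have e0 : 0 < e by rewrite lt_min e10.
have fr t : a <= t <= t0 \/ t2 <= t <= b -> e <= normc (cz k t - (x1 +i* 0)%C).
  by rewrite ge_min => -[ht|ht]; rewrite ?(f1 t ht) ?(f2 t ht) ?orbT.
have [t _|M M0 hM] := @ccont_bounded R (cz' k) a b; first exact: cz'_cont.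
have opp : (cx k t0 - x1) * (cx k t2 - x1) < 0.
  apply: inj_opposite => // [t|t u ht hu e'].
    by have [] := cz_ccont t hk.
  by apply: inj; [ilra|ilra|rewrite !czr // e'].
have g0 : 0 < `|cx k t0 - x1| by rewrite normr_gt0; apply: contraTneq opp => ->; rewrite mul0r ltxx.
have g2 : 0 < `|cx k t2 - x1| by rewrite normr_gt0; apply: contraTneq opp => ->; rewrite mulr0 ltxx.
(* Off the arc both poles are at distance at least [e / 2], so the logarithmic derivatives differ by
   at most [M (2 eta)] over the square of [e / 2], which explains the 8. Integrated, the rest of the
   curve contributes at most [eta K]. *)
pose K := M * 8 / e / e * (b - a).
have K0 : 0 < K by rewrite !mulr_gt0 ?invr_gt0 ?subr_gt0.
(* [eta] is kept below the distances of the ends of the arc from [x1], to use [atan_opposite]; below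
   [e / 2], to keep the poles off the rest; and below [pi / K]. *)
exists (Num.min (Num.min `|cx k t0 - x1| `|cx k t2 - x1|) (Num.min (e / 2) (pi / K))).
  by rewrite !lt_min g0 g2 !divr_gt0 ?pi_gt0.
move=> eta r /andP[eta0]; rewrite !lt_min => /andP[/andP[l0 l2] /andP[le lK]] [W1 hW1 v1] [W2 hW2 v2].
set zp := (x1 +i* eta)%C in hW1; set zm := (x1 +i* - eta)%C in hW2.
have hP := primB hW1 hW2; set P := fun t => W1 t - W2 t in hP.
have Pab : P b - P a = 0 by rewrite /P; lra.
have bnd t : a <= t <= t0 \/ t2 <= t <= b -> `|Im (logd k zp t) - Im (logd k zm t)| <= M * 8 / e / e * eta.
  move=> ht; have abt : a <= t <= b by case: ht => ht; ilra.
  have half (s : R) : `|s| = eta -> e / 2 <= normc (cz k t - (x1 +i* s)%C).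
    move=> hs; have := fr t ht; have := normcB_ge (cz k t - (x1 +i* 0)%C) (0 +i* s)%C.
    have -> : cz k t - (x1 +i* 0)%C - (0 +i* s)%C = cz k t - (x1 +i* s)%C.
      by apply/eqP; rewrite eq_complex /=; apply/andP; split; apply/eqP; ring.
    rewrite {2}/normc expr0n /= add0r sqrtr_sqr hs; lra.
  have hp : e / 2 <= normc (cz k t - zp) by apply: half; rewrite gtr0_norm.
  have hm : e / 2 <= normc (cz k t - zm) by apply: half; rewrite normrN gtr0_norm.
  have e2' : 0 < e / 2 by rewrite divr_gt0.
  have np : cz k t - zp != 0 by apply: contraTneq hp => ->; rewrite normc0 -ltNge.
  have nm : cz k t - zm != 0 by apply: contraTneq hm => ->; rewrite normc0 -ltNge.
  have -> : Im (logd k zp t) - Im (logd k zm t) = Im (logd k zp t - logd k zm t) by rewrite raddfB.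
  apply: le_trans (Im_le_normc _) _.
  have -> : logd k zp t - logd k zm t = cz' k t * (zp - zm) * (cz k t - zp)^-1 * (cz k t - zm)^-1.
    by rewrite /logd; move: np nm; move: (cz k t) (cz' k t) (zp) (zm) => z z' p q ? ?; field; apply/andP.
  rewrite !normcM !normcV.
  have -> : normc (zp - zm) = 2 * eta.
    rewrite /normc /= subrr opprK expr0n /= add0r sqrtr_sqr ger0_norm; lra.
  have -> : M * 8 / e / e * eta = M * (2 * eta) * (e / 2)^-1 * (e / 2)^-1.
    by field; rewrite gt_eqF.
  have i0 : 0 <= (e / 2)^-1 by rewrite invr_ge0 ltW.
  have n0 z : 0 <= (normc z)^-1 :> R by rewrite invr_ge0 normc_ge0.
  apply: ler_pM; rewrite ?mulr_ge0 ?normc_ge0 //; first lra; last first.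
    by rewrite lef_pV2 ?posrE //; apply: lt_le_trans hm.
  apply: ler_pM; rewrite ?mulr_ge0 ?normc_ge0 //; first lra; last first.
    by rewrite lef_pV2 ?posrE //; apply: lt_le_trans hp.
  by rewrite ler_wpM2r ?hM //; lra.
have b1 : `|P t0 - P a| <= M * 8 / e / e * eta * (t0 - a).
  apply: (prim_bound at0 (prim_sub (lexx _) _ hP)) => [|t ht]; first lra.
  by apply: bnd; left.
have b2 : `|P b - P t2| <= M * 8 / e / e * eta * (b - t2).
  apply: (prim_bound t2b (prim_sub _ (lexx _) hP)) => [|t ht]; first lra.
  by apply: bnd; right.
(* On the real arc the two kernels have conjugate values, and the imaginary part of their difference
   is [2 eta] over [(x - x1)^2 + eta^2]. *)
pose Q t : R := 2 * atan ((cx k t - x1) / eta).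
have hQ : prim (fun t => Im (logd k zp t) - Im (logd k zm t)) Q t0 t2.
  have hd (t : R) : is_derive t 1 Q (2 * (derive1 (cx k) t * eta / ((cx k t - x1) ^+ 2 + eta ^+ 2))).
    have dx : is_derive t 1 (fun t => cx k t - x1) (derive1 (cx k) t).
      have [dd _] := cz_der hk t; rewrite -[derive1 _ _]subr0 /=.
      by apply: is_deriveB dd _; exact: is_derive_cst.
    apply: is_derive_ext (is_deriveZ 2 (is_derive_atan_div _ dx)) => //.
    by rewrite gt_eqF // ltr_wpDl ?sqr_ge0 // exprn_gt0.
  apply: prim_ext (prim_derive (fun t _ => hd t) _) => [t ht|t ht //|].
    rewrite /logd (czr ht) /cz' /zp /zm /=.
    have n0 : (cx k t - x1) ^+ 2 + eta ^+ 2 != 0 by rewrite gt_eqF // ltr_wpDl ?sqr_ge0 // exprn_gt0.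
    by rewrite !sub0r !opprK sqrrN; field.
  apply: ucont_continuous => u _.
  have [cx1 _] := cz'_cont hk u; have [cx0 _] := cz_ccont u hk.
  apply: cvgM; first exact: cvg_cst.
  apply: cvgM; first by apply: cvgM; [exact: cx1|exact: cvg_cst].
  apply: cvgV; first by rewrite gt_eqF // ltr_wpDl ?sqr_ge0 // exprn_gt0.
  apply: cvgD; last exact: cvg_cst.
  by rewrite expr2; apply: cvgM; apply: cvgB; [exact: cx0|exact: cvg_cst|exact: cx0|exact: cvg_cst].
have PQ := prim_unique (ltW t02) (prim_sub at0 t2b hP) hQ.
have big : pi <= `|P t2 - P t0|.
  have one t : eta < `|cx k t - x1| -> 1 <= `|(cx k t - x1) / eta|.
    by move=> h; rewrite normrM normfV (gtr0_norm eta0) ler_pdivlMr // mul1r ltW.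
  have := atan_opposite (one _ l2) (one _ l0).
  have -> : (cx k t2 - x1) / eta * ((cx k t0 - x1) / eta) =
    (cx k t0 - x1) * (cx k t2 - x1) * (eta^-1 * eta^-1) by ring.
  rewrite pmulr_llt0 ?mulr_gt0 ?invr_gt0 // => /(_ opp).
  by rewrite PQ /Q -mulrBr normrM gtr0_norm // ler_pdivrMr // mulrC.
(* Equal winding numbers make the total increment of [P] zero, so the increment over the arc is
   compensated by the rest of the curve, which contributes less than [pi]. *)
move: big; rewrite leNgt => /negP; apply.
have -> : P t2 - P t0 = - (P b - P t2) - (P t0 - P a) by lra.
apply: le_lt_trans (ler_normB _ _) _; rewrite normrN.
apply: le_lt_trans (lerD b2 b1) _; rewrite -mulrDr.
move: lK; rewrite ltr_pdivlMr //; apply: le_lt_trans.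
have -> : eta * K = M * 8 / e / e * eta * (b - a) by rewrite /K; ring.
rewrite ler_wpM2l //; last lra.
by rewrite !mulr_ge0 ?invr_ge0 // ltW.
Qed.

End RealArc.

Section NotIsolated.
Variables (R : realType) (n : nat) (cs : 'I_n -> pcurve R) (D : set (R * R)).
Local Notation C := (R[i]).
Hypothesis Hcs : pos_bdry_param D cs.
Hypothesis oD : open D.
Hypothesis cD : connected D.

(* Otherwise the boundary curve through [x0] is real near [x0], with [D] on both sides, while its
   winding number is constant on the connected set [D]. *)
Lemma real_not_isolated (x0 rho : R) : ~ D (x0, 0) -> 0 < rho ->
  exists x y, [/\ y != 0, `|x - x0| < rho, `|y| < rho & ~ D (x, y)].
Proof.
move=> nD rho0; apply: contrapT => none.
have inD x y : y != 0 -> `|x - x0| < rho -> `|y| < rho -> D (x, y).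
  by move=> y0 hx hy; apply: contrapT => nd; apply: none; exists x, y.
have : bdry D (x0, 0).
  split; last by move=> /interior_subset.
  move=> B /nbhs_ballP[e /= e0 he].
  pose y := Num.min (e / 2) (rho / 2); have y0 : 0 < y by rewrite lt_min !divr_gt0.
  have yr : y < rho by rewrite gt_min orbC ltr_pdivrMr // ltr_pMr // ltr1n.
  have ye : y < e by rewrite gt_min ltr_pdivrMr // ltr_pMr // ltr1n.
  exists (x0, y); split.
    by apply: inD; rewrite ?gt_eqF ?subrr ?normr0 // gtr0_norm.
  by apply: he; split; rewrite /ball /= ?subrr ?normr0 // sub0r normrN gtr0_norm.
case: (Hcs) => _ [-> _] [k _ [s hs e]]; have hk := fam_jordan Hcs k.
have [cx0 cy0] := cz_ccont s hk.
have : \forall t \near s, `|cx (cs k) t - x0| < rho /\ `|cy (cs k) t| < rho.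
  near=> t; split; near: t.
    have -> : x0 = cx (cs k) s by case: e.
    by move/cvgrPdist_lt: cx0 => /(_ rho rho0); apply: filterS => t; rewrite /= distrC.
  have e2 : cy (cs k) s = 0 by case: e.
  by move/cvgrPdist_lt: cy0 => /(_ rho rho0); apply: filterS => t /=; rewrite e2 sub0r normrN.
move=> /nbhs_ballP[d /= d0 hd].
have ab := jordan_ab hk.
(* The parameter [s] may be an end point; clipping still leaves a nonempty open interval of
   parameters near [s]. *)
pose al := Num.max (ca (cs k)) (s - d); pose be := Num.min (cb (cs k)) (s + d).
have alb : al < be.
  by case/andP: hs => s1 s2; rewrite gt_max !lt_min ab /=; apply/andP; split; [|apply/andP; split]; lra.
have [ala ald] : ca (cs k) <= al /\ s - d <= al by split; rewrite le_max lexx ?orbT.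
have [beb bed] : be <= cb (cs k) /\ be <= s + d by split; rewrite ge_min lexx ?orbT.
have loc t : al < t < be -> [/\ `|cx (cs k) t - x0| < rho, `|cy (cs k) t| < rho & cy (cs k) t = 0].
  move=> /andP[t1 t2]; have [h1 h2] : `|cx (cs k) t - x0| < rho /\ `|cy (cs k) t| < rho.
    by apply: hd; rewrite /ball /= ltr_norml; apply/andP; split; lra.
  (* A nonreal point of the curve this close to [x0] would belong to [D], but the curves avoid
     [D]. *)
  split => //; apply: contrapT => /eqP h3; have := inD _ _ h3 h1 h2.
  by apply: (curve_notD Hcs oD); apply/andP; split; lra.
pose w := (be - al) / 4; have w0 : 0 < w by rewrite divr_gt0 // subr_gt0.
have w4 : be = al + 4 * w by rewrite /w; field.
have [||||t ht|eta0 eta00 jump] := @real_arc_jump R (cs k) (al + w) (al + 2 * w) (al + 3 * w) hk.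
- lra.
- lra.
- lra.
- lra.
- by have [] := loc t _; first by case/andP: ht => ? ?; apply/andP; split; lra.
set x1 := cx (cs k) (al + 2 * w) in jump.
have [hx1 _ _] : [/\ `|x1 - x0| < rho, `|cy (cs k) (al + 2 * w)| < rho & cy (cs k) (al + 2 * w) = 0].
  by apply: loc; apply/andP; split; lra.
pose eta := Num.min (eta0 / 2) (rho / 2); have p0 : 0 < eta by rewrite lt_min !divr_gt0.
have er : eta < rho by rewrite gt_min orbC ltr_pdivrMr // ltr_pMr // ltr1n.
have ee : eta < eta0 by rewrite gt_min ltr_pdivrMr // ltr_pMr // ltr1n.
have Dp : D (x1, eta) by apply: inD; rewrite ?gt_eqF // gtr0_norm.
have Dm : D (x1, - eta) by apply: inD; rewrite ?oppr_eq0 ?gt_eqF // normrN gtr0_norm.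
have dis z : D z -> ~ curve_img (cs k) z.
  by move=> Dz h; exact: (open_not_bdry oD Dz (curve_bdry Hcs h)).
have [r hr] := wnd_exists hk (dis _ Dp : off (cs k) (x1 +i* eta)%C).
apply: (jump eta r); rewrite ?p0 //.
exact: (wnd_const hk oD cD dis Dp Dm hr).
Unshelve. all: by end_near.
Qed.

End NotIsolated.

(** * Resolvent series *)

Section ResolventSeries.
Variables (R : realType) (X : completeNormedModType R) (I : X -> X).
Local Notation C := (R[i]).
Hypothesis ID : forall x y, I (x + y) = I x + I y.
Hypothesis IZ : forall (a : R) x, I (a *: x) = a *: I x.
Hypothesis II : forall x, I (I x) = - x.
Hypothesis Inorm : forall (a b : R) x, `|a *: x + b *: I x| = Num.sqrt (a ^+ 2 + b ^+ 2) * `|x|.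
Local Notation act := (cact I).
Local Notation polyapprox := (polyapprox I).
Ltac lmod := lmod_with R X.

Lemma geometric_small (K e : R) : 0 < e -> exists N, forall M, (N <= M)%N -> 2 ^- M * K <= e.
Proof.
move=> e0; have [K0|K0] := leP K 0.
  by exists 0%N => M _; apply: le_trans (ltW e0); rewrite pmulr_rle0 // invr_gt0 exprn_gt0.
have /archi_boundP := ltW (divr_gt0 K0 e0); set N := Num.bound _ => hN.
exists N => M NM; rewrite mulrC ler_pdivrMr ?exprn_gt0 // mulrC -ler_pdivrMr //.
apply: (le_trans (ltW hN)); rewrite -natrX ler_nat; apply: leq_trans NM _.
exact/ltnW/ltn_expl.
Qed.

Lemma normcX (z : C) k : normc (z ^+ k) = normc z ^+ k.
Proof. by elim: k => [|k IH]; rewrite ?expr0 ?normc1 // !exprS normcM IH. Qed.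

Variables (T : X -> X) (CT : R).
Hypothesis TD : forall x y, T (x + y) = T x + T y.
Hypothesis TB : forall x, T (- x) = - T x.
Hypothesis Tbd : forall x, `|T x| <= CT * `|x|.

Definition resolvent_op (w : C) (z : X) : X := act w z - T z.
Local Notation resop := resolvent_op.

Lemma resopD w x y : resop w (x + y) = resop w x + resop w y.
Proof. by rewrite /resop (actD ID) TD opprD addrACA. Qed.

Lemma resopB w x y : resop w (x - y) = resop w x - resop w y.
Proof. rewrite resopD /resop (actN IZ) TB; lmod. Qed.

Lemma resop0 w : resop w 0 = 0.
Proof. by rewrite -[in LHS](subrr (0 : X)) resopB subrr. Qed.

Lemma resop_near w w' z : resop w' z = resop w z + act (w' - w) z.
Proof. rewrite /resop (actBl I w' w z); lmod. Qed.

Definition bounded_below (mu : R) w := forall z, mu * `|z| <= `|resop w z|.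

Lemma resop_lower mu w w' d : bounded_below mu w -> normc (w' - w) <= d ->
  bounded_below (mu - d) w'.
Proof.
move=> h hd z; have := ler_normD (resop w' z) (act (w - w') z).
rewrite -resop_near (act_norm Inorm) -normcN opprB.
have := h z; have : normc (w' - w) * `|z| <= d * `|z| by rewrite ler_wpM2r.
by rewrite mulrBl; lra.
Qed.

Lemma resop_continuous w : exists2 K : R, 0 < K & forall z, `|resop w z| <= K * `|z|.
Proof.
exists (normc w + `|CT| + 1) => [|z].
  by rewrite ltr_wpDl // addr_ge0 // normc_ge0.
apply: le_trans (ler_normB _ _) _; rewrite (act_norm Inorm) !mulrDl -addrA lerD // mul1r.
apply: ler_wpDr => //; apply: le_trans (Tbd z) _; rewrite ler_wpM2r // ler_norm //.
Qed.

Section Series.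
Variables (s : C) (x : X) (xs : nat -> X) (mu : R).
Hypothesis mu0 : 0 < mu.
Hypothesis lower : bounded_below mu s.
Hypothesis xs0 : xs 0%N = x.
Hypothesis xsS : forall c k, resop s (act c (xs k.+1)) = act c (xs k).

(** Partial sum of the Neumann series at [w] centred at [s], with [xs k] in the place of the [k]-th
    power of the resolvent at [s] applied to [x]. *)
Definition psum w N := \sum_(k < N) act ((s - w) ^+ k) (xs k.+1).

Lemma resop_psum w N : resop w (psum w N) = x - act ((s - w) ^+ N) (xs N).
Proof.
elim: N => [|N IH].
  by rewrite /psum big_ord0 resop0 expr0 act1 xs0 subrr.
rewrite /psum big_ord_recr resopD IH /= (resop_near s) xsS exprS (actM ID IZ II).
set y := act ((s - w) ^+ N) (xs N.+1).
have -> : act (w - s) y = - act (s - w) y by rewrite -(opprB s w) (actNl I (s - w)).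
lmod.
Qed.

Lemma xs_bound N : mu ^+ N * `|xs N| <= `|x|.
Proof.
elim: N => [|N IH]; first by rewrite expr0 mul1r xs0.
apply: le_trans IH; rewrite exprSr -mulrA ler_wpM2l ?exprn_ge0 ?(ltW mu0) //.
by have := lower (xs N.+1); have := xsS 1 N; rewrite !act1 => ->.
Qed.

Lemma psum_tail w N : normc (w - s) <= mu / 2 -> `|x - resop w (psum w N)| <= 2 ^- N * `|x|.
Proof.
move=> h; rewrite resop_psum subKr (act_norm Inorm) normcX.
apply: (@le_trans _ _ ((mu / 2) ^+ N * `|xs N|)).
  rewrite ler_wpM2r //; apply: lerXn2r; rewrite ?nnegrE ?normc_ge0 ?divr_ge0 ?(ltW mu0) //.
  by rewrite -normcN opprB.
by rewrite exprMn exprVn mulrAC mulrC ler_wpM2l ?xs_bound // invr_ge0 exprn_ge0.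
Qed.

Lemma psum_near w N z : normc (w - s) <= mu / 2 -> resop w z = x ->
  `|z - psum w N| <= 2 ^- N * (2 / mu * `|x|).
Proof.
move=> h hz; have := psum_tail N h; rewrite -hz -resopB.
have := resop_lower lower h (z - psum w N).
have -> : mu - mu / 2 = mu / 2 by field.
rewrite hz => h1 h2; have := le_trans h1 h2.
rewrite mulrC -ler_pdivlMr ?divr_gt0 // invf_div => /le_trans; apply.
by rewrite mulrAC mulrA.
Qed.

(** The images of the partial sums converge to [x], and the lower bound [mu / 2] carries the Cauchy
    property back to the sums themselves. Nothing is assumed about invertibility at [w], which may
    lie in [D]. *)
Lemma resop_solvable w : normc (w - s) <= mu / 2 -> exists z, resop w z = x.
Proof.
move=> h; have [|z hz] := @complete_sequence R X (psum w).
  move=> e e0; have [N hN] := geometric_small (4 / mu * `|x|) e0.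
  have half K : (N <= K)%N -> `|x - resop w (psum w K)| <= mu / 4 * e.
    move=> NK; apply: le_trans (psum_tail K h) _.
    have -> : 2 ^- K * `|x| = mu / 4 * (2 ^- K * (4 / mu * `|x|)).
      by field; rewrite gt_eqF //= expf_neq0.
    by rewrite ler_wpM2l ?hN // divr_ge0 // ltW.
  exists N => i j Ni Nj; have := resop_lower lower h (psum w i - psum w j).
  have -> : mu - mu / 2 = mu / 2 by field.
  rewrite resopB.
  have -> : resop w (psum w i) - resop w (psum w j) =
    (x - resop w (psum w j)) - (x - resop w (psum w i)) by lmod.
  move=> h1; have := le_trans h1 (ler_normB _ _).
  have := half i Ni; have := half j Nj => k1 k2 k3.
  have : mu / 2 * `|psum w i - psum w j| <= mu / 2 * e by lra.
  by rewrite ler_pM2l // divr_gt0.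
exists z; have [K K0 hK] := resop_continuous w.
apply/eqP; rewrite -subr_eq0 -normr_le0; apply/ler_addgt0Pr => e e0; rewrite add0r.
have [N1 h1] := hz _ (divr_gt0 (divr_gt0 e0 K0) (ltr0Sn R 1)).
have [N2 h2] := geometric_small `|x| (divr_gt0 e0 (ltr0Sn R 1)).
pose N := maxn N1 N2.
have -> : resop w z - x = - (resop w (psum w N - z)) - (x - resop w (psum w N)).
  by rewrite resopB; lmod.
have a1 : `|resop w (psum w N - z)| <= e / 2.
  apply: le_trans (hK _) _; have := h1 N (leq_maxl _ _).
  by rewrite mulrAC ler_pdivlMr // mulrC.
have a2 : `|x - resop w (psum w N)| <= e / 2.
  by apply: le_trans (psum_tail N h) _; rewrite h2 // leq_maxr.
by apply: le_trans (ler_normB _ _) _; rewrite normrN (splitr e) lerD.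
Qed.

Lemma resolvent_polyapprox (S : set C) (F : C -> X) :
  (forall w, S w -> normc (w - s) <= mu / 2) -> (forall w, S w -> resop w (F w) = x) ->
  polyapprox S F.
Proof.
move=> hS hF e e0; have [N hN] := geometric_small (2 / mu * `|x|) e0.
exists [seq ((s%:P - 'X) ^+ k, xs k.+1) | k <- iota 0 N] => w Sw.
have iE : iota 0 N = index_iota 0 N by rewrite /index_iota subn0.
rewrite /veval big_map iE big_mkord /=.
under eq_bigr do rewrite horner_exp !hornerE.
exact: le_trans (psum_near N (hS w Sw) (hF w Sw)) (hN N (leqnn N)).
Qed.

End Series.

Section Laurent.
Variables (x : X) (xs : nat -> X) (L : R).
Hypothesis L0 : 0 < L.
Hypothesis LC : 2 * CT <= L.
Hypothesis CT0 : 0 <= CT.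
Hypothesis xs0 : xs 0%N = x.
Hypothesis xsS : forall c k, T (act c (xs k)) = act c (xs k.+1).

Lemma resop_laurent w N : w != 0 ->
  resop w (\sum_(k < N) act (w ^- k.+1) (xs k)) = x - act (w ^- N) (xs N).
Proof.
move=> w0; elim: N => [|N IH].
  by rewrite big_ord0 resop0 expr0 invr1 act1 xs0 subrr.
have e : act w (act (w ^- N.+1) (xs N)) = act (w ^- N) (xs N).
  by rewrite -(actM ID IZ II w) exprS invfM mulrA mulfV // mul1r.
rewrite big_ord_recr resopD IH /= {1}/resop xsS e; lmod.
Qed.

(** [2 CT <= L] plays two parts: it bounds [w - T] below by [L / 2] and the ratio of the Laurent
    series by 1/2. *)
Lemma laurent_approx w N z : L <= normc w -> resop w z = x ->
  `|z - \sum_(k < N) act (w ^- k.+1) (xs k)| <= 2 ^- N * (2 / L * `|x|).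
Proof.
move=> Lw hz; set P := \sum_(k < N) _.
have w0 : w != 0 by apply: contraTneq Lw => ->; rewrite normc0 -ltNge.
have low : L / 2 * `|z - P| <= `|resop w (z - P)|.
  have := ler_normB (act w (z - P)) (T (z - P)); rewrite -[act _ _ - _]/(resop w (z - P)).
  have := Tbd (z - P); have := ler_normD (resop w (z - P)) (T (z - P)).
  rewrite /resop subrK (act_norm Inorm) -/(resop w (z - P)).
  have : L * `|z - P| <= normc w * `|z - P| by rewrite ler_wpM2r.
  have : 2 * CT * `|z - P| <= L * `|z - P| by rewrite ler_wpM2r.
  rewrite mulrAC; lra.
have bd : `|xs N| <= CT ^+ N * `|x|.
  elim: N {P low} => [|N IH]; first by rewrite expr0 mul1r xs0.
  have := xsS 1 N; rewrite !act1 => <-; apply: le_trans (Tbd _) _.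
  by rewrite exprS -mulrA ler_wpM2l.
have up : `|resop w (z - P)| <= 2 ^- N * `|x|.
  rewrite resopB hz resop_laurent // subKr (act_norm Inorm) normcV normcX.
  apply: (@le_trans _ _ (L ^- N * (CT ^+ N * `|x|))).
    apply: ler_pM => //; first by rewrite invr_ge0 exprn_ge0 // normc_ge0.
    rewrite lef_pV2 ?posrE ?exprn_gt0 //; last exact: lt_le_trans Lw.
    by apply: lerXn2r; rewrite ?nnegrE ?normc_ge0 ?(ltW L0).
  rewrite mulrA ler_wpM2r // mulrC ler_pdivrMr ?exprn_gt0 // mulrC -ler_pdivrMr ?invr_gt0 ?exprn_gt0 //.
  rewrite invrK -exprMn; apply: lerXn2r; rewrite ?nnegrE ?mulr_ge0 ?(ltW L0) //.
  by rewrite mulrC.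
have := le_trans low up; rewrite mulrC -ler_pdivlMr ?divr_gt0 // invf_div => /le_trans; apply.
by rewrite mulrAC mulrA.
Qed.

End Laurent.
End ResolventSeries.

(** * The resolvent on a slice *)

Section Operator.
Variables (R : realType) (V : completeNormedModType R).
Variables (lm : oct R -> V -> V) (rm : V -> oct R -> V).
Hypothesis HV : banach_O_bimodule lm rm.
Variable J : oct R.
Hypothesis HJ : in_S J.
Local Notation C := (R[i]).
Local Notation Re := (@complex.Re R).
Local Notation Im := (@complex.Im R).

Definition rmJ (x : V) := rm x J.
Local Notation act := (cact rmJ).

Lemma act_oz z x : act z x = rm x (oz J z).
Proof. by rewrite /cact /rmJ /oz /cJ (rmDr HV) !(rmZr HV) (rm1 HV). Qed.

Lemma rmJD x y : rmJ (x + y) = rmJ x + rmJ y. Proof. exact: (rmDl HV). Qed.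

Lemma rmJZ (a : R) x : rmJ (a *: x) = a *: rmJ x. Proof. exact: (rmZl HV). Qed.

Lemma rmJJ x : rmJ (rmJ x) = - x.
Proof.
have h := rm_slice HV HJ x 'i%C 'i%C.
have iE : oz J 'i%C = J by rewrite /oz /cJ /= scale0r add0r scale1r.
have mE : oz J ('i%C * 'i%C) = - one_o R.
  by rewrite /oz /cJ /= !(mul0r, mulr0, mulr1, sub0r, addr0, add0r, scale0r, scaleN1r).
by rewrite /rmJ; move: h; rewrite iE mE (rmNr HV) (rm1 HV).
Qed.

Lemma rmJ_norm (a b : R) x : `|a *: x + b *: rmJ x| = Num.sqrt (a ^+ 2 + b ^+ 2) * `|x|.
Proof. by have := act_oz (a +i* b)%C x; rewrite /cact /= => ->; rewrite (rm_norm HV) oz_norm. Qed.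

Lemma opinvP (S : V -> V) : invertible S ->
  [/\ bdd_lin (opinv S), cancel S (opinv S) & cancel (opinv S) S].
Proof.
move=> h; rewrite /opinv; case: pselect => [h'|[]//].
by case: (cid h') => g [h1 [h2 h3]].
Qed.

Variable T : V -> V.
Hypothesis HTpa : power_assoc lm rm T.
Local Notation resop := (resolvent_op rmJ T).

Lemma resopE w z : resop w z = RsT rm T (oz J w) z.
Proof. by rewrite /resolvent_op act_oz. Qed.

Lemma T_BRO : in_BRO lm rm T. Proof. exact: (HTpa 1). Qed.

Lemma T_add x y : T (x + y) = T x + T y. Proof. by case: T_BRO => [[h _] _]. Qed.

Lemma T_scale (a : R) x : T (a *: x) = a *: T x. Proof. by case: T_BRO => [[_ [h _]] _]. Qed.

Lemma T_opp x : T (- x) = - T x. Proof. by rewrite -scaleN1r T_scale scaleN1r. Qed.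

Lemma T_bounded : exists2 K : R, 0 <= K & forall x, `|T x| <= K * `|x|.
Proof.
case: T_BRO => [[_ [_ [K hK]]] _]; exists `|K| => // x.
by apply: le_trans (hK x) _; rewrite ler_wpM2r // ler_norm.
Qed.

Lemma T_act c k x : Defs.ReV lm rm x -> T (act c (iter k T x)) = act c (iter k.+1 T x).
Proof.
move=> hx; rewrite !act_oz -(BRO_rm HV _ (HTpa k.+1) hx) -(BRO_rm HV _ (HTpa k) hx) //.
Qed.

Variable U : set (oct R).
Hypothesis HU : left_admissible lm rm T U.

Definition outside (w : C) := ~ U (oz J w).

Lemma outside_rho w : outside w -> exists J', in_S J' /\ rhoJ lm rm T J' (oz J w).
Proof.
move=> hw; apply: contrapT => h; apply: hw.
by case: HU => _ [_ [hs _]]; apply: hs => -[J' hJ']; apply: h; exists J'.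
Qed.

Lemma outside_inv w : outside w -> invertible (RsT rm T (oz J w)).
Proof. by move=> /outside_rho[J' [_ [_ []]]]. Qed.

(* a nonreal point lies in one slice only, so the unit provided by the resolvent set is [J] up to sign *)
Lemma CJ_transfer J' w lam : in_S J' -> in_CJ J' (oz J w) -> Im w != 0 -> in_CJ J lam -> in_CJ J' lam.
Proof.
move=> hJ' [x [y e]] w0 [p [q ->]].
have e0 := congr1 (fun s : oct R => s 0 ord0) e.
have xE : x = Re w.
  move: e0; rewrite /oz /cJ !mxE (inS_re HJ) (inS_re hJ') !mulr0 !addr0 eqxx /= !mulr1.
  by move=> ->.
have JE : J = (y / Im w) *: J'.
  move: e; rewrite /oz /cJ xE => /addrI e1.
  by rewrite mulrC -scalerA -e1 scalerA mulVf // scale1r.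
by exists p, (q * (y / Im w)); rewrite /cJ [in LHS]JE scalerA.
Qed.

(** The sequence consists of the iterates of the inverse at [x]. Extendability for every power lets
    slice scalars pass through them, although the iterates themselves may leave [Re V]. *)
Lemma resolvent_powers w x : outside w -> Im w != 0 -> Defs.ReV lm rm x ->
  exists xs : nat -> V, xs 0%N = x /\ forall c k, resop w (act c (xs k.+1)) = act c (xs k).
Proof.
move=> hw w0 hx; have [J' [hJ' [h1 [h2 h3]]]] := outside_rho hw.
set A := opinv (RsT rm T (oz J w)) in h3.
have [_ _ AK] := opinvP h2.
have com k c : iter k A (rm x (oz J c)) = rm (iter k A x) (oz J c).
  case: k => [//|k]; apply: h3 => //.
  by apply: (CJ_transfer hJ' h1 w0); exists (Re c), (Im c).
exists (fun k => iter k A x); split=> [//|c k].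
by rewrite !act_oz resopE -!com /= AK.
Qed.

(** A chosen solution rather than the value of [opinv]: near the complement of [D] the series solves
    the equation also at points of [D], where [R_w - T] may fail to be invertible. *)
Definition resolv (x : V) (w : C) : V := xget 0 [set z | resop w z = x].

Lemma resolvP x w : (exists z, resop w z = x) -> resop w (resolv x w) = x.
Proof. by move=> h; exact: (xgetPex 0 h). Qed.

Lemma resolv_outside x w : outside w -> resop w (resolv x w) = x.
Proof.
move=> /outside_inv /opinvP[_ _ h]; apply: resolvP.
by exists (opinv (RsT rm T (oz J w)) x); rewrite resopE h.
Qed.

Lemma resolv_opinv x w : outside w -> resolv x w = opinv (RsT rm T (oz J w)) x.
Proof.
move=> hw; have := resolv_outside x hw; rewrite resopE.
by have [_ h _] := opinvP (outside_inv hw) => /(congr1 (opinv (RsT rm T (oz J w)))); rewrite h.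
Qed.

Lemma slice_open : open (sliceJ U J).
Proof. by case: HU => _ [[_ [_ [_ /(_ J HJ)[h1 h2]]]] _]. Qed.

Lemma slice_connected : connected (sliceJ U J).
Proof. by case: HU => _ [[_ [_ [_ /(_ J HJ)[h1 h2]]]] _]. Qed.

Local Notation bounded_below := (bounded_below rmJ T).

Lemma outside_lower w : outside w -> exists2 mu : R, 0 < mu & bounded_below mu w.
Proof.
move=> hw; have [[_ [_ [K hK]]] h _] := opinvP (outside_inv hw).
have K1 : 0 < `|K| + 1 by rewrite ltr_wpDl.
exists (`|K| + 1)^-1; first by rewrite invr_gt0.
move=> z; rewrite mulrC ler_pdivrMr // mulrC resopE -{1}(h z).
by apply: le_trans (hK _) _; rewrite ler_wpM2r // (le_trans (ler_norm _)) // lerDl.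
Qed.

(** A lower bound at one point persists nearby, and the part of the square outside the slice is
    compact because the slice is open. *)
Lemma uniform_lower (L : R) : exists2 mu : R, 0 < mu & forall w, box (- L) L (- L) L w ->
  outside w -> bounded_below mu w.
Proof.
pose K : set (R * R) := (`[- L, L] `*` `[- L, L]) `&` ~` (sliceJ U J).
have cK : compact K.
  apply: compact_closedI; last exact: open_closedC slice_open.
  by apply: compact_setX; exact: segment_compact.
have [d d' z /andP[d0 dd] h x|z [_ hz]|mu mu0 hmu] := @compact_uniform R (R * R)%type K
    (fun d z => bounded_below d (z.1 +i* z.2)%C) cK.
- by apply: le_trans (h x); rewrite ler_wpM2r.
- have [mu mu0 hmu] := @outside_lower (z.1 +i* z.2)%C hz.
  exists (mu / 4); first by rewrite divr_gt0.
  move=> y _ [/= b1 b2] x; have hd : normc ((y.1 +i* y.2)%C - (z.1 +i* z.2)%C) <= mu / 2.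
    apply: le_trans (normc_le_sum _) _ => /=; move: b1 b2.
    by rewrite /ball /= (distrC z.1) (distrC z.2); lra.
  have := resop_lower rmJ_norm hmu hd x; have -> : mu - mu / 2 = mu / 2 by field.
  by apply: le_trans; rewrite ler_wpM2r //; lra.
exists mu => // -[a b] [/= h1 h2] hw; apply: (hmu (a, b)); split; last exact: hw.
by split; rewrite /= in_itv.
Qed.

End Operator.

(** * Moments of the resolvent over the contours *)

Section Contour.
Variables (R : realType) (V : completeNormedModType R).
Variables (lm : oct R -> V -> V) (rm : V -> oct R -> V).
Hypothesis HV : banach_O_bimodule lm rm.
Variable J : oct R.
Hypothesis HJ : in_S J.
Local Notation C := (R[i]).
Local Notation Re := (@complex.Re R).
Local Notation Im := (@complex.Im R).
Local Notation rmJ := (rmJ rm J).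
Local Notation act := (cact rmJ).
Variable T : V -> V.
Hypothesis HTpa : power_assoc lm rm T.
Variable U : set (oct R).
Hypothesis HU : left_admissible lm rm T U.
Local Notation resop := (resolvent_op rmJ T).
Local Notation outside := (outside J U).
Local Notation resolv := (resolv rm J T).
Variables (n : nat) (cs : 'I_n -> pcurve R).
Hypothesis Hcs : pos_bdry_param (sliceJ U J) cs.

Let ID := rmJD HV J.
Let IZ := rmJZ HV J.
Let II := rmJJ HV HJ.
Let Inorm := rmJ_norm HV HJ.
Let TD := T_add HTpa.
Let TB := T_opp HTpa.

(* For real [s] the unit provided by the resolvent set may be unrelated to [J]; the series is then
   centred at a nonreal point near [s] outside [U]. *)
Lemma outside_approx (L : R) : 0 < L -> exists2 r : R, 0 < r &
  forall s x, box (- L) L (- L) L s -> outside s -> Defs.ReV lm rm x ->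
    (forall w, square r s w -> resop w (resolv x w) = x) /\
    polyapprox rmJ (square r s) (resolv x).
Proof.
move=> L0; have [mu mu0 hmu] := uniform_lower HV HJ HU (L + 1).
pose r := Num.min (mu / 8) 1; have r0 : 0 < r by rewrite lt_min ltr01 divr_gt0.
have [r1 rmu] : r <= 1 /\ r <= mu / 8 by rewrite !ge_min !lexx orbT.
exists r => // s x [/andP[a1 a2] /andP[b1 b2]] os hx.
have [s1 [os1 im1 hs1 hs2]] : exists s1, [/\ outside s1, Im s1 != 0, `|Re s1 - Re s| <= r & `|Im s1 - Im s| <= r].
  have [i0|i0] := eqVneq (Im s) 0; last by exists s; rewrite !subrr !normr0 !(ltW r0).
  have os' : ~ sliceJ U J (Re s, 0) by move=> h; apply: os; rewrite /oz i0.
  have [p [q [q0 h1 h2 h3]]] := real_not_isolated Hcs (slice_open HJ HU) (slice_connected HJ HU) os' r0.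
  by exists (p +i* q)%C; rewrite /= i0 subr0 !ltW.
have bs1 : box (- (L + 1)) (L + 1) (- (L + 1)) (L + 1) s1.
  by move: hs1 hs2; rewrite !ler_norml => /andP[? ?] /andP[? ?]; split; apply/andP; split; lra.
have low := hmu s1 bs1 os1.
have near w : square r s w -> normc (w - s1) <= mu / 2.
  move=> [h1 h2]; apply: le_trans (normc_le_sum _) _; rewrite !raddfB /=.
  have := ler_normB (Re w - Re s) (Re s1 - Re s); have := ler_normB (Im w - Im s) (Im s1 - Im s).
  have -> : Re w - Re s - (Re s1 - Re s) = Re w - Re s1 by ring.
  have -> : Im w - Im s - (Im s1 - Im s) = Im w - Im s1 by ring.
  lra.
have [xs [xs0 xsS]] := resolvent_powers HV HJ HU os1 im1 hx.
have [K _ TK] := T_bounded HTpa.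
have sol w : square r s w -> resop w (resolv x w) = x.
  by move=> /near hw; apply: resolvP; apply: (resop_solvable ID IZ II Inorm TD TB TK mu0 low xs0 xsS hw).
split => //; exact: (resolvent_polyapprox ID IZ II Inorm TD TB mu0 low xs0 xsS near sol).
Qed.

Lemma curve_outside k t : ca (cs k) <= t <= cb (cs k) -> outside (cz (cs k) t).
Proof. exact: (curve_notD Hcs (slice_open HJ HU)). Qed.

Local Notation cc := (fun k => cz (cs k)).
Local Notation cc' := (fun k => cz' (cs k)).
Local Notation ca' := (fun k => ca (cs k)).
Local Notation cb' := (fun k => cb (cs k)).

Lemma contour_moment x m (G : 'I_n -> R -> V) : Defs.ReV lm rm x ->
  (forall k, prim (fun t => act (cz (cs k) t ^+ m * cz' (cs k) t) (resolv x (cz (cs k) t))) (G k)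
    (ca (cs k)) (cb (cs k))) ->
  \sum_(k < n) (G k (cb (cs k)) - G k (ca (cs k))) = act (0 +i* (2 * pi))%C (iter m T x).
Proof.
move=> hx hG; have oU := slice_open HJ HU.
have [M M0 hM] := fam_bounded Hcs; have [L1 L10 hL1] := D_bounded Hcs oU.
have [CT CT0 hCT] := T_bounded HTpa.
(* The square contains [D] because of [L1], keeps distance 1 from the curves because of [M + 1], and
   is large enough for the Laurent series because of [2 CT]. *)
pose L := L1 + M + 1 + 2 * CT; have L0 : 0 < L by rewrite ltr_wpDr ?mulr_ge0 // !addr_gt0.
have [r r0 hr] := outside_approx L0.
pose D : set C := [set w | U (oz J w)].
have hF s : box (- L) L (- L) L s -> ~ D s -> polyapprox rmJ (square r s) (resolv x).
  by move=> bs os; have [] := hr s x bs os hx.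
have hD s : D s -> `|Re s| < L /\ `|Im s| < L.
  move=> Ds; have [h1 h2] := hL1 (Re s, Im s) Ds; rewrite /L; split; move: h1 h2 => /=; lra.
have [n0 hn0] : exists n0 : nat, 2 * L / n0.+1%:R <= r.
  have /archi_boundP := ltW (divr_gt0 (mulr_gt0 (ltr0Sn R 1) L0) r0); set N := Num.bound _ => hN.
  exists N; rewrite ler_pdivrMr ?ltr0n // -ler_pdivrMl // mulrC; apply: (le_trans (ltW hN)).
  by rewrite ler_nat.
set Ein := inner_chain L n0 (chi D L n0); set Eout := outer_chain L n0.
have apx e : e \in Ein ++ Eout -> exists2 S, polyapprox rmJ S (resolv x) &
    forall t, 0 <= t <= 1 -> S (seg e.2.1 e.2.2 t).
  exact: (edges_approx L0 hF hD hn0).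
have onM s : on_curves cc ca' cb' s -> normc s <= M /\ ~ D s.
  by move=> [k [t [ht ->]]]; split; [have [] := hM k t ht|exact: curve_outside].
have farout e t : e \in Eout -> 0 <= t <= 1 -> L <= normc (seg e.2.1 e.2.2 t).
  move=> he ht; have [h|h] := outer_far L0 hD he ht; apply: le_trans h _.
    exact: Re_le_normc.
  exact: Im_le_normc.
have [rho1 rho10 hrho1] : exists2 rho : R, 0 < rho & forall e, e \in Ein -> forall t s,
    0 <= t <= 1 -> ~ D s -> rho <= normc (seg e.2.1 e.2.2 t - s).
  have [e he t ht|rho rho0 h] := @chain_far R (sliceJ U J) oU Ein.
    exact: (inner_in_D L0 he ht).
  by exists rho => // e he t [p q]; exact: h.
(* [rho1] separates the inner edges from the complement of [D], which contains the curves; 1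
   separates the outer edges from the curves. *)
pose rho := Num.min rho1 1; have rho0 : 0 < rho by rewrite lt_min rho10 ltr01.
have far e : e \in Ein ++ Eout -> forall t s, 0 <= t <= 1 -> on_curves cc ca' cb' s ->
    rho <= normc (seg e.2.1 e.2.2 t - s).
  rewrite mem_cat => he t s ht /onM[sM os]; rewrite ge_min; case/orP: he => he.
    by rewrite hrho1.
  apply/orP; right; apply: le_trans (normcB_ge _ _); have := farout e t he ht.
  by rewrite /L; have := L10; have := CT0; lra.
have hk := fam_jordan Hcs.
have pole w (o : R) : ~ bdry (sliceJ U J) (Re w, Im w) ->
    (if pselect (sliceJ U J (Re w, Im w)) then 2 * pi else 0) = o ->
    pole_value rmJ cc cc' ca' cb' m w (- (0 +i* o)%C).
  move=> nb <-; case: (Hcs) => _ [_ /(_ _ nb)[wk [h1 <-]]].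
  apply: (pole_value_index ID IZ II Inorm m hk _ h1) => k h; exact/nb/(curve_bdry Hcs h).
have := @swap_cauchy R V rmJ ID IZ II Inorm n cc cc' ca' cb' m
  (fun k => jordan_ab (hk k)) (fun k => cz_der (hk k)) (fun k => cz'_cont (hk k))
  Ein Eout (resolv x) rho G rho0 apx far _ _ _ hG.
move=> ->; last 3 first.
- move=> e he t ht; have Dw : sliceJ U J (Re (seg e.2.1 e.2.2 t), Im (seg e.2.1 e.2.2 t)).
    exact: (inner_in_D L0 he ht).
  apply: pole; first exact: (open_not_bdry oU Dw).
  by case: pselect.
- move=> e he t ht; have h := farout e t he ht.
  have nb : ~ bdry (sliceJ U J) (Re (seg e.2.1 e.2.2 t), Im (seg e.2.1 e.2.2 t)).
    case: (Hcs) => _ [-> _] [k _ [u hu e1]].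
    have : normc (seg e.2.1 e.2.2 t) <= M.
      by have [] := hM k u hu; rewrite /cz; case: (seg _ _ _) e1 => p q [-> ->].
    by have := h; rewrite /L; have := L10; have := CT0; lra.
  have -> : (0 : C) = - (0 +i* 0)%C by rewrite oppr0.
  apply: pole => //; case: pselect => // Dw.
  have [] := hD _ Dw; case: (outer_far L0 hD he ht); lra.
- move=> s /onM[sM os].
  apply: (grid_formula ID IZ II Inorm L0 r0 hF hD hn0) => //.
    by apply: le_lt_trans (Re_le_normc _) _; rewrite /L; have := L10; have := CT0; lra.
  by apply: le_lt_trans (Im_le_normc _) _; rewrite /L; have := L10; have := CT0; lra.
have gc := grid_cauchy ID IZ II Inorm L0 hF hD hn0 'X^m.
have hX ch : chain_sum rmJ ch (fun w => act ('X^m).[w] (resolv x w)) = chain_sum rmJ ch (fun w => act (w ^+ m) (resolv x w)).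
  by apply: csum_ext => e he t ht; rewrite hornerXn.
move: gc; rewrite !hX => /eqP; rewrite addr_eq0 => /eqP ->; rewrite opprK.
have inout e : e \in Eout -> e \in Ein ++ Eout by move=> h; rewrite mem_cat; apply/orP; right.
apply: (outer_laurent ID IZ II Inorm L0 (x := fun k => iter k T x)).
- by move=> e /inout/apx[S hS hs]; exact: (econt_approx ID IZ II Inorm hs hS).
- move=> eps eps0; have [N0 hN0] := geometric_small (2 / L * `|x|) eps0.
  exists N0 => N NN e he t ht /=; apply: le_trans (hN0 N NN).
  have LC : 2 * CT <= L by rewrite /L lerDr !addr_ge0 // ltW.
  apply: (laurent_approx ID IZ II Inorm TD TB hCT L0 LC CT0 (xs := fun k => iter k T x)) => //.
  - by move=> c k; exact: (T_act HV J HTpa c k hx).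
  - exact: farout.
  apply: (resolv_outside HV HU) => Dw.
  have [] := hD _ Dw; case: (outer_far L0 hD he ht); lra.
move=> e /inout/apx[S hS hs]; apply: (econt_mul ID IZ II Inorm hs _ hS) => t _.
by apply: (ccontX (z := seg e.2.1 e.2.2)); exact: ccont_seg.
Qed.

End Contour.

(** * The operator-valued contour integral *)

Lemma ccont_uniform (R : realType) (z : R -> R[i]) (a b : R) : (forall t, a <= t <= b -> ccont z t) ->
  forall e : R, 0 < e -> exists2 d : R, 0 < d & forall u v : R, a <= u <= b -> a <= v <= b ->
    `|u - v| < d -> normc (z u - z v) <= e.
Proof.
move=> hz e e0; have e2 : 0 < e / 2 by rewrite divr_gt0.
have [d1 d10 h1] := ucont_continuous (fun t ht => (hz t ht).1) e2.
have [d2 d20 h2] := ucont_continuous (fun t ht => (hz t ht).2) e2.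
exists (Num.min d1 d2) => [|u v hu hv]; first by rewrite lt_min d10.
rewrite lt_min => /andP[k1 k2]; apply: le_trans (normc_le_sum _) _.
by rewrite !raddfB /= (splitr e) lerD ?h1 ?h2.
Qed.

Section Integral.
Variables (R : realType) (V : completeNormedModType R).
Variables (lm : oct R -> V -> V) (rm : V -> oct R -> V).
Hypothesis HV : banach_O_bimodule lm rm.
Variable J : oct R.
Hypothesis HJ : in_S J.
Local Notation C := (R[i]).
Local Notation rmJ := (rmJ rm J).
Local Notation act := (cact rmJ).
Variable T : V -> V.
Hypothesis HTpa : power_assoc lm rm T.
Variable U : set (oct R).
Hypothesis HU : left_admissible lm rm T U.
Local Notation outside := (outside J U).
Local Notation resolv := (resolv rm J T).

Let ID := rmJD HV J.
Let IZ := rmJZ HV J.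
Let II := rmJJ HV HJ.
Let Inorm := rmJ_norm HV HJ.
Let TD := T_add HTpa.
Let TB := T_opp HTpa.

(** Substitute for the resolvent identity: subtracting the two equations gives [(w - w') F(w')] up
    to sign as the image of the difference, and the lower bound is applied twice. *)
Lemma resolv_lipschitz mu x w w' : 0 < mu -> bounded_below rmJ T mu w -> bounded_below rmJ T mu w' ->
  outside w -> outside w' ->
  `|resolv x w| <= mu^-1 * `|x| /\
  `|resolv x w - resolv x w'| <= normc (w - w') * (mu^-1 * (mu^-1 * `|x|)).
Proof.
move=> mu0 low low' ow ow'.
have bd v : bounded_below rmJ T mu v -> outside v -> `|resolv x v| <= mu^-1 * `|x|.
  move=> lv ov; have := lv (resolv x v); rewrite (resolv_outside HV HU x ov).
  by rewrite -ler_pdivlMl.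
split; first exact: bd.
have := low (resolv x w - resolv x w').
rewrite (resopB ID IZ TD TB) (resolv_outside HV HU x ow) (resop_near rmJ T w' w) (resolv_outside HV HU x ow').
rewrite opprD addrA subrr add0r normrN (act_norm Inorm) -ler_pdivlMl // => /le_trans; apply.
rewrite mulrCA ler_wpM2l ?normc_ge0 // ler_wpM2l ?bd //.
by rewrite invr_ge0 ltW.
Qed.

Variables (c : pcurve R) (m : nat).
Hypothesis hc : C1_jordan c.
Hypothesis co : forall t, ca c <= t <= cb c -> outside (cz c t).
Local Notation a := (ca c).
Local Notation b := (cb c).

Definition resolv_integrand x t := act (cz c t ^+ m * cz' c t) (resolv x (cz c t)).

Lemma curve_weight_cont t : ccont (fun t => cz c t ^+ m * cz' c t) t.
Proof. apply: ccontM (cz'_cont hc t); by apply: (ccontX (z := cz c)); exact: cz_ccont. Qed.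

(** The modulus scales with the norm of [x], so one [d] serves all vectors, as convergence in
    operator norm demands. *)
Lemma integrand_equicont e : 0 < e -> exists2 d : R, 0 < d & forall x u v,
  a <= u <= b -> a <= v <= b -> `|u - v| < d ->
  `|resolv_integrand x u - resolv_integrand x v| <= e * `|x|.
Proof.
move=> e0; have [t _|M M0 hM] := @ccont_bounded R (cz c) a b; first exact: cz_ccont.
have [t _|Q Q0 hQ] := @ccont_bounded R (fun t => cz c t ^+ m * cz' c t) a b.
  exact: curve_weight_cont.
have [mu mu0 hmu] := uniform_lower HV HJ HU M.
have low t : a <= t <= b -> bounded_below rmJ T mu (cz c t).
  move=> ht; apply: hmu; last exact: co.
  by split; rewrite -ler_norml; apply: le_trans (hM t ht);
    [exact: Re_le_normc | exact: Im_le_normc].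
(* One half of [e] pays for the change of the weight against the bound [|x| / mu] of the resolvent,
   the other for the change of the resolvent against the bound [Q] of the weight. *)
have e1 : 0 < e * mu / 2 by rewrite divr_gt0 ?mulr_gt0.
have e2 : 0 < e * mu * mu / (2 * Q) by rewrite divr_gt0 ?mulr_gt0.
have [d1 d10 h1] := ccont_uniform (fun t (_ : a <= t <= b) => curve_weight_cont t) e1.
have [d2 d20 h2] := ccont_uniform (fun t (_ : a <= t <= b) => cz_ccont t hc) e2.
exists (Num.min d1 d2) => [|x u v hu hv]; first by rewrite lt_min d10.
rewrite lt_min => /andP[k1 k2]; rewrite /resolv_integrand.
have := h1 u v hu hv k1; have := h2 u v hu hv k2; have := hQ v hv.
have [bu duv] := resolv_lipschitz x mu0 (low u hu) (low v hv) (co hu) (co hv).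
move: (cz c u ^+ m * _) (cz c v ^+ m * _) => qu qv hqv hcuv hquv.
have -> : act qu (resolv x (cz c u)) - act qv (resolv x (cz c v)) =
    act (qu - qv) (resolv x (cz c u)) + act qv (resolv x (cz c u) - resolv x (cz c v)).
  by rewrite (actBl rmJ qu qv) (actB ID IZ qv) addrA subrK.
apply: le_trans (ler_normD _ _) _; rewrite !(act_norm Inorm).
have mui : 0 <= mu^-1 by rewrite invr_ge0 ltW.
have -> : e * `|x| = (e * mu / 2) * (mu^-1 * `|x|) +
    Q * ((e * mu * mu / (2 * Q)) * (mu^-1 * (mu^-1 * `|x|))).
  by field; rewrite !gt_eqF.
apply: lerD; first by apply: ler_pM; rewrite ?normc_ge0.
apply: ler_pM; rewrite ?normc_ge0 //; apply: le_trans duv _.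
by rewrite ler_wpM2r // !mulr_ge0.
Qed.

(** The strong form of [prim_construct] is kept, so that the primitives for all [x] share the
    modulus of [integrand_equicont]. *)
Lemma integrand_prim_exists x : exists G : R -> V, forall e d : R, 0 < d -> 0 <= e ->
  (forall u v, a <= u <= b -> a <= v <= b -> `|u - v| < d ->
     `|resolv_integrand x u - resolv_integrand x v| <= e) ->
  prim_mod (resolv_integrand x) G a b e d.
Proof.
apply: prim_construct (jordan_ab hc) _ => e e0.
have x1 : 0 < `|x| + 1 by rewrite ltr_wpDl.
have [d d0 hd] := integrand_equicont (divr_gt0 e0 x1); exists d => // u v hu hv uv.
apply: le_trans (hd x u v hu hv uv) _.
by rewrite mulrAC ler_pdivrMr // ler_wpM2l ?(ltW e0) // lerDl.
Qed.

Definition integrand_prim x : R -> V := proj1_sig (cid (integrand_prim_exists x)).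

Lemma integrand_primP x e d : 0 < d -> 0 <= e ->
  (forall u v, a <= u <= b -> a <= v <= b -> `|u - v| < d ->
     `|resolv_integrand x u - resolv_integrand x v| <= e) ->
  prim_mod (resolv_integrand x) (integrand_prim x) a b e d.
Proof. exact: (proj2_sig (cid (integrand_prim_exists x))). Qed.

Lemma integrand_prim_prim x : prim (resolv_integrand x) (integrand_prim x) a b.
Proof.
move=> e e0; have x1 : 0 < `|x| + 1 by rewrite ltr_wpDl.
have [d d0 hd] := integrand_equicont (divr_gt0 e0 x1); exists d => //.
apply: (integrand_primP d0 (ltW e0)) => u v hu hv uv.
apply: le_trans (hd x u v hu hv uv) _.
by rewrite mulrAC ler_pdivrMr // ler_wpM2l ?(ltW e0) // lerDl.
Qed.

(** The factor [-i] comes from [ds_J = - ds J]; the sum over components is the form of the right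
    action found in [odot_ext]. *)
Definition ocoords (f : V -> V) (v : V) : V :=
  \sum_(i < 8) rm (act (- 'i%C) (f (ocomp lm rm v i))) (eb i).

Lemma contour_integrandE t v : a <= t <= b ->
  contour_integrand lm rm T J m c t v = ocoords (resolv_integrand^~ t) v.
Proof.
move=> ht; have ow := co ht; have [[hD [hZ _]] _ _] := opinvP (outside_inv HU ow).
have pE : omul (omul (- cJ J (derive1 (cx c) t) (derive1 (cy c) t)) J)
     (opow (cJ J (cx c t) (cy c t)) m) = oz J (- 'i%C * (cz c t ^+ m * cz' c t)).
  have iE : J = oz J 'i%C by rewrite /oz /cJ /= scale0r add0r scale1r.
  have nE : - cJ J (derive1 (cx c) t) (derive1 (cy c) t) = oz J (- cz' c t).
    by rewrite /oz /cJ /= !scaleNr opprD.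
  rewrite [X in omul (omul _ X) _]iE nE -[cJ J (cx c t) (cy c t)]/(oz J (cz c t)).
  by rewrite -(ozX HJ) -!(ozM HJ); congr (oz J _); ring.
rewrite /contour_integrand /circ_inv pE (odot_ext HV _ _ hD hZ) /ocoords.
apply: eq_bigr => i _; rewrite /resolv_integrand -(actM ID IZ II) (act_oz HV).
by rewrite (resolv_opinv HV HU _ ow).
Qed.

(** 16 counts eight components, each of norm at most twice that of [v]. *)
Lemma ocoords_norm f (K : R) v : (forall x, `|f x| <= K * `|x|) -> 0 <= K ->
  `|ocoords f v| <= 16 * K * `|v|.
Proof.
move=> hf K0; apply: le_trans (ler_norm_sum _ _ _) _.
have -> : 16 * K * `|v| = \sum_(i < 8) (K * (2 * `|v|)).
  by rewrite sumr_const card_ord -mulr_natl; ring.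
apply: ler_sum => i _; rewrite (rm_norm HV) onorm_eb mul1r (act_norm Inorm).
have -> : normc (- 'i%C) = 1 :> R by rewrite /normc /= oppr0 expr0n /= add0r sqrrN expr1n sqrtr1.
rewrite mul1r; apply: le_trans (hf _) _; rewrite ler_wpM2l //; exact: (ocomp_norm HV).
Qed.

Lemma ocoordsB f g v : ocoords f v - ocoords g v = ocoords (fun x => f x - g x) v.
Proof.
by rewrite /ocoords -sumrB; apply: eq_bigr => i _; rewrite -(rmNl HV) -(rmDl HV) -(actB ID IZ).
Qed.

Lemma ocoords_sum (K : Type) (s : seq K) (P : pred K) (r : K -> R) (f : K -> V -> V) v :
  \sum_(j <- s | P j) r j *: ocoords (f j) v = ocoords (fun x => \sum_(j <- s | P j) r j *: f j x) v.
Proof.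
rewrite /ocoords; under eq_bigr do rewrite scaler_sumr.
rewrite exchange_big; apply: eq_bigr => i _ /=; rewrite (act_sum ID IZ) (rm_sum HV).
by apply: eq_bigr => j _; rewrite (actZ IZ) (rmZl HV).
Qed.

(** Riemann sums commute with [ocoords], so the error in operator norm is at most 16 times the
    relative error of the Riemann sums of [resolv_integrand], uniformly in the vector. *)
Lemma contour_is_oint : is_oint (contour_integrand lm rm T J m c) a b
  (ocoords (fun x => integrand_prim x b - integrand_prim x a)).
Proof.
have ba : 0 < b - a by rewrite subr_gt0 (jordan_ab hc).
move=> e e0; have e1 : 0 < e / (16 * (b - a)) by rewrite divr_gt0 ?mulr_gt0.
have [d d0 hd] := integrand_equicont e1; exists d => // p tg Hp v.
under eq_bigr => i _ do rewrite (contour_integrandE _ (tagged_mem Hp (ltn_ord i))).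
rewrite ocoords_sum ocoordsB.
have -> : e * `|v| = 16 * (e / (16 * (b - a)) * (b - a)) * `|v|.
  by field; rewrite gt_eqF.
apply: ocoords_norm => [x|]; last by rewrite mulr_ge0 ?ltW.
have ex0 : 0 <= e / (16 * (b - a)) * `|x| by rewrite mulr_ge0 // ltW.
have := prim_riemann (integrand_primP d0 ex0 (hd x)) Hp.
by rewrite mulrAC.
Qed.

End Integral.

Theorem mainTheorem12 (R : realType) (V : completeNormedModType R)
  (lm : oct R -> V -> V) (rm : V -> oct R -> V)
  (HV : banach_O_bimodule lm rm)
  (T : V -> V) (HT : in_BRO lm rm T) (HTpa : power_assoc lm rm T)
  (U : set (oct R)) (HU : left_admissible lm rm T U)
  (J : oct R) (HJ : in_S J) (m : nat)
  (n : nat) (cs : 'I_n -> pcurve R) (Hcs : pos_bdry_param (sliceJ U J) cs) :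
  exists Ls : 'I_n -> (V -> V),
    (forall k, is_oint (contour_integrand lm rm T J m (cs k))
                       (ca (cs k)) (cb (cs k)) (Ls k)) /\
    (forall v, (2 * pi)^-1 *: \sum_(k < n) Ls k v = iter m T v).
Proof.
have hk := fam_jordan Hcs; have co := curve_outside HJ HU Hcs.
exists (fun k => ocoords lm rm J (fun x => integrand_prim HV HJ HTpa HU m (hk k) (co k) x (cb (cs k)) -
  integrand_prim HV HJ HTpa HU m (hk k) (co k) x (ca (cs k)))); split=> [k|v].
  exact: contour_is_oint.
rewrite (eq_bigr _ (fun k _ => esym (scale1r _))).
rewrite (ocoords_sum HV J).
(* Power-associativity puts [T^m] itself into the class where [BRO_rm] applies, so both sides may be
   compared on components. *)
have -> : iter m T v = \sum_(i < 8) rm (iter m T (ocomp lm rm v i)) (eb i).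
  have [[iD [iZ _]] _] := HTpa m.
  rewrite {1}(ocomp_sum HV v).
  have -> : forall f : 'I_8 -> V, iter m T (\sum_(i < 8) f i) = \sum_(i < 8) iter m T (f i).
    move=> f; apply: (big_morph (iter m T)); first exact: iD.
    by rewrite -[in LHS](scale0r (0 : V)) iZ scale0r.
  by apply: eq_bigr => i _; apply: (BRO_rm HV _ (HTpa m)); apply: ocomp_ReV.
rewrite scaler_sumr; apply: eq_bigr => i _.
under eq_bigr do rewrite scale1r.
rewrite (contour_moment HV HJ HTpa HU Hcs (ocomp_ReV HV v i) (fun k => integrand_prim_prim HV HJ HTpa HU m (hk k) (co k) _)).
rewrite -(actM (rmJD HV J) (rmJZ HV J) (rmJJ HV HJ)).
(* The [-i] of [ds_J] meets the [2 pi i] of the residue, and the real factor [2 pi] is left. *)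
have -> : (- 'i%C * (0 +i* (2 * pi))%C) = ((2 * pi) +i* 0)%C :> R[i].
  by apply/eqP; rewrite eq_complex /=; apply/andP; split; apply/eqP; ring.
rewrite /cact /= scale0r addr0 (rmZl HV) scalerA mulVf ?scale1r //.
by rewrite mulf_neq0 // gt_eqF // pi_gt0.
Qed.
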